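(* Let $k$ be a perfect field of characteristic $p\ge5$ and $R_{p,4}=k[x_0,\dots,x_4]/(x_0^2+\cdots+x_4^2)$. Then the HK density function $f=f_{R_{p,4},\mathbf m}$ is: $f(x)=x^3/3$ for $0\le x<1$; $f(x)=\frac{x^3}{3}-\frac53(x-1)^3$ for $1\le x<2$; $f(x)=\frac{x^3}3-\frac53(x-1)^3+\frac{11}3(x-2)^3$ for $2\le x<2+P_1$; for every $j\ge1$ and $2+P_j\le x<2+P_{j+1}$: $$f(x)=\frac{(3-x)^3}{3}+\frac43\sum_{i=1}^{j}\Big[\frac1{p^i}+P_i+2-x\Big]^3\mu_{-1}\overline{\mu}_{-1}^{\,i-1}+\Big[\frac83(x-2-P_j)^3-\frac4{p^j}(x-2-P_j)^2+\frac{2}{3p^{3j}}\Big]\overline{\mu}_{-1}^{\,j};$$ for every $j\ge1$ and $2+P_{j+1}+\frac1{p^{j+1}}\le x<2+P_j+\frac1{p^j}$: $$f(x)=\frac{(3-x)^3}{3}+\frac43\sum_{i=1}^{j}\Big[\frac1{p^i}+P_i+2-x\Big]^3\mu_{-1}\overline{\mu}_{-1}^{\,i-1};$$ $f(x)=\frac{(3-x)^3}3$ for $2+P_1+\frac1p\le x<3$; and $f(x)=0$ for $x\ge3$.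
   Context: $\mathbf m=(x_0,\dots,x_4)$, $\mathbf m^{[q]}=(x_0^q,\dots,x_4^q)$, and $f_{R_{p,4},\mathbf m}(x)=\lim_{s\to\infty}q^{-3}\dim_k(R_{p,4}/\mathbf m^{[q]})_{\lfloor xq\rfloor}$, $q=p^s$. Put $P_0=\frac{p-1}2$ and $P_i=\frac{p-1}{2p}\big(1+\frac1p+\cdots+\frac1{p^{i-1}}\big)$ for $i\ge1$. Let $Q_3=\mathrm{Proj}\,R_{p,4}$ over $\bar k$, $\mathcal O(m)=\mathcal O_{Q_3}(m)$, $\mathcal S$ the (rank 2) spinor bundle on $Q_3$, $F$ the absolute Frobenius of $Q_3$. Define $\mu_{-1}$ as the multiplicity of $\mathcal S(-1)$ in the (Krull–Schmidt) decomposition of $F_*\mathcal O(P_0-2)$ into line bundles $\mathcal O(t)$ and twisted spinor bundles $\mathcal S(t)$, and $\overline\mu_{-1}$ as the multiplicity of $\mathcal S(-1)$ in the decomposition of $F_*\mathcal S(P_0-1)$. Explicitly, with $Y_m=\binom{m+4}{4}-\binom{m+2}{4}$ ($m\ge0$) and $h^0(\mathcal S(m))=4\big(\binom{m+3}{4}-\binom{m+2}{4}\big)$: $4\mu_{-1}=Y_{a+2p}-5Y_{a+p}+11Y_a-Y_{p-a-3}$ with $a=P_0-2$, and $4\overline\mu_{-1}=h^0(\mathcal S(b+2p))-5h^0(\mathcal S(b+p))+11h^0(\mathcal S(b))-h^0(\mathcal S(p-b-2))$ with $b=P_0-1$. *)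

(* Defs.v *)
From HB Require Import structures.
From mathcomp Require Import all_boot all_order all_algebra.
From mathcomp Require Import mpoly.
From Stdlib Require Import ClassicalEpsilon.
Set Implicit Arguments. Unset Strict Implicit. Unset Printing Implicit Defensive.
Import Order.TTheory GRing.Theory Num.Theory.
Local Open Scope ring_scope.

Definition perfect_char (k : fieldType) (p : nat) : Prop :=
  p \in [pchar k] /\ forall x : k, exists y : k, y ^+ p = x.

Definition quadric (k : fieldType) : {mpoly k[5]} :=
  \sum_(i < 5) 'X_i ^+ 2.

(* Generators of the ideal (Q, x_0^q, ..., x_4^q) of k[x_0..x_4]; the quotient
   k[x]/(Q, x_i^q) is R_{p,4} / m^[q]. *)
Definition gens (k : fieldType) (q : nat) (j : 'I_6) : {mpoly k[5]} :=
  match unlift ord0 j with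
  | None => quadric k
  | Some i => 'X_i ^+ q
  end.

Definition in_ideal (k : fieldType) (q : nat) (f : {mpoly k[5]}) : Prop :=
  exists c : 'I_6 -> {mpoly k[5]}, f = \sum_(j < 6) c j * gens k q j.

(* n homogeneous polynomials of degree d, linearly independent modulo the ideal,
   i.e. linearly independent elements of (R_{p,4}/m^[q])_d. *)
Definition indep_mod (k : fieldType) (q d n : nat) : Prop :=
  exists f : 'I_n -> {mpoly k[5]},
    (forall i, f i \is d.-homog) /\
    (forall c : 'I_n -> k, in_ideal q (\sum_(i < n) c i *: f i) ->
       forall i, c i = 0).

Definition is_graded_dim (k : fieldType) (q d n : nat) : Prop :=
  indep_mod k q d n /\ (forall m, indep_mod k q d m -> (m <= n)%N).

Definition graded_dim (k : fieldType) (q d : nat) : nat :=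
  epsilon (inhabits 0%N) (is_graded_dim k q d).

Definition seq_cvg (R : realFieldType) (u : nat -> R) (l : R) : Prop :=
  forall eps : R, 0 < eps -> exists N : nat, forall s, (N <= s)%N -> `|u s - l| < eps.

Definition HK_density_at (k : fieldType) (p : nat) (R : archiRealFieldType)
    (x l : R) : Prop :=
  seq_cvg (fun s : nat =>
     (graded_dim k (p ^ s) (Num.truncn (x * (p ^ s)%:R)))%:R / ((p ^ s) ^ 3)%:R) l.

Definition Yf (m : nat) : nat := ('C(m + 4, 4) - 'C(m + 2, 4))%N.
Definition h0S (m : nat) : nat := (4 * ('C(m + 3, 4) - 'C(m + 2, 4)))%N.

Definition P0 (p : nat) : nat := (p - 1) %/ 2.

Definition Pi (R : fieldType) (p i : nat) : R :=
  ((p%:R - 1) / (2 * p%:R)) * \sum_(t < i) (p%:R ^+ t)^-1.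

Definition mu (R : fieldType) (p : nat) : R :=
  let a := (P0 p - 2)%N in
  ((Yf (a + 2 * p))%:R - 5 * (Yf (a + p))%:R + 11 * (Yf a)%:R
     - (Yf (p - a - 3))%:R) / 4.

Definition mubar (R : fieldType) (p : nat) : R :=
  let b := (P0 p - 1)%N in
  ((h0S (b + 2 * p))%:R - 5 * (h0S (b + p))%:R + 11 * (h0S b)%:R
     - (h0S (p - b - 2))%:R) / 4.

Definition tailsum (R : fieldType) (p j : nat) (x : R) : R :=
  (3 - x) ^+ 3 / 3 +
  4 / 3 * \sum_(1 <= i < j.+1)
     ((p%:R ^+ i)^-1 + Pi R p i + 2 - x) ^+ 3 * mu R p * mubar R p ^+ i.-1.

(* Main.v *)
Require Import Defs.
From HB Require Import structures.
From mathcomp Require Import all_boot all_order all_algebra.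
From mathcomp Require Import mpoly.
From mathcomp Require Import zify ring lra.
From Stdlib Require Import ClassicalEpsilon.
Set Implicit Arguments. Unset Strict Implicit. Unset Printing Implicit Defensive.
Import Order.TTheory GRing.Theory Num.Theory.
Local Open Scope ring_scope.

(** Write [A_q = k[x_0..x_4] / (x_i^q)] and [Q = x_0^2 + ... + x_4^2].  Since [A_q] is
    self-dual and [Q] is self-adjoint, the dimension of [R / m^[q]] in degree [d] is the
    dimension of [ker Q] on [A_q] in degree [5q - 5 - d].

    For [q = p r], put [y_i = x_i^r].  Then [A_q] is free over [A_p = k[y] / (y_i^p)] with
    fibre [A_r], and [Q] becomes the pencil [D_0 + sum_i y_i D_i], where [D_0] is
    multiplication by [Q] on [A_r]; its [r]-th power is [sum_i y_i^2].  Over [A_p] the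
    kernel of [sum_i y_i^2] agrees with the image of its [(p-1)]-st power below the middle
    degree [5 (p-1) / 2].  Hence, in the range needed, an element of [ker Q] that is not in
    the image of [Q^(q-1)] is determined by its component in the middle [y]-degree, whose
    coefficients lie in [ker D_0].  Modulo the image of [D_0], the maps [D_i] kill the part of
    [ker D_0] in the image of [D_0^(r-1)], which leaves the quadric itself as a condition and
    contributes [4 mu]; on a complement they form a linear matrix factorization of the
    quadric and contribute [mubar].  The resulting recursion from [q] to [q / p] is exact;
    iterating it and dividing by [q^3] gives the density. *)

(** Exactness below the middle is a Lefschetz property in characteristic [p]. It is proved one
    variable at a time by differentiating power series, which inverts only integers below [p]; hence
    it is established over [A_p] and reaches [A_q] through the pencil.

    Kernel elements of the pencil are studied through their lowest [y]-component. Write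
    [h = (p - 1) / 2]. From the middle [y]-degree [5h] on, exactness of the quadric in [y] is no
    longer available; the range of degrees is chosen so that only two further [y]-degrees occur, and
    there the degree in [A_r] is so small that [D_0] itself is injective or exact.

    No sheaf enters: the multiplicities appear as dimensions of middle kernels, which duality over
    [A_p] determines because it relates the middle degree to one just below it.

    The breakpoints [2 + P_j] and [2 + P_j + 1/p^j] are [5/2 - 1/(2 p^j)] and [5/2 + 1/(2 p^j)].
    They surround [5/2], the limit of the middle degree [5 (q - 1) / 2] divided by [q], at the scale
    reached after [j] steps of the recursion. *)

Definition iterlin_is_linear (k : fieldType) (V : lmodType k) (f : {linear V -> V}) i :
  linear (iter i f).
Proof. by move=> c u v; elim: i => //= i ->; rewrite linearP. Qed.
HB.instance Definition _ (k : fieldType) (V : lmodType k) (f : {linear V -> V}) i :=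
  GRing.isLinear.Build k V V _ (iter i f) (iterlin_is_linear f i).

(** * Truncated polynomials in five variables *)

(* An element of [{ffun mon n -> W}] is a polynomial in [x_0, ..., x_4], truncated by
   [x_i ^ n = 0], with coefficients in [W].  On these, [mulX i r] is multiplication by
   [x_i ^ r], [hcomp t] the component of degree [t], [Qop] multiplication by
   [\sum_i x_i ^ 2], and [Pen f] the action of the linear pencil [\sum_i x_i f_i]. *)
Definition mon n := {ffun 'I_5 -> 'I_n}.

Definition wt n (a : mon n) := (\sum_i a i)%N.

Lemma osub_proof n (a : 'I_n) r : (a - r < n)%N.
Proof. exact: leq_ltn_trans (leq_subr _ _) (ltn_ord a). Qed.

(** Truncated at [0]; [mulX] reads it only where [r <= a i]. *)
Definition osub n (a : 'I_n) r := Ordinal (osub_proof a r).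

Definition msub n (a : mon n) i r : mon n :=
  [ffun j => if j == i then osub (a j) r else a j].

Lemma msubE n (a : mon n) i r j :
  msub a i r j = (a j - (if j == i then r else 0))%N :> nat.
Proof. by rewrite ffunE; case: eqP => _ //=; rewrite subn0. Qed.

Lemma mon_eqP n (a b : mon n) : (forall j, a j = b j :> nat) -> a = b.
Proof. by move=> h; apply/ffunP => j; apply/val_inj/h. Qed.

Lemma wt_msub n (a : mon n) i r : (r <= a i)%N -> (wt (msub a i r) + r)%N = wt a.
Proof.
move=> h; rewrite /wt (bigD1 i) //= [in RHS](bigD1 i) //= msubE eqxx.
under eq_bigr => j ji do rewrite msubE (negbTE ji) subn0.
lia.
Qed.

Section MulX.
Variables (k : fieldType) (n : nat).
Implicit Types (W : lmodType k) (i j : 'I_5) (r s t : nat).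

Definition mulX W i r (v : {ffun mon n -> W}) : {ffun mon n -> W} :=
  [ffun a : mon n => if (r <= a i)%N then v (msub a i r) else 0].

Lemma mulXE W i r (v : {ffun mon n -> W}) a :
  mulX i r v a = if (r <= a i)%N then v (msub a i r) else 0.
Proof. by rewrite ffunE. Qed.

Definition clift W W' (f : W -> W') (v : {ffun mon n -> W}) : {ffun mon n -> W'} :=
  [ffun a => f (v a)].

Lemma cliftE W W' (f : W -> W') v a : clift f v a = f (v a).
Proof. by rewrite ffunE. Qed.

Definition hcomp W t (v : {ffun mon n -> W}) : {ffun mon n -> W} :=
  [ffun a => if wt a == t then v a else 0].

Lemma hcompE W t (v : {ffun mon n -> W}) a :
  hcomp t v a = if wt a == t then v a else 0.
Proof. by rewrite ffunE. Qed.

Lemma zeroE W a : (0 : {ffun mon n -> W}) a = 0.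
Proof. by rewrite ffunE. Qed.

Definition opE := (mulXE, cliftE, hcompE).

Fact mulX_is_linear W i r : linear (@mulX W i r).
Proof.
move=> c u v; apply/ffunP => a; rewrite ?opE ?ffunE ?opE.
by case: ifP; rewrite ?opE ?ffunE ?opE // scaler0 addr0.
Qed.
HB.instance Definition _ W i r :=
  GRing.isLinear.Build k {ffun mon n -> W} {ffun mon n -> W} _ (@mulX W i r)
    (@mulX_is_linear W i r).

Fact clift_is_linear W W' (f : {linear W -> W'}) : linear (clift f).
Proof. by move=> c u v; apply/ffunP => a; rewrite ?opE ?ffunE ?opE linearP. Qed.
HB.instance Definition _ W W' (f : {linear W -> W'}) :=
  GRing.isLinear.Build k {ffun mon n -> W} {ffun mon n -> W'} _ (clift f)
    (@clift_is_linear W W' f).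

Lemma clift_mulX W W' (f : {linear W -> W'}) i r v :
  clift f (mulX i r v) = mulX i r (clift f v).
Proof. by apply/ffunP => a; rewrite ?opE ?ffunE ?opE; case: ifP; rewrite ?linear0 // cliftE. Qed.

Lemma mulXD W i r s (v : {ffun mon n -> W}) :
  mulX i r (mulX i s v) = mulX i (r + s) v.
Proof.
apply/ffunP => a; rewrite !mulXE msubE eqxx.
have -> : (r + s <= a i)%N = (r <= a i)%N && (s <= a i - r)%N by lia.
case: ifP => //= h1; case: ifP => // h2.
by congr (v _); apply: mon_eqP => j; rewrite !msubE; case: eqP; lia.
Qed.

Lemma mulXC W i j r s (v : {ffun mon n -> W}) :
  mulX i r (mulX j s v) = mulX j s (mulX i r v).
Proof.
have [<-|ij] := eqVneq i j; first by rewrite !mulXD addnC.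
apply/ffunP => a; rewrite !mulXE !msubE (eq_sym j) (negbTE ij) !subn0.
case: ifP => h1; case: ifP => h2 //.
by congr (v _); apply: mon_eqP => l; rewrite !msubE; do 2!case: eqP; lia.
Qed.

Lemma mulX_ge W i r (v : {ffun mon n -> W}) : (n <= r)%N -> mulX i r v = 0.
Proof.
move=> h; apply/ffunP => a; rewrite ?opE ?ffunE ?opE; case: ifP => // h1.
by have := ltn_ord (a i); lia.
Qed.

Fact hcomp_is_linear W t : linear (@hcomp W t).
Proof.
by move=> c u v; apply/ffunP => a; rewrite ?opE ?ffunE ?opE; case: ifP; rewrite // scaler0 addr0.
Qed.
HB.instance Definition _ W t :=
  GRing.isLinear.Build k {ffun mon n -> W} {ffun mon n -> W} _ (@hcomp W t)
    (@hcomp_is_linear W t).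

Lemma hcomp_mulX W i r t (v : {ffun mon n -> W}) :
  hcomp (t + r) (mulX i r v) = mulX i r (hcomp t v).
Proof.
apply/ffunP => a; rewrite ?opE ?ffunE ?opE.
have [h|h] := leqP r (a i); last by rewrite if_same.
by rewrite -(wt_msub h) eqn_add2r.
Qed.

Lemma hcomp_mulX0 W i r t (v : {ffun mon n -> W}) :
  (t < r)%N -> hcomp t (mulX i r v) = 0.
Proof.
move=> tr; apply/ffunP => a; rewrite ?opE ?ffunE ?opE.
have [h|h] := leqP r (a i); last by rewrite if_same.
by have := wt_msub h; case: eqP => // ->; lia.
Qed.

Lemma hcomp_clift W W' (f : {linear W -> W'}) t v :
  hcomp t (clift f v) = clift f (hcomp t v).
Proof. by apply/ffunP => a; rewrite ?opE ?ffunE ?opE; case: ifP; rewrite ?linear0. Qed.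

Lemma hcomp_id W t (v : {ffun mon n -> W}) : hcomp t (hcomp t v) = hcomp t v.
Proof. by apply/ffunP => a; rewrite ?opE ?ffunE ?opE; case: (wt a == t). Qed.

Lemma hcomp_neq W s t (v : {ffun mon n -> W}) : s != t -> hcomp s (hcomp t v) = 0.
Proof.
by move=> st; apply/ffunP => a; rewrite ?opE ?ffunE ?opE; case: eqP => // ->; rewrite (negbTE st).
Qed.

Lemma sum_hcomp W (v : {ffun mon n -> W}) b :
  (forall t, (b <= t)%N -> hcomp t v = 0) -> v = \sum_(t < b) hcomp t v.
Proof.
move=> h; apply/ffunP => a; rewrite sum_ffunE.
have [wb|wb] := ltnP (wt a) b.
  rewrite (bigD1 (Ordinal wb)) //= ffunE eqxx big1 ?addr0 // => t tw.
  by rewrite ?opE ?ffunE; case: eqP => // e; case/eqP: tw; apply: val_inj.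
rewrite big1 => [|t _].
  by have /ffunP/(_ a) := h _ wb; rewrite ?opE ?ffunE ?opE eqxx.
by rewrite ?opE ?ffunE; case: eqP => // e; have := ltn_ord t; rewrite -e; lia.
Qed.

Lemma hcomp_ext W (u v : {ffun mon n -> W}) : (forall t, hcomp t u = hcomp t v) -> u = v.
Proof.
by move=> h; apply/ffunP => a; have /ffunP/(_ a) := h (wt a); rewrite ?opE ?ffunE ?opE eqxx.
Qed.

Definition Qop W (v : {ffun mon n -> W}) := \sum_i mulX i 2 v.

Fact Qop_is_linear W : linear (@Qop W).
Proof.
move=> c u v; rewrite /Qop scaler_sumr -big_split /=.
by apply: eq_bigr => i _; rewrite linearP.
Qed.
HB.instance Definition _ W :=
  GRing.isLinear.Build k {ffun mon n -> W} {ffun mon n -> W} _ (@Qop W)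
    (@Qop_is_linear W).

Definition Pen W W' (f : 'I_5 -> W -> W') (v : {ffun mon n -> W}) : {ffun mon n -> W'} :=
  \sum_i mulX i 1 (clift (f i) v).

Fact Pen_is_linear W W' (f : 'I_5 -> {linear W -> W'}) : linear (Pen f).
Proof.
move=> c u v; rewrite /Pen scaler_sumr -big_split /=.
by apply: eq_bigr => i _; rewrite !linearP.
Qed.
HB.instance Definition _ W W' (f : 'I_5 -> {linear W -> W'}) :=
  GRing.isLinear.Build k {ffun mon n -> W} {ffun mon n -> W'} _
    (Pen (fun i => f i : W -> W')) (@Pen_is_linear W W' f).

Lemma clift_Qop W W' (f : {linear W -> W'}) v : clift f (Qop v) = Qop (clift f v).
Proof. by rewrite /Qop linear_sum; apply: eq_bigr => i _; rewrite /= clift_mulX. Qed.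

Lemma Qop_mulX W i r (v : {ffun mon n -> W}) : Qop (mulX i r v) = mulX i r (Qop v).
Proof. by rewrite /Qop linear_sum; apply: eq_bigr => j _; rewrite /= mulXC. Qed.

Lemma Qop_Pen W W' (f : 'I_5 -> {linear W -> W'}) v : Qop (Pen f v) = Pen f (Qop v).
Proof.
rewrite /Pen linear_sum; apply: eq_bigr => j _ /=.
by rewrite Qop_mulX clift_Qop.
Qed.

Lemma hcomp_Qop W t (v : {ffun mon n -> W}) : hcomp (t + 2) (Qop v) = Qop (hcomp t v).
Proof. by rewrite /Qop linear_sum; apply: eq_bigr => i _; rewrite /= hcomp_mulX. Qed.

Lemma hcomp_Qop0 W t (v : {ffun mon n -> W}) : (t < 2)%N -> hcomp t (Qop v) = 0.
Proof. by move=> h; rewrite /Qop linear_sum big1 // => i _; rewrite /= hcomp_mulX0. Qed.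

Lemma hcomp_Pen W W' (f : 'I_5 -> {linear W -> W'}) t v :
  hcomp (t + 1) (Pen f v) = Pen f (hcomp t v).
Proof. by rewrite /Pen linear_sum; apply: eq_bigr => i _; rewrite /= hcomp_mulX hcomp_clift. Qed.

Lemma hcomp_Pen0 W W' (f : 'I_5 -> {linear W -> W'}) v : hcomp 0 (Pen f v) = 0.
Proof. by rewrite /Pen linear_sum big1 // => i _; rewrite /= hcomp_mulX0. Qed.

Lemma hcomp_PenS W W' (f : 'I_5 -> {linear W -> W'}) t v :
  hcomp t.+1 (Pen f v) = Pen f (hcomp t v).
Proof. by have := hcomp_Pen f t v; rewrite addn1. Qed.

Lemma hcomp_QS W t (v : {ffun mon n -> W}) : hcomp t.+2 (Qop v) = Qop (hcomp t v).
Proof. by have := hcomp_Qop t v; rewrite addn2. Qed.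

Lemma hcomp_iterQ W t (j : nat) (v : {ffun mon n -> W}) :
  hcomp (t + 2 * j) (iter j (@Qop W) v) = iter j (@Qop W) (hcomp t v).
Proof.
elim: j => [|j IH]; first by rewrite muln0 addn0.
by rewrite (_ : (t + 2 * j.+1 = (t + 2 * j) + 2)%N) /= ?hcomp_Qop ?IH //; lia.
Qed.

Lemma hcomp_iterQ0 W t (j : nat) (v : {ffun mon n -> W}) : (t < 2 * j)%N ->
  hcomp t (iter j (@Qop W) v) = 0.
Proof.
elim: j t => [|j IH] t h; first by lia.
have [t2|t2] := ltnP t 2; first by rewrite /= hcomp_Qop0.
by rewrite -(subnK t2) /= hcomp_Qop IH ?linear0 //; lia.
Qed.

Lemma iterQ_comm W W' (f : {linear {ffun mon n -> W} -> {ffun mon n -> W'}}) :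
  (forall v, Qop (f v) = f (Qop v)) ->
  forall (j : nat) v, iter j (@Qop W') (f v) = f (iter j (@Qop W) v).
Proof. by move=> h; elim=> //= j IH v; rewrite IH h. Qed.

Lemma clift_iterQ W W' (f : {linear W -> W'}) (j : nat) v :
  clift f (iter j (@Qop W) v) = iter j (@Qop W') (clift f v).
Proof. by elim: j => //= j IH; rewrite clift_Qop IH. Qed.

End MulX.

(** * Exactness up to the middle degree *)

Section TruncatedSeries.
Variables (k : fieldType) (V : lmodType k) (T : {linear V -> V}).
Implicit Types (u v w : nat -> V).

Definition prv u (j : nat) : V := if j is j'.+1 then u j' else 0.

(* [u] stands for the series [\sum_j u_j z^j], and [shS] is multiplication by [T + z]. *)
Definition shS u (j : nat) : V := T (u j) + prv u j.

Lemma shSE u j : shS u j = T (u j) + prv u j. Proof. by []. Qed.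

Lemma shS_ext u v : u =1 v -> shS u =1 shS v.
Proof. by move=> h [|j]; rewrite !shSE /= !h. Qed.

Lemma iterS_ext i u v : u =1 v -> iter i shS u =1 iter i shS v.
Proof. by move=> h; elim: i => //= i; apply: shS_ext. Qed.

Lemma iterS_loc i a u v : (forall j, (j < a)%N -> u j = v j) ->
  forall j, (j < a)%N -> iter i shS u j = iter i shS v j.
Proof.
move=> h; elim: i => //= i IH [|j] ja; rewrite !shSE /= IH //.
by rewrite IH // ltnW.
Qed.

Lemma shS_lin (c : k) u v :
  shS (fun j => c *: u j + v j) =1 fun j => c *: shS u j + shS v j.
Proof.
move=> j; rewrite !shSE linearP scalerDr.
by case: j => [|j]; rewrite /= ?scaler0 ?addr0 // addrACA.
Qed.

Lemma iterS_lin i (c : k) u v :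
  iter i shS (fun j => c *: u j + v j) =1 fun j => c *: iter i shS u j + iter i shS v j.
Proof. by elim: i => //= i IH j; rewrite (shS_ext IH) shS_lin. Qed.

Lemma shS0 j : shS (fun=> 0) j = 0.
Proof. by rewrite shSE linear0; case: j => [|j]; rewrite addr0. Qed.

Lemma iterS0 i j : iter i shS (fun=> 0) j = 0.
Proof. by elim: i j => //= i IH j; rewrite (shS_ext IH) shS0. Qed.

Lemma iterSZ i (c : k) u : iter i shS (fun j => c *: u j) =1 fun j => c *: iter i shS u j.
Proof.
move=> j; rewrite -[RHS]addr0 -(iterS0 i j) -iterS_lin.
by apply: iterS_ext => l; rewrite addr0.
Qed.

Definition der u (j : nat) : V := j.+1%:R *: u j.+1.

Lemma der_shS u j : der (shS u) j = shS (der u) j + u j.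
Proof.
rewrite /der !shSE /= scalerDr linearZ /= -!addrA; congr (_ + _).
case: j => [|j] /=; first by rewrite scale1r add0r.
by rewrite (mulrSr 1 j.+1) scalerDl scale1r.
Qed.

(** Leibniz rule for the derivative in [z], since that of [(T + z)^(i+1)] is [(i+1) (T + z)^i]. *)
Lemma der_iterS i u j :
  der (iter i.+1 shS u) j = iter i.+1 shS (der u) j + i.+1%:R *: iter i shS u j.
Proof.
elim: i j => [|i IH] j; first by rewrite /= der_shS scale1r.
rewrite iterS der_shS.
have -> : shS (der (iter i.+1 shS u)) j = shS (fun j => i.+1%:R *: iter i shS u j
    + iter i.+1 shS (der u) j) j by apply: shS_ext => l; rewrite IH addrC.
rewrite shS_lin.
rewrite (mulrSr 1 i.+1) scalerDl scale1r -!iterS.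
by rewrite addrAC [LHS]addrC.
Qed.

(** The series [u - c z (u' - v)], with [u'] the derivative in [z]. For [c = 1/N] its coefficient at
    [z^N] does not involve that of [u]. *)
Definition rho (c : k) u v (j : nat) : V :=
  (1 - j%:R * c) *: u j + c *: prv v j.

Lemma shS_rho c u v : shS (rho c u v) =1 rho c (shS u) (fun j => shS v j + u j).
Proof.
move=> j; rewrite /rho !shSE linearD !linearZ /= !scalerDr.
case: j => [|j] /=; first by rewrite ?(linear0, scaler0, addr0).
rewrite !shSE !scalerDr /rho.
have -> : (1 - j%:R * c) *: u j = (1 - j.+1%:R * c) *: u j + c *: u j.
  by rewrite -scalerDl (mulrSr 1 j); congr (_ *: _); ring.
by rewrite -!addrA; congr (_ + _); rewrite [LHS]addrCA (addrC (c *: u j)).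
Qed.

(** Multiplication by [(T + z)^N] fails to commute with the derivative by [N (T + z)^(N-1)], which
    the second argument absorbs. *)
Lemma iterS_rho N c u v :
  iter N shS (rho c u v) =1
  rho c (iter N shS u) (fun j => iter N shS v j + N%:R *: iter N.-1 shS u j).
Proof.
elim: N => [|N IH] j.
  by rewrite /rho /=; congr (_ + _ *: _); case: j => [|j] //=; rewrite scale0r addr0.
rewrite iterS (shS_ext IH) shS_rho /rho; congr (_ + _ *: _).
case: j => [|j] //=.
have -> : shS (fun j => iter N shS v j + N%:R *: iter N.-1 shS u j) j =
    shS (fun j => N%:R *: iter N.-1 shS u j + iter N shS v j) j.
  by apply: shS_ext => l; rewrite addrC.
rewrite shS_lin (_ : N%:R *: shS (iter N.-1 shS u) j = N%:R *: iter N shS u j).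
  by rewrite (mulrSr 1 N) scalerDl scale1r addrAC [LHS]addrC.
by case: N {IH} => [|N]; rewrite ?mulr0n ?scale0r.
Qed.

Variables (p : nat) (hom : int -> V -> Prop) (C : int).
Hypotheses (pk : p%:R = 0 :> k) (nz : forall j, (0 < j < p)%N -> j%:R != 0 :> k).
Hypothesis hom0 : forall e, hom e 0.
Hypothesis homP : forall e (c : k) (x y : V), hom e x -> hom e y -> hom e (c *: x + y).
Hypothesis homT : forall e (v : V), hom e v -> hom (e + 2) (T v).

(* Below the centre [C] of symmetry, [ker T^i] is contained in [im T^(p-i)].  The property
   passes from [T] to [T + z] on series truncated at [z ^ a] by induction on [a], the
   truncation at [a + 1] being reached from the derivative of a series. *)
Definition midpoint_exact := forall (i : nat) e (v : V),
  (i <= p)%N -> hom e v -> e + i%:Z <= C -> iter i T v = 0 ->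
  exists w : V, v = iter (p - i) T w.

(** With [z] of degree 2 and [z^a = 0], the powers of [z] are symmetric about degree [a - 1], which
    is added to [C]. *)
Lemma midpoint_exact_trunc (a : nat) : midpoint_exact -> (0 < a <= p)%N ->
  forall (i : nat) e u, (i <= p)%N -> (forall j : nat, hom (e - 2 * j%:Z) (u j)) ->
  e + i%:Z <= C + a%:Z - 1 -> (forall j, (j < a)%N -> iter i shS u j = 0) ->
  exists w, forall j, (j < a)%N -> u j = iter (p - i) shS w j.
Proof.
move=> mid; case: a => [|a] //= ap.
elim: a ap => [|a IH] ap i e u ip hu ei iu.
  have [|||w hw] := mid i e (u 0%N) ip; [|lia| |].
  - by have := hu 0%N; rewrite mulr0 subr0.
  - have := iu 0%N isT; suff -> : iter i shS u 0%N = iter i T (u 0%N) by [].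
    by elim: (i) => //= l IH; rewrite shSE /= IH addr0.
  exists (fun j => if j is 0%N then w else 0) => -[|j] // _; rewrite hw.
  elim: (p - i)%N => //= l IH; by rewrite shSE /= -IH addr0.
case: i ip ei iu => [|i] ip ei iu.
  exists (fun=> 0) => j ja; rewrite iterS0; exact: iu.
(* If [p - i.+1 = 0], then [w = u]; otherwise [i.+2 <= p], as the induction hypothesis for [i.+2]
   requires. *)
have [ip'|ip'] := eqVneq i.+1 p.
  by exists u => j ja; rewrite ip' subnn.
have nzi : i.+1%:R != 0 :> k by apply: nz; lia.
have nza : a.+1%:R != 0 :> k by apply: nz; lia.
(* Differentiating [(T + z)^(i+2) u] and [(T + z)^(i+1) u] shows, modulo [z^(a+1)], that [u'] is
   killed by [(T + z)^(i+2)] and [(i+1) u + (T + z) u'] by [(T + z)^i]. The induction hypothesis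
   covers both, as [u'] has degree [e - 2]. *)
pose v := der u.
have hv j : hom (e - 2 - 2 * j%:Z) (v j).
  have := hu j.+1; rewrite (_ : e - 2 * j.+1%:Z = e - 2 - 2 * j%:Z); last by lia.
  by move=> h; rewrite /v /der -[_ *: _]addr0; apply: homP.
have Siu l j : (i < l)%N -> (j < a.+2)%N -> iter l shS u j = 0.
  move=> il ja; rewrite -(subnK il) iterD.
  by rewrite (@iterS_loc _ a.+2 _ (fun=> 0)) // iterS0.
have der0 l j : (i < l)%N -> (j < a.+1)%N -> der (iter l shS u) j = 0.
  by move=> il ja; rewrite /der Siu // scaler0.
have [||||v1 hv1] := IH _ i.+2 (e - 2) v _ hv; [lia|lia|lia| |].
  move=> j ja; have := der_iterS i.+1 u j; rewrite der0 // Siu ?scaler0 ?addr0 //; last by lia.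
have [|||||u1 hu1] := IH _ i e (fun j => i.+1%:R *: u j + shS v j); [lia|lia| |lia| |].
- move=> j; apply: homP => //; rewrite shSE -[T _]scale1r; apply: homP.
    by have /homT := hv j; congr (hom _ _); lia.
  case: j => [|j]; first exact: hom0.
  by have := hv j; congr (hom _ _); lia.
- move=> j ja; rewrite iterS_lin -iterSr.
  by have := der_iterS i u j; rewrite der0 // addrC => <-.
(* Eliminating [u'] from the two preimages gives a preimage of [u] itself, but only modulo
   [z^(a+1)]. *)
pose al j := i.+1%:R^-1 *: (shS u1 j - v1 j).
have iterN l f g j : iter l shS (fun j => f j - g j) j = iter l shS f j - iter l shS g j.
  have := iterS_lin l (-1) g f j; rewrite scaleN1r addrC => <-.
  by apply: iterS_ext => m; rewrite scaleN1r addrC.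
have hal j : (j < a.+1)%N -> u j = iter (p - i.+1) shS al j.
  move=> ja; rewrite /al iterSZ iterN -iterSr (_ : (p - i.+1).+1 = (p - i)%N); last by lia.
  rewrite -hu1 // (_ : iter (p - i.+1) shS v1 j = shS v j).
    by rewrite addrK scalerA mulVf // scale1r.
  rewrite (_ : (p - i.+1 = (p - i.+2).+1)%N); last by lia.
  apply: (@iterS_loc 1 a.+1 (iter (p - i.+2) shS v1) v) => // l la.
  by rewrite hv1.
(* As [p = 0] in [k], the factor [p - i.+1] is [-(i+1)], which cancels the inverse in [al] and
   brings [u'] into the form that [iterS_rho] produces. *)
have hvv j : (j < a.+1)%N ->
    v j = iter (p - i.+1) shS u1 j + (p - i.+1)%:R *: iter (p - i.+1).-1 shS al j.
  move=> ja; rewrite /al iterSZ iterN scalerA natrB // pk sub0r mulNr mulfV // scaleN1r.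
  rewrite -iterSr (_ : (p - i.+1).-1.+1 = (p - i.+1)%N); last by lia.
  rewrite opprB addrC subrK (_ : (p - i.+1).-1 = (p - i.+2)%N); last by lia.
  exact: hv1.
(* Below [z^(a+1)] the terms [j u_j / (a+1)] cancel; at [z^(a+1)] the uncontrolled coefficient
   coming from [al] is multiplied by [0], and [u_(a+1)] is recovered from [u']. *)
exists (rho a.+1%:R^-1 al u1) => j ja; rewrite iterS_rho /rho.
case: j ja => [|j] ja /=; first by rewrite mul0r subr0 scale1r scaler0 addr0 hal.
rewrite -hvv // /v /der scalerA.
have [ja1|ja1] := eqVneq j.+1 a.+1.
  by rewrite ja1 mulfV // mulVf // subrr scale0r add0r scale1r.
rewrite -hal; last by lia.
by rewrite -scalerDl (mulrC _ j.+1%:R) subrK scale1r.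
Qed.

End TruncatedSeries.

Section Slices.
Variables (k : fieldType) (n : nat) (W : lmodType k).
Implicit Types (u v : {ffun mon n -> W}) (i : 'I_5).

Definition mset (a : mon n) i (o : 'I_n) : mon n := [ffun l => if l == i then o else a l].

(** The coefficient of [x_i ^ j], stored as a function that ignores the exponent of [x_i]. This
    keeps one type for every number of variables. *)
Definition slice i (j : nat) v : {ffun mon n -> W} :=
  if insub j is Some o then [ffun a => v (mset a i o)] else 0.

Lemma sliceE i j v (jn : (j < n)%N) a : slice i j v a = v (mset a i (Ordinal jn)).
Proof. by rewrite /slice insubT ffunE. Qed.

Lemma slice_ge i j v : (n <= j)%N -> slice i j v = 0.
Proof. by rewrite leqNgt /slice => h; rewrite insubF //; apply/negbTE. Qed.

Fact slice_is_linear i j : linear (slice i j).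
Proof.
move=> c u v; have [jn|nj] := ltnP j n; last by rewrite !slice_ge // scaler0 addr0.
by apply/ffunP => a; rewrite !ffunE !sliceE !ffunE.
Qed.
HB.instance Definition _ i j :=
  GRing.isLinear.Build k {ffun mon n -> W} {ffun mon n -> W} _ (slice i j)
    (slice_is_linear i j).

Lemma slice_mulX_neq i i' j r v : i' != i -> slice i j (mulX i' r v) = mulX i' r (slice i j v).
Proof.
move=> ii; have [jn|nj] := ltnP j n; last by rewrite !slice_ge // linear0.
apply/ffunP => a; rewrite mulXE !sliceE !mulXE ffunE (negbTE ii).
case: ifP => // h; congr (v _); apply: mon_eqP => l.
rewrite msubE [mset _ _ _ l]ffunE [mset _ _ _ l]ffunE; case: (eqVneq l i) => [->|li].
  by rewrite eq_sym (negbTE ii) subn0.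
by rewrite msubE.
Qed.

Lemma slice_mulX i j r v : (j < n)%N ->
  slice i j (mulX i r v) = if (r <= j)%N then slice i (j - r) v else 0.
Proof.
move=> jn; apply/ffunP => a; rewrite sliceE mulXE ffunE eqxx /=.
case: ifP => h; last by rewrite ffunE.
have jrn : (j - r < n)%N by lia.
rewrite sliceE; congr (v _); apply: mon_eqP => l.
by rewrite msubE !ffunE; case: (l == i); rewrite //= subn0.
Qed.

Lemma slice_slice i l j v : (l < n)%N -> slice i l (slice i j v) = slice i j v.
Proof.
move=> ln; have [jn|nj] := ltnP j n; last by rewrite !(slice_ge _ _ nj) linear0.
apply/ffunP => a; rewrite !sliceE; congr (v _); apply/ffunP => m.
by rewrite !ffunE; case: eqP.
Qed.

Lemma slice_glue i j (f : nat -> {ffun mon n -> W}) : (j < n)%N ->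
  slice i j [ffun a : mon n => f (a i) a] = slice i j (f j).
Proof.
by move=> jn; apply/ffunP => a; rewrite !sliceE ffunE; congr (f _ _); rewrite ffunE eqxx.
Qed.

Lemma slice_inj i u v : (forall j, (j < n)%N -> slice i j u = slice i j v) -> u = v.
Proof.
move=> h; apply/ffunP => a; have /ffunP/(_ a) := h _ (ltn_ord (a i)).
rewrite !sliceE (_ : mset _ _ _ = a) //.
by apply: mon_eqP => l; rewrite ffunE; case: eqP => // ->.
Qed.

End Slices.

Section Midpoint.
Variables (k : fieldType) (p : nat) (W : lmodType k).
Hypotheses (pk : p%:R = 0 :> k) (nz : forall j, (0 < j < p)%N -> j%:R != 0 :> k).
Hypothesis (podd : odd p) (p2 : (2 < p)%N).
Local Notation V := {ffun mon p -> W}.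

Definition Qpart (m : nat) (v : V) : V := \sum_(i < 5 | (i < m)%N) mulX i 2 v.

Fact Qpart_is_linear m : linear (Qpart m).
Proof.
move=> c u v; rewrite /Qpart scaler_sumr -big_split /=.
by apply: eq_bigr => i _; rewrite linearP.
Qed.
HB.instance Definition _ m := GRing.isLinear.Build k V V _ (Qpart m) (Qpart_is_linear m).

Definition phom (m : nat) (e : int) (v : V) : Prop :=
  forall a, v a != 0 -> (\sum_(i < 5 | (i < m)%N) a i)%N%:Z = e.

Lemma phom0 m e : phom m e 0.
Proof. by move=> a; rewrite ffunE eqxx. Qed.

Lemma phomP m e (c : k) u v : phom m e u -> phom m e v -> phom m e (c *: u + v).
Proof.
move=> hu hv a; rewrite !ffunE.
have [u0|/hu //] := eqVneq (u a) 0; have [v0|/hv //] := eqVneq (v a) 0.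
by rewrite u0 v0 scaler0 addr0 eqxx.
Qed.

Lemma phomT m e v : phom m e v -> phom m (e + 2) (Qpart m v).
Proof.
move=> hv; rewrite /Qpart; elim/big_ind: _ => [|x y hx hy|i im]; first exact: phom0.
  by rewrite -[x]scale1r; apply: phomP.
move=> a; rewrite mulXE; case: ifP; rewrite ?eqxx // => h /hv <-.
rewrite (bigD1 i) //= [in RHS](bigD1 i) //= msubE eqxx.
rewrite [in RHS](eq_bigr (fun j => a j : nat)) => [|j /andP[_ ji]]; last first.
  by rewrite msubE (negbTE ji) subn0.
move: (bigop _ _ _) (nat_of_ord (a i)) h => S x h.
lia.
Qed.

Lemma slice_Qpart m (im : (m < 5)%N) j v : (j < p)%N ->
  slice (Ordinal im) j (Qpart m.+1 v) =
  Qpart m (slice (Ordinal im) j v) + (if (2 <= j)%N then slice (Ordinal im) (j - 2) v else 0).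
Proof.
move=> jp; rewrite {1}/Qpart (bigD1 (Ordinal im)) //= linearD /= slice_mulX // addrC.
congr (_ + _); rewrite linear_sum /Qpart; apply: eq_big => [i|i /andP[_ im']].
  by rewrite ltnS -val_eqE /=; lia.
by rewrite /= slice_mulX_neq.
Qed.

Lemma slice_Qpart_lt m (im : (m < 5)%N) j v :
  slice (Ordinal im) j (Qpart m v) = Qpart m (slice (Ordinal im) j v).
Proof.
rewrite linear_sum /Qpart; apply: eq_bigr => i ilm /=; rewrite slice_mulX_neq //.
by rewrite -val_eqE /=; lia.
Qed.

Lemma slice_phom m (im : (m < 5)%N) j e v : phom m.+1 e v ->
  phom m (e - j%:Z) (slice (Ordinal im) j v).
Proof.
move=> hv; have [jn|nj] := ltnP j p; last by rewrite slice_ge //; apply: phom0.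
move=> a; rewrite sliceE => /hv <-.
rewrite [in RHS](bigD1 (Ordinal im)) //= ffunE eqxx /=.
rewrite PoszD addrAC subrr add0r; congr Posz; apply: eq_big => [i|i ilm].
  by rewrite ltnS -val_eqE /=; lia.
by rewrite ffunE -val_eqE /=; case: ifP => //; lia.
Qed.

(** With [h = p./2], the even exponents of a new variable [x_m] are the powers of [z = x_m ^ 2]
    below [z ^ (h+1)], the odd ones [x_m] times those below [z ^ h]. In both cases the centre moves
    by [h]: by [(h+1) - 1], and by [1 + (h - 1)]. *)
Theorem midpoint_Qpart m : (m <= 5)%N ->
  midpoint_exact (Qpart m) p (phom m) (m * p./2)%N%:Z.
Proof.
elim: m => [|m IH] m5 i e v ip hv ei iv.
  have [v0|[a va]] : v = 0 \/ exists a, v a != 0.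
    have [->|/eqP vn] := eqVneq v 0; first by left.
    right; apply/existsP; apply: contra_notT vn => /existsPn h.
    by apply/ffunP => a; rewrite ffunE; have := h a; rewrite negbK => /eqP.
    by exists 0; rewrite linear0.
  have e0 : e = 0 by rewrite -(hv a va) big1.
  case: i ip ei iv => [|i] ip ei iv; last by lia.
  by move: va; rewrite /= in iv; rewrite iv ffunE eqxx.
pose I := Ordinal m5; pose h := p./2.
have ph : p = (h + h).+1 by rewrite /h; lia.
pose sq eps (u : V) (l : nat) := slice I (2 * l + eps) u.
pose A eps := if eps is 0%N then h.+1 else h.
have hA eps l : (eps < 2)%N -> (l < A eps)%N -> (2 * l + eps < p)%N.
  by case: eps => [|[|]] //= _; lia.
have sqS eps u : (eps < 2)%N -> forall N l, (l < A eps)%N ->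
    sq eps (iter N (Qpart m.+1) u) l = iter N (shS (Qpart m)) (sq eps u) l.
  move=> ep; elim=> // N IHN l lA; rewrite !iterS /sq slice_Qpart; last exact: hA.
  rewrite shSE; congr (_ + _); first by rewrite -IHN.
  case: l lA => [|l] lA; first by rewrite /= muln0 add0n leqNgt ep.
  rewrite /= -IHN; last by lia.
  have -> : (2 <= 2 * l.+1 + eps)%N by lia.
  by have -> : (2 * l.+1 + eps - 2 = 2 * l + eps)%N by lia.
have key eps : (eps < 2)%N -> exists w, forall l, (l < A eps)%N ->
    sq eps v l = iter (p - i) (shS (Qpart m)) w l.
  move=> ep; have m5' : (m <= 5)%N by lia.
  have mid := midpoint_exact_trunc pk nz (@phom0 m) (@phomP m) (@phomT m) (IH m5').
  apply: (mid (A eps) _ i (e - eps%:Z)) => //.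
  - by case: eps ep => [|[|]] //= _; lia.
  - move=> l; have := @slice_phom m m5 (2 * l + eps) _ _ hv; congr (phom _ _ _); lia.
  - by case: eps ep => [|[|]] //= _; lia.
  - by move=> l lA; rewrite -sqS // iv /sq linear0.
have [w0 hw0] := key 0%N isT; have [w1 hw1] := key 1%N isT.
(* Slicing at [0] makes the witnesses independent of the exponent of [x_m], so that slicing the
   glued [w] gives them back. *)
pose f j := slice I 0 ((if odd j then w1 else w0) j./2).
pose w : V := [ffun a : mon p => f (a I) a].
have hsw eps (wx := if eps is 0%N then w0 else w1) l : (eps < 2)%N -> (l < A eps)%N ->
    sq eps w l = slice I 0 (wx l).
  move=> ep lA; have jp := hA _ _ ep lA.
  rewrite /sq slice_glue // /f slice_slice //; congr (slice _ _ _).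
  have -> : odd (2 * l + eps) = odd eps by lia.
  have -> : (2 * l + eps)./2 = l by lia.
  by rewrite /wx; case: eps ep {lA jp wx} => [|[|]].
have sl0 N (wx : nat -> V) l :
    slice I 0 (iter N (shS (Qpart m)) wx l) =
    iter N (shS (Qpart m)) (fun j => slice I 0 (wx j)) l.
  elim: N l => // N IHN l; rewrite !iterS !shSE linearD /= slice_Qpart_lt IHN.
  by congr (_ + _); case: l => [|l] /=; rewrite ?linear0 // IHN.
have p0 : (0 < p)%N by lia.
exists w; apply: (@slice_inj _ _ _ I) => j jp.
have fin eps (wx := if eps is 0%N then w0 else w1) l : (eps < 2)%N -> (l < A eps)%N ->
    (forall l, (l < A eps)%N -> sq eps v l = iter (p - i) (shS (Qpart m)) (wx) l) ->
    sq eps v l = sq eps (iter (p - i) (Qpart m.+1) w) l.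
  move=> ep lA hwx; rewrite sqS //.
  rewrite (@iterS_loc _ _ _ _ _ _ (fun l => slice I 0 (wx l)) _ l lA); last first.
    by move=> l' lA'; rewrite hsw.
  rewrite -sl0 -hwx // /sq slice_slice //.
have [oj|oj] := boolP (odd j).
  have -> : j = (2 * j./2 + 1)%N by lia.
  by apply: (fin 1%N) => //=; lia.
have -> : j = (2 * j./2 + 0)%N by lia.
by apply: (fin 0%N) => //=; lia.
Qed.

End Midpoint.

Definition low (k : fieldType) n (W : lmodType k) b (v : {ffun mon n -> W}) : Prop :=
  forall a, (b <= wt a)%N -> v a = 0.

Section Low.
Variables (k : fieldType) (n : nat) (W : lmodType k).
Implicit Types (u v : {ffun mon n -> W}).

Lemma low_hcomp b t v : low b v -> (b <= t)%N -> hcomp t v = 0.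
Proof.
move=> h bt; apply/ffunP => a; rewrite hcompE ffunE; case: eqP => // e.
by rewrite h ?e.
Qed.

Lemma hcomp_low t v : low t.+1 (hcomp t v).
Proof. by move=> a; rewrite hcompE; case: eqP => // <-; rewrite ltnn. Qed.

Lemma low_leq b c v : (b <= c)%N -> low b v -> low c v.
Proof. by move=> bc h a ca; apply: h; apply: leq_trans bc ca. Qed.

Lemma low0 v : low 0 v -> v = 0.
Proof. by move=> h; apply/ffunP => a; rewrite ffunE h. Qed.

Lemma low_sum b (I : finType) (F : I -> {ffun mon n -> W}) :
  (forall i, low b (F i)) -> low b (\sum_i F i).
Proof. by move=> h a ba; rewrite sum_ffunE big1 // => i _; apply: h. Qed.

Lemma low_clift b (W' : lmodType k) (f : {linear W -> W'}) v : low b v -> low b (clift f v).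
Proof. by move=> h a ba; rewrite cliftE h // linear0. Qed.

End Low.

Lemma p_half p : prime p -> (5 <= p)%N -> p = (2 * p./2).+1.
Proof. by move=> pp p5; have := even_prime pp; lia. Qed.

Section Exactness.
Variables (k : fieldType) (p : nat).
Hypotheses (pp : prime p) (pch : p \in [pchar k]) (p5 : (5 <= p)%N).
Local Notation h := (p./2).
Local Notation Q := (@Qop k p _).

Lemma charp_eq0 : p%:R = 0 :> k. Proof. exact: pcharf0. Qed.

Lemma charp_neq0 j : (0 < j < p)%N -> j%:R != 0 :> k.
Proof.
move=> /andP[j0 jp]; rewrite -(dvdn_pcharf pch); apply/negP => /(dvdn_leq j0).
by rewrite leqNgt jp.
Qed.

(** A vector with [low b] has degrees at most [b - 1], so the bound says [e + i <= 5h] for each of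
    its degrees [e]. *)
Lemma low_exact (W : lmodType k) i b (v : {ffun mon p -> W}) : (i <= p)%N ->
  (b + i <= (5 * h).+1)%N -> low b v -> iter i Q v = 0 ->
  exists2 w, low (b - 2 * (p - i)) w & v = iter (p - i) Q w.
Proof.
move=> ip bi lv iv.
have QE : Qpart 5 =1 Q :> ({ffun mon p -> W} -> _).
  by move=> u; rewrite /Qpart /Qop; apply: eq_bigl => j; rewrite ltn_ord.
have iQE j : iter j (Qpart 5) =1 iter j Q :> ({ffun mon p -> W} -> _).
  by move=> u; elim: j => //= j ->; rewrite QE.
have podd : odd p by have := p_half pp p5; lia.
have p2 : (2 < p)%N by lia.
have [t|w hw] := @fin_all_exists 'I_b (fun _ => {ffun mon p -> W})
    (fun t w => hcomp t v = iter (p - i) Q w).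
  have [|||w hw] := @midpoint_Qpart k p W charp_eq0 charp_neq0 podd p2 5 (leqnn _) i t%:Z
    (hcomp t v) ip.
  - move=> a; rewrite hcompE; have [ta _|] := eqVneq (wt a) t; last by rewrite eqxx.
    by rewrite -ta; congr Posz; apply: eq_bigl => j; rewrite ltn_ord.
  - have := ltn_ord t; lia.
  - by rewrite iQE -hcomp_iterQ iv linear0.
  by exists w; rewrite hw iQE.
(* Each preimage is replaced by its component of the right degree; for [t < 2 (p - i)] there is none
   and the component of [v] is [0]. *)
pose w' (t : 'I_b) := if (2 * (p - i) <= t)%N then hcomp (t - 2 * (p - i)) (w t) else 0.
exists (\sum_t w' t).
  apply: low_sum => t; rewrite /w'; case: ifP => tp; last by move=> a _; rewrite ffunE.
  apply: low_leq (@hcomp_low _ _ _ _ _); have := ltn_ord t; lia.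
rewrite linear_sum {1}(sum_hcomp (b := b) (v := v)); last by move=> t; apply: low_hcomp.
apply: eq_bigr => t _ /=; rewrite /w'; case: ifP => tp.
  by rewrite -hcomp_iterQ subnK // -hw hcomp_id.
by rewrite linear0 -[hcomp t v]hcomp_id hw hcomp_iterQ0 //; lia.
Qed.

(** Since [p - 1 = 2h], the operator [Q ^ (p-1)] raises the degree by [4h]; hence the bounds here
    and in [Q_inj]. *)
Lemma ker_Q (W : lmodType k) (v : {ffun mon p -> W}) : low (5 * h) v -> Q v = 0 ->
  exists2 w, low h w & v = iter p.-1 Q w.
Proof.
move=> lv Qv; have [||w lw hw] := @low_exact W 1 (5 * h) v _ _ lv Qv; [lia|lia|].
by exists w; [apply: low_leq lw; have := p_half pp p5; lia | rewrite hw subn1].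
Qed.

Lemma ker_Qpow (W : lmodType k) b (v : {ffun mon p -> W}) : (b <= (3 * h).+1)%N ->
  low b v -> iter p.-1 Q v = 0 -> exists2 w, low (b - 2) w & v = Q w.
Proof.
move=> bh lv Qv; have [||w lw hw] := @low_exact W p.-1 b v _ _ lv Qv; [lia|have := p_half pp p5;
  lia|].
have e : (p - p.-1 = 1)%N by lia.
by exists w; [apply: low_leq lw; lia | rewrite hw e].
Qed.

Lemma Q_inj (W : lmodType k) (v : {ffun mon p -> W}) : low (4 * h) v -> Q v = 0 -> v = 0.
Proof.
move=> lv Qv; have [||w lw ->] := @low_exact W 1 (4 * h) v _ _ lv Qv; [lia|lia|].
rewrite (low0 (v := w)) ?linear0 //; apply: low_leq lw; have := p_half pp p5; lia.
Qed.

End Exactness.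

Import VectorInternalTheory.

(** * Duality and the Frobenius power of a pencil *)

Section RankAdjoint.
Variables (k : fieldType).

Definition bilin (U V : lmodType k) (B : U -> V -> k) :=
  (forall c x y v, B (c *: x + y) v = c * B x v + B y v) /\
  (forall c u x y, B u (c *: x + y) = c * B u x + B u y).

Lemma bilin_suml (U V : lmodType k) (B : U -> V -> k) n (c : 'I_n -> k) (f : 'I_n -> U) v :
  bilin B -> B (\sum_i c i *: f i) v = \sum_i c i * B (f i) v.
Proof.
case=> hl _; elim: n c f => [|n IH] c f.
  by rewrite !big_ord0; have := hl (-1) 0 0 v; rewrite scaler0 addr0 mulN1r addNr.
by rewrite !big_ord_recl hl IH.
Qed.

Lemma bilin_sumr (U V : lmodType k) (B : U -> V -> k) n (c : 'I_n -> k) (f : 'I_n -> V) u :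
  bilin B -> B u (\sum_i c i *: f i) = \sum_i c i * B u (f i).
Proof.
by case=> hl hr; apply: (@bilin_suml V U (fun v u => B u v)); split=> *; rewrite ?hl ?hr.
Qed.

(** The Gram matrix of a basis of the image of [F] against one of [V'] has independent rows by
    nondegeneracy, and adjunction factors it through the coordinates of the image of [F']. *)
Lemma rank_adjoint_le (U V U' V' : vectType k) (F : 'Hom(U, V)) (F' : 'Hom(V', U'))
    (BU : U -> U' -> k) (BV : V -> V' -> k) :
  bilin BU -> bilin BV ->
  (forall v, (forall v', BV v v' = 0) -> v = 0) ->
  (forall u v', BV (F u) v' = BU u (F' v')) ->
  (\dim (limg F) <= \dim (limg F'))%N.
Proof.
move=> bU bV nd adj.
pose b := vbasis (limg F); pose f := vbasis (limg F'); pose e := vbasis {:V'}.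
have bas : basis_of (limg F) b := vbasisP _.
have basf : basis_of (limg F') f := vbasisP _.
have base : basis_of {:V'} e := vbasisP _.
pose M := \matrix_(i < \dim (limg F), j < \dim {:V'}) BV b`_i e`_j.
have rf : row_free M.
  rewrite -kermx_eq0; apply/eqP.
  apply/row_matrixP => i; rewrite row0; set c := row i _.
  have cM : c *m M = 0 by rewrite -row_mul mulmx_ker row0.
  have s0 : \sum_i c 0 i *: b`_i = 0.
    apply: nd => v'; rewrite (coord_basis base (memvf v')) bilin_sumr // big1 // => j _.
    rewrite bilin_suml //; have /matrixP/(_ 0 j) := cM; rewrite !mxE => h.
    rewrite [X in _ * X](_ : _ = 0) ?mulr0 // -[RHS]h.
    by apply: eq_bigr => l _; rewrite [M l j]mxE.
  have /freeP fr := basis_free bas.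
  by apply/rowP => j; rewrite (fr (fun j => c 0 j) s0 j) mxE.
pose A := \matrix_(i < \dim (limg F), l < \dim (limg F')) BU (F^-1%VF b`_i) f`_l.
pose C := \matrix_(l < \dim (limg F'), j < \dim {:V'}) coord f l (F' e`_j).
have MAC : M = A *m C.
  apply/matrixP => i j; rewrite !mxE.
  have bi : b`_i \in limg F by apply: vbasis_mem; apply: mem_nth; rewrite size_tuple.
  rewrite -{1}(limg_lfunVK bi) adj (coord_basis basf (memv_img F' (memvf e`_j))).
  by rewrite bilin_sumr //; apply: eq_bigr => l _; rewrite !mxE mulrC.
have := mxrankM_maxl A C; rewrite -MAC (eqP rf) => h.
exact: leq_trans h (rank_leq_col _).
Qed.

End RankAdjoint.

Section Duality.
Variables (k : fieldType) (n : nat).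

(** Any symmetric nondegenerate form on [W] would serve; this one makes [adjoint] the transpose. *)
Definition dot (W : vectType k) (x y : W) : k := (v2r x *m (v2r y)^T) 0 0.

Lemma dot_bilin (W : vectType k) : bilin (@dot W).
Proof.
split=> c x y z; rewrite /dot; first by rewrite linearP mulmxDl -scalemxAl !mxE.
by rewrite linearP linearD linearZ /= mulmxDr -scalemxAr !mxE.
Qed.

Lemma dot_nondeg (W : vectType k) (x : W) : (forall y, dot x y = 0) -> x = 0.
Proof.
move=> h; apply: v2r_inj; rewrite linear0; apply/rowP => j.
have := h (r2v (delta_mx 0 j)); rewrite /dot r2vK trmx_delta -colE !mxE; exact.
Qed.

Definition adjoint (W W' : vectType k) (f : {linear W -> W'}) : W' -> W :=
  r2v \o mulmxr (lin1_mx (v2r \o f \o r2v))^T \o v2r.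

HB.instance Definition _ (W W' : vectType k) (f : {linear W -> W'}) :=
  GRing.Linear.copy (adjoint f)
    (r2v \o mulmxr (lin1_mx (v2r \o f \o r2v))^T \o v2r).

Lemma dot_adjoint (W W' : vectType k) (f : {linear W -> W'}) x y :
  dot (f x) y = dot x (adjoint f y).
Proof.
rewrite /dot /adjoint /= r2vK trmx_mul trmxK mulmxA mul_rV_lin1 /=.
by rewrite v2rK.
Qed.

Definition mrev (a : mon n) : mon n := [ffun i => rev_ord (a i)].

Lemma mrevE a i : mrev a i = (n - (a i).+1)%N :> nat.
Proof. by rewrite ffunE. Qed.

Lemma mrevK : involutive mrev.
Proof. by move=> a; apply/ffunP => i; rewrite !ffunE rev_ordK. Qed.

Lemma wt_mrev a : (wt (mrev a) + wt a = 5 * n.-1)%N.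
Proof.
rewrite /wt -big_split /= (eq_bigr (fun=> n.-1)); last first.
  by move=> i _; rewrite ffunE /=; have := ltn_ord (a i); lia.
by rewrite sum_nat_const card_ord.
Qed.

(** The coefficient of the socle monomial [(x_0 ... x_4) ^ (n-1)] in the product of [u] and [v],
    which makes multiplication by a monomial self-adjoint. *)
Definition fdot (W : vectType k) (u v : {ffun mon n -> W}) : k :=
  \sum_a dot (u a) (v (mrev a)).

Lemma fdot_bilin (W : vectType k) : bilin (@fdot W).
Proof.
have [hl hr] := dot_bilin W.
split=> c x y z; rewrite /fdot mulr_sumr -big_split; apply: eq_bigr => a _ /=.
  by rewrite !ffunE hl.
by rewrite !ffunE hr.
Qed.

Lemma dot0 (W : vectType k) (x : W) : dot x 0 = 0.
Proof. by rewrite /dot linear0 trmx0 mulmx0 mxE. Qed.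

Lemma dot0l (W : vectType k) (x : W) : dot 0 x = 0.
Proof. by rewrite /dot linear0 mul0mx mxE. Qed.

Lemma fdot_nondeg (W : vectType k) (u : {ffun mon n -> W}) :
  (forall v, fdot u v = 0) -> u = 0.
Proof.
move=> h; apply/ffunP => a; rewrite ffunE; apply: dot_nondeg => y.
rewrite -[RHS](h [ffun b => if b == mrev a then y else 0]) /fdot (bigD1 a) //=.
rewrite ffunE eqxx big1 ?addr0 // => b ba.
by rewrite ffunE (inj_eq (inv_inj mrevK)) (negbTE ba) dot0.
Qed.

Lemma fdot_sym (W : vectType k) (u v : {ffun mon n -> W}) : fdot u v = fdot v u.
Proof.
rewrite /fdot (reindex_inj (inv_inj mrevK)) /=; apply: eq_bigr => b _.
by rewrite mrevK /dot !mxE; apply: eq_bigr => l _; rewrite !mxE mulrC.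
Qed.

Lemma fdot_mulX (W : vectType k) i r (u v : {ffun mon n -> W}) :
  fdot (mulX i r u) v = fdot u (mulX i r v).
Proof.
rewrite /fdot (bigID (fun a : mon n => (r <= a i)%N)) /= [X in _ + X]big1 ?addr0; last first.
  by move=> a /negbTE ra; rewrite mulXE ra dot0l.
rewrite [RHS](bigID (fun a : mon n => (r <= mrev a i)%N)) /= [X in _ = _ + X]big1 ?addr0;
  last by move=> a /negbTE ra; rewrite mulXE ra dot0.
(* [h] multiplies by [x_i ^ r], and so inverts [msub _ i r] on the monomials divisible by
   [x_i ^ r]. *)
pose h b := mrev (msub (mrev b) i r).
have hE b j : h b j = (n - (mrev b j - (if j == i then r else 0)).+1)%N :> nat.
  by rewrite /h mrevE msubE.
have hP b : (r <= h b i)%N && (msub (h b) i r == b) = (r <= mrev b i)%N.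
  have bn := ltn_ord (b i).
  apply/andP/idP => [[h1 /eqP h2]|h1].
    have := congr1 (fun c : mon n => c i : nat) h2; rewrite /= msubE hE mrevE eqxx.
    by move: h1; rewrite hE mrevE eqxx; lia.
  split; first by move: h1; rewrite hE mrevE eqxx; lia.
  apply/eqP; apply: mon_eqP => j; rewrite msubE hE mrevE.
  move: h1; rewrite mrevE; have := ltn_ord (b j).
  by case: (eqVneq j i) => [->|_]; lia.
rewrite (reindex_onto h (fun a => msub a i r)) /=.
  apply: eq_big => [b|b h1]; first exact: hP.
  move: (h1); rewrite hP => h2; case/andP: h1 => h1 /eqP h3.
  by rewrite !mulXE h1 h2 h3 mrevK.
move=> a ra; apply: mon_eqP => j; rewrite hE mrevE msubE.
have := ltn_ord (a j); move: ra; case: (eqVneq j i) => [->|_]; lia.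
Qed.

Lemma fdot_clift (W W' : vectType k) (f : {linear W -> W'}) u v :
  fdot (clift f u) v = fdot u (clift (adjoint f) v).
Proof. by apply: eq_bigr => a _; rewrite !cliftE dot_adjoint. Qed.

Lemma fdot_suml (W : vectType k) (I : finType) (F : I -> {ffun mon n -> W}) v :
  fdot (\sum_i F i) v = \sum_i fdot (F i) v.
Proof.
have [hl _] := fdot_bilin W.
apply: (big_morph (fun u => fdot u v)) => [x y|].
  by have := hl 1 x y v; rewrite scale1r mul1r.
by have := hl (-1) 0 0 v; rewrite scaler0 addr0 mulN1r addNr.
Qed.

Lemma fdot_sumr (W : vectType k) (I : finType) (F : I -> {ffun mon n -> W}) v :
  fdot v (\sum_i F i) = \sum_i fdot v (F i).
Proof.
have [_ hr] := fdot_bilin W.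
apply: (big_morph (fun u => fdot v u)) => [x y|].
  by have := hr 1 v x y; rewrite scale1r mul1r.
by have := hr (-1) v 0 0; rewrite scaler0 addr0 mulN1r addNr.
Qed.

Lemma fdot_Pen (W W' : vectType k) (f : 'I_5 -> {linear W -> W'}) u v :
  fdot (Pen f u) v = fdot u (Pen (fun i => adjoint (f i)) v).
Proof.
rewrite fdot_suml fdot_sumr; apply: eq_bigr => i _.
by rewrite fdot_mulX fdot_clift clift_mulX.
Qed.

Lemma fdot_Qop (W : vectType k) (u v : {ffun mon n -> W}) :
  fdot (Qop u) v = fdot u (Qop v).
Proof. by rewrite fdot_suml fdot_sumr; apply: eq_bigr => i _; rewrite fdot_mulX. Qed.

Lemma fdot_hcomp (W : vectType k) s t (u v : {ffun mon n -> W}) :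
  (s + t = 5 * n.-1)%N -> fdot (hcomp s u) v = fdot u (hcomp t v).
Proof.
move=> st; apply: eq_bigr => a _; rewrite !hcompE; have := wt_mrev a.
by case: eqP => h1; case: eqP => h2 h3; rewrite ?dot0 ?dot0l //; lia.
Qed.

End Duality.

Section Frobenius.
Variables (k : fieldType) (p : nat) (V : lmodType k).
Hypotheses (pp : prime p) (pch : p \in [pchar k]).

Lemma iterC (f g : V -> V) m n v : (forall v, f (g v) = g (f v)) ->
  iter m f (iter n g v) = iter n g (iter m f v).
Proof.
move=> fg; have h w : f (iter n g w) = iter n g (f w).
  by elim: n => //= n IH; rewrite fg IH.
by elim: m => //= m ->; rewrite h.
Qed.

Lemma iter_add (f g : {linear V -> V}) m v : (forall v, f (g v) = g (f v)) ->
  iter m (fun x => f x + g x) v =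
  \sum_(i < m.+1) iter (m - i) f (iter i g v) *+ 'C(m, i).
Proof.
move=> fg; elim: m => [|m IH]; first by rewrite big_ord_recl big_ord0 addr0.
rewrite iterS {}IH !linear_sum big_ord_recl [in X in _ + X]big_ord_recr /=.
rewrite [RHS]big_ord_recl [in RHS]big_ord_recr /= !bin0 !binn !subn0 !subnn /=.
rewrite !mulr1n -!addrA; congr (_ + _); rewrite !addrA; congr (_ + _).
rewrite -big_split /=; apply: eq_bigr => i _; rewrite !linearMn /=.
rewrite -/(iter i.+1 g v) subSS -!iterS subnSK ?ltn_ord // binS mulrnDr.
rewrite /bump leq0n add1n; congr (_ *+ _ + _ *+ _).
by have /= := @iterC f g (m - i) 1 (iter i g v) fg.
Qed.

Lemma iterp_add (f g : {linear V -> V}) v : (forall v, f (g v) = g (f v)) ->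
  iter p (fun x => f x + g x) v = iter p f v + iter p g v.
Proof.
move=> fg; rewrite iter_add // big_ord_recl; have := prime_gt0 pp.
case: (p) pp pch => // n np nch _.
rewrite big_ord_recr /= big1 ?add0r => [|i _].
  by rewrite bin0 binn subnn mulr1n.
rewrite -scaler_nat; have /eqP -> : ('C(n.+1, bump 0 i))%:R == 0 :> k.
  rewrite -(dvdn_pcharf nch) prime_dvd_bin // /bump leq0n add1n /=.
  by rewrite ltnS ltn_ord.
by rewrite scale0r.
Qed.

Lemma iterp_sum I (r : seq I) (f : I -> {linear V -> V}) v :
  (forall i j v, f i (f j v) = f j (f i v)) ->
  iter p (fun x => \sum_(i <- r) f i x) v = \sum_(i <- r) iter p (f i) v.
Proof.
move=> fC.
have lin s : linear (fun x => \sum_(i <- s) f i x).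
  move=> c x y; rewrite scaler_sumr -big_split /=.
  by apply: eq_bigr => i _; rewrite linearP.
pose S s := HB.pack_for {linear V -> V} (fun x => \sum_(i <- s) f i x)
  (GRing.isLinear.Build k V V _ _ (lin s)).
elim: r v => [|i r IH] v.
  rewrite big_nil (eq_iter (f' := fun=> 0)) => [|x]; last by rewrite big_nil.
  by rewrite -(prednK (prime_gt0 pp)).
rewrite big_cons -IH -(@iterp_add (f i) (S r)) => [|w] /=.
  by apply: eq_iter => x; rewrite big_cons.
by rewrite linear_sum; apply: eq_bigr => j _; rewrite fC.
Qed.

Lemma iterq_sum (I : finType) (f : I -> {linear V -> V}) s v :
  (forall i j v, f i (f j v) = f j (f i v)) ->
  iter (p ^ s) (fun x => \sum_i f i x) v = \sum_i iter (p ^ s) (f i) v.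
Proof.
move=> fC; elim: s v => [|s IH] v; first by [].
rewrite expnS iterM (eq_iter IH) (@iterp_sum _ _ (fun i => iter (p ^ s) (f i))).
  by apply: eq_bigr => i _; rewrite -iterM.
by move=> i j w /=; apply: iterC.
Qed.

End Frobenius.

Lemma iter_mulX (k : fieldType) n (W : lmodType k) i r m (v : {ffun mon n -> W}) :
  iter m (mulX i r) v = mulX i (m * r) v.
Proof.
elim: m => [|m IH] /=; last by rewrite IH mulXD mulSn.
by apply/ffunP => a; rewrite mul0n mulXE /=; congr (v _); apply: mon_eqP => j;
  rewrite msubE if_same subn0.
Qed.

Lemma iterQ_Frobenius (k : fieldType) p s n (W : lmodType k) (v : {ffun mon n -> W}) :
  prime p -> p \in [pchar k] ->
  iter (p ^ s) (@Qop k n W) v = \sum_i mulX i (p ^ s * 2) v.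
Proof.
move=> pp pch; rewrite (@iterq_sum k p _ pp pch _ (fun i => mulX i 2)).
  by apply: eq_bigr => i _; rewrite iter_mulX.
by move=> i j w /=; rewrite mulXC.
Qed.

(** * Graded pieces and factorizations of the quadric *)

Definition cA n t := #|[pred a : mon n | wt a == t]|.

Section Graded.
Variables (k : fieldType) (n : nat).
Implicit Types (W N G : vectType k).
Local Notation A W := {ffun mon n -> W}.

Definition homg W t : {vspace A W} := limg (linfun (@hcomp k n W t)).

Lemma mem_homg W t (v : A W) : (v \in homg W t) = (hcomp t v == v).
Proof.
apply/idP/eqP => [/memv_imgP[u _ ->]|<-]; first by rewrite lfunE /= hcomp_id.
by rewrite -[hcomp t v](lfunE (@hcomp k n W t)) memv_img ?memvf.
Qed.

Lemma hcomp_homg W t (v : A W) : hcomp t v \in homg W t.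
Proof. by rewrite mem_homg hcomp_id. Qed.

Lemma homg_low W t (v : A W) : v \in homg W t -> low t.+1 v.
Proof. by rewrite mem_homg => /eqP <-; apply: hcomp_low. Qed.

Lemma dim_homg W t : \dim (homg W t) = (cA n t * \dim {:W})%N.
Proof.
pose T := {a : mon n | wt a == t}.
pose ext (f : {ffun T -> W}) : A W :=
  [ffun a => if insub a is Some x then f (x : T) else 0].
have lin : linear ext.
  move=> c f g; apply/ffunP => a; rewrite !ffunE.
  by case: insub => [x|]; rewrite ?ffunE // scaler0 addr0.
pose E := HB.pack_for {linear {ffun T -> W} -> A W} ext (GRing.isLinear.Build k _ _ _ _ lin).
have -> : homg W t = limg (linfun E).
  apply/vspaceP => v; apply/idP/memv_imgP => [|[f _ ->]].
    rewrite mem_homg => /eqP hv; exists [ffun x : T => v (val x)]; first exact: memvf.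
    rewrite lfunE /= -hv; apply/ffunP => a; rewrite hcompE ffunE.
    by case: insubP => [x _ <-|/negbTE ->] //; rewrite ffunE hv (valP x).
  rewrite lfunE /= mem_homg; apply/eqP/ffunP => a; rewrite hcompE ffunE.
  by case: insubP => [x wx _|/negbTE ->] //; rewrite wx.
rewrite limg_dim_eq.
  rewrite !dimvf /cA -card_sig; exact: erefl.
apply/eqP; rewrite -subv0 capfv; apply/subvP => f; rewrite memv_ker lfunE /= => /eqP f0.
rewrite memv0; apply/eqP/ffunP => x; have /ffunP/(_ (val x)) := f0.
by rewrite !ffunE valK.
Qed.

(** [fdot] pairs degree [t + a] with [s] and degree [t] with [s + a], so the two restrictions are
    transposes of each other. *)
Lemma rank_dual N G (F : {linear A N -> A G}) (Ft : {linear A G -> A N}) a s t :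
  (forall u v, fdot (F u) v = fdot u (Ft v)) ->
  (forall t v, hcomp (t + a) (F v) = F (hcomp t v)) ->
  (forall t v, hcomp (t + a) (Ft v) = Ft (hcomp t v)) ->
  (s + t + a = 5 * n.-1)%N ->
  \dim (linfun F @: homg N t) = \dim (linfun Ft @: homg G s).
Proof.
move=> adj dF dFt st; rewrite -!limg_comp.
have E (N' G' : vectType k) (f : {linear A N' -> A G'}) s' v :
    (linfun f \o linfun (@hcomp k n N' s'))%VF v = f (hcomp s' v).
  by rewrite lfunE /= !lfunE.
apply/eqP; rewrite eqn_leq; apply/andP; split.
  apply: (rank_adjoint_le (fdot_bilin n N) (fdot_bilin n G)).
    exact: fdot_nondeg.
  move=> u v; rewrite !E adj -dFt; apply: fdot_hcomp; lia.
apply: (rank_adjoint_le (fdot_bilin n G) (fdot_bilin n N)).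
  exact: fdot_nondeg.
move=> u v; rewrite !E fdot_sym -adj fdot_sym -dF; apply: fdot_hcomp; lia.
Qed.
End Graded.

Definition cAz n (x : int) : int := if x is Posz m then (cA n m)%:Z else 0.

Section Factorization.
Variables (k : fieldType) (p : nat).
Hypotheses (pp : prime p) (pch : p \in [pchar k]) (p5 : (5 <= p)%N).
Local Notation h := (p./2).
Local Notation A W := {ffun mon p -> W}.
Local Notation Q := (@Qop k p _).
Local Notation Qp := (iter p.-1 Q).

Lemma iterpQ0 (W : lmodType k) (v : A W) : Q (Qp v) = 0.
Proof.
have e : p.-1.+1 = (p ^ 1)%N by rewrite expn1 prednK ?prime_gt0.
rewrite -iterS e iterQ_Frobenius //; apply: big1 => i _; rewrite mulX_ge //; lia.
Qed.

Section Pair.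
Variables (N G : vectType k) (a a' : nat).
Variables (F : {linear A N -> A G}) (F' : {linear A G -> A N}).
Hypotheses (aa' : (a + a' = 2)%N).
Hypothesis (dF : forall t v, hcomp (t + a) (F v) = F (hcomp t v)).
Hypothesis (dF' : forall t v, hcomp (t + a') (F' v) = F' (hcomp t v)).
Hypotheses (FF' : forall v, F (F' v) = Q v) (F'F : forall v, F' (F v) = Q v).

Lemma F_homg t v : v \in homg p N t -> F v \in homg p G (t + a).
Proof. by rewrite !mem_homg dF => /eqP ->. Qed.

Lemma F'_homg t v : v \in homg p G t -> F' v \in homg p N (t + a').
Proof. by rewrite !mem_homg dF' => /eqP ->. Qed.

Lemma F_Qp v : F (Qp v) = Qp (F v).
Proof. by rewrite (iterQ_comm (f := F)) // => w; rewrite -FF' F'F. Qed.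

Lemma F_inj t v : (t < 4 * h)%N -> v \in homg p N t -> F v = 0 -> v = 0.
Proof.
move=> th /homg_low lv Fv; apply: (Q_inj pp pch p5); last by rewrite -F'F Fv linear0.
exact: low_leq lv.
Qed.

Lemma F'_inj t v : (t < 4 * h)%N -> v \in homg p G t -> F' v = 0 -> v = 0.
Proof.
move=> th /homg_low lv Fv; apply: (Q_inj pp pch p5); last by rewrite -FF' Fv linear0.
exact: low_leq lv.
Qed.

(** The index [j] is the degree before applying [Q ^ (p-1)]; the elements themselves have degree
    [j + 4h]. *)
Definition trivker j := (linfun (Qp : A N -> A N) @: homg p N j :&: lker (linfun F))%VS.

Lemma trivkerP j v : reflect (exists w, [/\ w \in homg p N j, v = Qp w & F v = 0])
  (v \in trivker j).
Proof.
rewrite memv_cap memv_ker lfunE /=; apply: (iffP andP).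
  by case=> /memv_imgP[w wj]; rewrite lfunE /= => -> /eqP Fv; exists w.
case=> w [wj -> ->]; split; last exact/eqP.
by apply/memv_imgP; exists w; rewrite // lfunE.
Qed.

(** If [F] kills [Q ^ (p-1) w], then [Q ^ (p-1)] kills [F w], so [F w = Q g = F (F' g)] by
    exactness, and injectivity of [F] gives [w = F' g]. *)
Lemma trivker_img j : (j + a <= 3 * h)%N -> (a' <= j)%N ->
  trivker j = (linfun (Qp \o F') @: homg p G (j - a'))%VS.
Proof.
move=> ja a'j; apply/vspaceP => v; apply/trivkerP/memv_imgP.
  case=> w [wj vE Fv]; have Fw := F_homg wj.
  have [||g0 _ hg0] := @ker_Qpow k p pp pch p5 G (j + a).+1 (F w) _ (homg_low Fw).
  - lia.
  - by rewrite -F_Qp -vE.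
  exists (hcomp (j - a') g0); first exact: hcomp_homg.
  have e : (j + a = (j - a') + 2)%N by lia.
  have FwE : F w = F (F' (hcomp (j - a') g0)).
    by rewrite FF' -hcomp_Qop -e -hg0; move: Fw; rewrite mem_homg => /eqP.
  rewrite lfunE /= vE; congr (Qp _); apply/eqP; rewrite -subr_eq0; apply/eqP.
  apply: (@F_inj j); [lia| |by rewrite linearB /= FwE subrr].
  apply: memvB => //; rewrite -{2}(subnK a'j); apply: F'_homg; exact: hcomp_homg.
case=> g gj; rewrite lfunE /= => ->; exists (F' g); split=> //.
  by rewrite -{1}(subnK a'j); apply: F'_homg.
by rewrite F_Qp FF' -iterSr /= iterpQ0.
Qed.

(** The map [Q ^ (p-1) F'] onto the trivial kernel has kernel [F] applied to degree [j - 2], by the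
    same argument with [F] and [F'] exchanged, and [F] is injective there. *)
Lemma trivker_dim j : (j + a <= 3 * h)%N -> (a' <= j)%N ->
  (\dim (trivker j))%:Z + (\dim {:N})%:Z * cAz p (j%:Z - 2) =
  (\dim {:G})%:Z * (cA p (j - a')%N)%:Z.
Proof.
move=> ja a'j; rewrite trivker_img //.
set xi := linfun _; set U := homg p G _.
have kerxi : \dim (U :&: lker xi) = (\dim {:N} * `|cAz p (j%:Z - 2)|)%N.
  have key g : g \in U -> Qp (F' g) = 0 -> exists n0, F' g = Q n0.
    move=> gU Qg; have F'g := F'_homg gU; rewrite subnK // in F'g.
    have [||n0 _ hn0] := @ker_Qpow k p pp pch p5 N j.+1 (F' g) _ (homg_low F'g) => //.
      lia.
    by exists n0.
  have [j2|j2] := leqP 2 j; last first.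
    have -> : cAz p (j%:Z - 2) = 0 by case: (j) j2 => [|[|]].
    rewrite absz0 muln0; apply/eqP; rewrite dimv_eq0 -subv0; apply/subvP => g.
    rewrite memv_cap memv_ker lfunE /= => /andP[gU /eqP /(key _ gU)[n0 hn0]].
    rewrite memv0; apply/eqP/(@F'_inj (j - a')) => //; first by lia.
    have F'g := F'_homg gU; rewrite subnK // mem_homg in F'g.
    by rewrite -(eqP F'g) hn0 hcomp_Qop0.
  have -> : (U :&: lker xi)%VS = (linfun F @: homg p N (j - 2))%VS.
    apply/vspaceP => g; rewrite memv_cap memv_ker lfunE /=; apply/andP/memv_imgP.
      case=> gU /eqP /(key _ gU)[n0 hn0]; exists (hcomp (j - 2) n0); first exact: hcomp_homg.
      rewrite lfunE /=; apply/eqP; rewrite -subr_eq0; apply/eqP.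
      apply: (@F'_inj (j - a')); [lia| |].
        apply: memvB => //; rewrite (_ : (j - a' = j - 2 + a)%N); last by lia.
        exact/F_homg/hcomp_homg.
      rewrite linearB /= F'F -hcomp_Qop subnK // -hn0.
      have F'g := F'_homg gU; rewrite subnK // mem_homg in F'g.
      by rewrite (eqP F'g) subrr.
    case=> n nj; rewrite lfunE /= => ->; split.
      by rewrite /U (_ : (j - a' = j - 2 + a)%N); [apply: F_homg | lia].
    by rewrite F'F -iterSr /= iterpQ0.
  rewrite limg_dim_eq; last first.
    apply/eqP; rewrite -subv0; apply/subvP => n; rewrite memv_cap memv_ker lfunE /=.
    move=> /andP[nj /eqP Fn]; rewrite memv0; apply/eqP/(@F_inj (j - 2)) => //; lia.
  rewrite dim_homg mulnC; congr (_ * _)%N.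
  by rewrite (_ : j%:Z - 2 = (j - 2)%N%:Z) //; lia.
have := limg_ker_dim xi U; rewrite kerxi dim_homg.
have : 0 <= cAz p (j%:Z - 2) by case: (j%:Z - 2).
move: (cAz _ _) => c c0 hd.
have -> : (\dim {:N})%:Z * c = (\dim {:N} * `|c|)%N%:Z by rewrite PoszM gez0_abs.
by rewrite -PoszM -PoszD addnC hd mulnC.
Qed.

(** [F' F = Q] puts the kernel of [F] inside that of [Q], which below the middle lies in the image
    of [Q ^ (p-1)]. *)
Lemma ker_low t j : (t < 5 * h)%N -> (t = j + 4 * h)%N ->
  (homg p N t :&: lker (linfun F))%VS = trivker j.
Proof.
move=> th tj; have ph := p_half pp p5; apply/vspaceP => v; rewrite memv_cap memv_ker lfunE /=.
have tj' : (t = j + 2 * p.-1)%N by lia.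
apply/andP/trivkerP => [[vt /eqP Fv]|[w [wj -> Fv]]].
  have Qv : Q v = 0 by rewrite -F'F Fv linear0.
  have [|w _ hw] := ker_Q pp pch p5 _ Qv; first exact: low_leq (homg_low vt).
  exists (hcomp j w); split=> //; first exact: hcomp_homg.
  by rewrite -hcomp_iterQ -tj' -hw; move: vt; rewrite mem_homg => /eqP.
rewrite Fv eqxx; split=> //; rewrite mem_homg tj' hcomp_iterQ.
by move: wj; rewrite mem_homg => /eqP ->.
Qed.

End Pair.

(* The excess of the middle-degree kernel of a factor of degree [a] of the quadric over its
   trivial part: [nu 2 = 4 mu] and [nu 1 = mubar], see [nu2_mu] and [nu1_mubar]. *)
Definition nu a : int :=
  (cA p (5 * h)%N)%:Z - (cA p (5 * h - a)%N)%:Z + (cA p (h - 2)%N)%:Z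
  - cAz p (h%:Z - a%:Z - 2) - (cA p (h - (2 - a))%N)%:Z + (cA p (h - 2)%N)%:Z.

(** Duality turns the rank of [F] in degree [5h] into that of its adjoint in degree [5h - a], which
    is below the middle, so that [ker_low] and [trivker_dim] give it. *)
Lemma ker_mid (N G : vectType k) (a : nat) (F Ft' : {linear A N -> A G})
    (F' Ft : {linear A G -> A N}) : (0 < a <= 2)%N -> \dim {:N} = \dim {:G} ->
  (forall t v, hcomp (t + a) (F v) = F (hcomp t v)) ->
  (forall t v, hcomp (t + (2 - a)) (F' v) = F' (hcomp t v)) ->
  (forall v, F (F' v) = Q v) -> (forall v, F' (F v) = Q v) ->
  (forall t v, hcomp (t + a) (Ft v) = Ft (hcomp t v)) ->
  (forall t v, hcomp (t + (2 - a)) (Ft' v) = Ft' (hcomp t v)) ->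
  (forall v, Ft (Ft' v) = Q v) -> (forall v, Ft' (Ft v) = Q v) ->
  (forall u v, fdot (F u) v = fdot u (Ft v)) ->
  (\dim (homg p N (5 * h) :&: lker (linfun F)))%:Z - (\dim (trivker F h))%:Z =
  (\dim {:N})%:Z * nu a.
Proof.
move=> a2 NG dF dF' FF' F'F dFt dFt' FtFt' Ft'Ft adj.
have ph := p_half pp p5.
have aa : (a + (2 - a) = 2)%N by lia.
have r1 := limg_ker_dim (linfun F) (homg p N (5 * h)).
have r2 := limg_ker_dim (linfun Ft) (homg p G (5 * h - a)).
have rk : \dim (linfun F @: homg p N (5 * h)) = \dim (linfun Ft @: homg p G (5 * h - a)).
  apply: (rank_dual adj dF dFt); lia.
have t1 := @trivker_dim N G a (2 - a) F F' aa dF dF' FF' F'F h.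
have t2 := @trivker_dim G N a (2 - a) Ft Ft' aa dFt dFt' FtFt' Ft'Ft (h - a).
have kl := @ker_low G N a (2 - a) Ft Ft' aa Ft'Ft (5 * h - a) (h - a).
have {}t1 := t1 ltac:(lia) ltac:(lia); have {}t2 := t2 ltac:(lia) ltac:(lia).
have {}kl := kl ltac:(lia) ltac:(lia).
rewrite !dim_homg in r1 r2; rewrite kl in r2; rewrite -NG in t1 t2 r2.
rewrite (_ : (h - a)%N%:Z - 2 = h%:Z - a%:Z - 2) in t2; last by lia.
rewrite (_ : (h - a - (2 - a) = h - 2)%N) in t2; last by lia.
rewrite (_ : h%:Z - 2 = (h - 2)%N%:Z) /= in t1; last by lia.
rewrite /nu; move: r1 r2 t1 t2; rewrite rk.
move: (\dim {:N}) (cAz _ _) (\dim _) (\dim _) (\dim _) (\dim _) => d c x1 x2 x3 x4.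
move: (cA p _) (cA p _) (cA p _) (cA p _) => c1 c2 c3 c4.
move=> r1 r2 t1 t2.
nia.
Qed.

End Factorization.

Section PenEval.
Variables (k : fieldType) (p : nat).
Hypothesis p2 : (2 < p)%N.

(* The monomial [y_i ^ c]. *)
Definition umon i c (cp : (c < p)%N) : mon p :=
  [ffun j => if j == i then Ordinal cp else Ordinal (ltnW (ltnW p2))].

Lemma umonE i c (cp : (c < p)%N) j : umon i cp j = (if j == i then c else 0%N) :> nat.
Proof. by rewrite ffunE; case: eqP. Qed.

Lemma Pen_umon (W W' : lmodType k) (f : 'I_5 -> {linear W -> W'}) (v : {ffun mon p -> W}) i c
    (cp : (c.+1 < p)%N) :
  Pen f v (umon i cp) = f i (v (umon i (ltnW cp))).
Proof.
rewrite sum_ffunE (bigD1 i) //= big1 ?addr0 => [|j ji]; last first.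
  by rewrite mulXE umonE (negbTE ji).
rewrite mulXE umonE eqxx /= cliftE; congr (f i (v _)).
by apply: mon_eqP => j; rewrite msubE !umonE; case: eqP => // _; rewrite ?subn1.
Qed.

Lemma wt_umon0 i (cp : (0 < p)%N) : wt (umon i cp) = 0%N.
Proof. by rewrite /wt big1 // => j _; rewrite umonE if_same. Qed.

Lemma Pen_eq0 (W W' : lmodType k) (f : 'I_5 -> {linear W -> W'}) i x :
  (forall v : {ffun mon p -> W}, hcomp 0 v = v -> Pen f v = 0) -> f i x = 0.
Proof.
move=> h; pose v : {ffun mon p -> W} := hcomp 0 [ffun=> x].
have /ffunP/(_ (umon i (ltnW p2))) := h v (hcomp_id _ _).
by rewrite Pen_umon hcompE wt_umon0 eqxx zeroE ffunE.
Qed.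

(** Compare the coefficients of [y_i ^ 2], a nonzero monomial as [p > 2]. *)
Lemma Pen_Pen_id (W W' : lmodType k) (f : 'I_5 -> {linear W -> W'})
    (g : 'I_5 -> {linear W' -> W}) i x :
  (forall v : {ffun mon p -> W'}, Pen f (Pen g v) = Qop v) -> f i (g i x) = x.
Proof.
move=> h; pose v : {ffun mon p -> W'} := hcomp 0 [ffun=> x].
have /ffunP/(_ (umon i p2)) := h v.
rewrite !Pen_umon hcompE wt_umon0 eqxx ffunE => ->.
rewrite sum_ffunE (bigD1 i) //= big1 ?addr0 => [|j ji]; last first.
  by rewrite mulXE umonE (negbTE ji).
rewrite mulXE umonE eqxx /= (_ : msub _ _ _ = umon i (ltnW (ltnW p2))).
  by rewrite hcompE wt_umon0 eqxx ffunE.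
by apply: mon_eqP => j; rewrite msubE !umonE; case: eqP.
Qed.

End PenEval.

(** [Q] is self-adjoint for a nondegenerate form, so the transpose of a factorization is again
    one. *)
Lemma adjoint_factorization (k : fieldType) n (N G : vectType k)
    (f : 'I_5 -> {linear N -> G}) (g : 'I_5 -> {linear G -> N}) :
  (forall v : {ffun mon n -> N}, Pen g (Pen f v) = Qop v) ->
  forall v : {ffun mon n -> N},
    Pen (fun i => adjoint (f i)) (Pen (fun i => adjoint (g i)) v) = Qop v.
Proof.
move=> gf v; apply/eqP; rewrite -subr_eq0; apply/eqP.
apply: fdot_nondeg => u; rewrite fdot_sym.
have [_ hr] := fdot_bilin n N.
have := hr (-1) u (Qop v) (Pen (fun i => adjoint (f i)) (Pen (fun i => adjoint (g i)) v)).
rewrite scaleN1r addrC => ->; rewrite mulN1r -!fdot_Pen gf fdot_Qop addNr //.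
Qed.

Lemma subfE (V : zmodType) n (u v : {ffun mon n -> V}) a : (u - v) a = u a - v a.
Proof. by rewrite !ffunE. Qed.

(** * The kernel of a pencil whose r-th power is the quadric *)

Section Pencil.
Variables (k : fieldType) (p : nat).
Hypotheses (pp : prime p) (pch : p \in [pchar k]) (p5 : (5 <= p)%N).
Variables (r' : nat) (E : vectType k) (D0 : {linear E -> E}) (D : 'I_5 -> {linear E -> E}).
Variable prE : int -> {linear E -> E}.
Local Notation h := (p./2).
Local Notation r := r'.+1.
Local Notation A := {ffun mon p -> E}.
Local Notation Q := (@Qop k p _).
Local Notation Qp := (iter p.-1 Q).

Definition DD (v : A) : A := clift D0 v + Pen D v.

Fact DD_is_linear : linear DD.
Proof. by move=> c u v; rewrite /DD !linearP /= scalerDr addrACA. Qed.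
HB.instance Definition _ := GRing.isLinear.Build k A A _ DD DD_is_linear.

(* The component of total degree [d] when each variable [y_i] has degree [r]. *)
Definition tp (d : int) (v : A) : A := [ffun a => prE (d - r%:Z * (wt a)%:Z) (v a)].

Lemma tpE d v a : tp d v a = prE (d - r%:Z * (wt a)%:Z) (v a).
Proof. by rewrite ffunE. Qed.

Fact tp_is_linear d : linear (tp d).
Proof. by move=> c u v; apply/ffunP => a; rewrite !ffunE linearP. Qed.
HB.instance Definition _ d := GRing.isLinear.Build k A A _ (tp d) (tp_is_linear d).

Hypothesis pr_neg : forall m x, m < 0 -> prE m x = 0.
Hypothesis pr_id : forall m x, prE m (prE m x) = prE m x.
Hypothesis prD0 : forall m x, prE (m + 2) (D0 x) = D0 (prE m x).
Hypothesis prD : forall m i x, prE (m + 2 - r%:Z) (D i x) = D i (prE m x).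
Hypothesis DD_Frobenius : forall v : A, iter r DD v = Q v.

Lemma tp_id d v : tp d (tp d v) = tp d v.
Proof. by apply/ffunP => a; rewrite !tpE pr_id. Qed.

Lemma tp_mulX d i s v : tp (d + r%:Z * s%:Z) (mulX i s v) = mulX i s (tp d v).
Proof.
apply/ffunP => a; rewrite !(tpE, mulXE); case: ifP => sa; last by rewrite linear0.
by rewrite -(wt_msub sa); congr (prE _ _); lia.
Qed.

Lemma tp_Q d v : tp (d + 2 * r%:Z) (Q v) = Q (tp d v).
Proof.
rewrite /Qop linear_sum; apply: eq_bigr => i _ /=.
by rewrite -tp_mulX; congr (tp _ _); lia.
Qed.

Lemma tp_iterQ d j v : tp (d + 2 * j%:Z * r%:Z) (iter j Q v) = iter j Q (tp d v).
Proof.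
elim: j => [|j IH]; first by rewrite mulr0 mul0r addr0.
by rewrite /= -IH -tp_Q; congr (tp _ _); lia.
Qed.

Lemma tp_cliftD0 d v : tp (d + 2) (clift D0 v) = clift D0 (tp d v).
Proof. by apply/ffunP => a; rewrite !(tpE, cliftE) -prD0; congr (prE _ _); lia. Qed.

Lemma tp_Pen d v : tp (d + 2) (Pen D v) = Pen D (tp d v).
Proof.
rewrite /Pen linear_sum; apply: eq_bigr => i _ /=.
apply/ffunP => a; rewrite !(tpE, mulXE); case: ifP => sa; last by rewrite linear0.
by rewrite !cliftE tpE -prD -(wt_msub sa); congr (prE _ _); lia.
Qed.

Lemma tp_DD d v : tp (d + 2) (DD v) = DD (tp d v).
Proof. by rewrite /DD linearD /= tp_cliftD0 tp_Pen. Qed.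

Lemma tp_iterDD d j v : tp (d + 2 * j%:Z) (iter j DD v) = iter j DD (tp d v).
Proof.
elim: j => [|j IH]; first by rewrite mulr0 addr0.
by rewrite /= -IH -tp_DD; congr (tp _ _); lia.
Qed.

Lemma tp_hcomp d t v : tp d (hcomp t v) = hcomp t (tp d v).
Proof.
by apply/ffunP => a; rewrite !(tpE, hcompE); case: (wt a == t); rewrite // linear0.
Qed.

Lemma tp_neg d v : d < 0 -> tp d v = 0.
Proof. by move=> d0; apply/ffunP => a; rewrite tpE ffunE pr_neg //; lia. Qed.

Lemma tp_low d b v : tp d v = v -> d < r%:Z * b%:Z -> low b v.
Proof. by move=> <- db a ba; rewrite tpE pr_neg //; nia. Qed.

Lemma DD_Q v : DD (Q v) = Q (DD v).
Proof. by rewrite /DD linearD /= -clift_Qop -Qop_Pen. Qed.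

Lemma iterDD_Q j v : iter j DD (Q v) = Q (iter j DD v).
Proof. by elim: j => //= j ->; apply: DD_Q. Qed.

Lemma DD_Qp v : DD (Qp v) = Qp (DD v).
Proof. by symmetry; apply: (iterQ_comm (f := DD)) => w; symmetry; apply: DD_Q. Qed.

Lemma iter_rDD v : iter r' DD (DD v) = Q v.
Proof. by rewrite -DD_Frobenius -iterSr. Qed.

Lemma ker_DD_Q v : DD v = 0 -> Q v = 0.
Proof. by move=> e; rewrite -iter_rDD e linear0. Qed.

(** The kernel lies in that of [Q], so [v = Q ^ (p-1) w] with [w] of total degree below [2r - 2].
    Then [DD w] is [Q] of something of negative degree, hence [0], and [w] is in turn killed by [Q],
    injective on it. *)
Lemma DD_inj_low d v : d < 2 * (p * r)%N%:Z - 2 -> tp d v = v -> DD v = 0 -> v = 0.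
Proof.
move=> dq dv DDv; have ph := p_half pp p5.
have [||w _ hw] := ker_Q pp pch p5 (W := E) (v := v); last 1 first.
- pose d1 := d - 2 * p.-1%:Z * r%:Z; pose w1 := tp d1 w.
  have vE : v = Qp w1 by rewrite -tp_iterQ -hw -[LHS]dv; congr (tp _ _); rewrite /d1; lia.
  have dw : tp d1 w1 = w1 by rewrite tp_id.
  have lw : low 2 w1 by apply: tp_low dw _; rewrite /d1; nia.
  have DDw : Qp (DD w1) = 0 by rewrite -DD_Qp -vE.
  have lDw : low 2 (DD w1).
    apply: (@tp_low (d1 + 2)); first by rewrite tp_DD dw.
    by rewrite /d1; nia.
  have [|g _ hg] := ker_Qpow pp pch p5 _ lDw DDw; first by lia.
  have Dw0 : DD w1 = 0.
    have <- : tp (d1 + 2) (DD w1) = DD w1 by rewrite tp_DD dw.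
    rewrite hg (_ : d1 + 2 = (d1 + 2 - 2 * r%:Z) + 2 * r%:Z); last by lia.
    by rewrite tp_Q tp_neg ?linear0 // /d1; nia.
  rewrite vE (Q_inj pp pch p5 (v := w1)) ?linear0 //; first by apply: low_leq lw; lia.
  exact: ker_DD_Q.
- by apply: (@tp_low d) => //; nia.
- exact: ker_DD_Q.
Qed.

(** By exactness [DD^(r-1) v = Q u = DD^(r-1) (DD u)]; the difference [v - DD u] is then killed by
    [DD^r = Q], in a range where [Q] is injective. *)
Lemma im_DD_low d v : d < (p * r)%N%:Z -> tp d v = v -> Qp (iter r' DD v) = 0 ->
  exists2 u, tp (d - 2) u = u & v = DD u.
Proof.
move=> dq dv Qv; have ph := p_half pp p5; pose g := iter r' DD v.
have dg : tp (d + 2 * r'%:Z) g = g by rewrite tp_iterDD dv.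
have lg : low (p + 2) g by apply: tp_low dg _; nia.
have [|u _ hu] := ker_Qpow pp pch p5 _ lg Qv; first by lia.
pose u' := tp (d - 2) u.
have gE : g = Q u'.
  by rewrite -tp_Q -hu -[LHS]dg; congr (tp _ _); lia.
exists u'; first by rewrite tp_id.
apply/eqP; rewrite -subr_eq0; apply/eqP/(Q_inj pp pch p5).
  apply: (@tp_low d); last by nia.
  rewrite linearB /= dv; congr (_ - _).
  have -> : d = (d - 2) + 2 by lia.
  by rewrite tp_DD tp_id.
rewrite -DD_Frobenius /= linearB /= iter_rDD -/g gE subrr linear0 //.
Qed.

Definition valued (U : {vspace E}) (v : A) := forall a, v a \in U.

Lemma valued_hcomp U t v : valued U v -> valued U (hcomp t v).
Proof. by move=> h a; rewrite hcompE; case: ifP => // _; apply: mem0v. Qed.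

Lemma valued_sum U (I : finType) (f : I -> A) :
  (forall i, valued U (f i)) -> valued U (\sum_i f i).
Proof. by move=> h a; rewrite sum_ffunE memv_suml // => i _; apply: h. Qed.

Lemma valued_mulX U i s v : valued U v -> valued U (mulX i s v).
Proof. by move=> h a; rewrite mulXE; case: ifP => // _; apply: mem0v. Qed.

Lemma valued_Q U v : valued U v -> valued U (Q v).
Proof. by move=> h; apply: valued_sum => i; apply: valued_mulX. Qed.

Lemma valued_clift (U U' : {vspace E}) (f : E -> E) v :
  (forall x, x \in U -> f x \in U') -> valued U v -> valued U' (clift f v).
Proof. by move=> fU h a; rewrite cliftE fU. Qed.

Lemma valued_Pen (U U' : {vspace E}) (f : 'I_5 -> {linear E -> E}) v :
  (forall i x, x \in U -> f i x \in U') -> valued U v -> valued U' (Pen f v).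
Proof.
by move=> fU h; apply: valued_sum => i; apply: valued_mulX; apply: valued_clift h; apply: fU.
Qed.

Lemma valuedB U u v : valued U u -> valued U v -> valued U (u - v).
Proof. by move=> hu hv a; rewrite !ffunE memvB. Qed.

Lemma valued_ker (f : {linear E -> E}) v : valued (lker (linfun f)) v <-> clift f v = 0.
Proof.
split=> [h|h a]; last first.
  by rewrite memv_ker lfunE /= -cliftE h ffunE.
by apply/ffunP => a; rewrite cliftE ffunE; have := h a; rewrite memv_ker lfunE => /eqP.
Qed.

Lemma valued_img (f : {linear E -> E}) v : valued (limg (linfun f)) v <->
  exists w, v = clift f w.
Proof.
split=> [h|[w ->] a]; last by rewrite cliftE -(lfunE f) memv_img ?memvf.
exists (clift ((linfun f)^-1)%VF v); apply/ffunP => a; rewrite !cliftE.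
by rewrite -[RHS](lfunE f) limg_lfunVK.
Qed.

Lemma valued_img_hcomp (f : {linear E -> E}) t v : hcomp t v = v ->
  valued (limg (linfun f)) v -> exists2 w, hcomp t w = w & v = clift f w.
Proof.
move=> hv /valued_img[w hw]; exists (hcomp t w); first by rewrite hcomp_id.
by rewrite -hcomp_clift -hw hv.
Qed.

Lemma clift_projv U (v : A) : valued U v -> clift (projv U) v = v.
Proof. by move=> h; apply/ffunP => a; rewrite cliftE projv_id. Qed.

Lemma valued_projv U (v : A) : valued U (clift (projv U) v).
Proof. by move=> a; rewrite cliftE memv_proj. Qed.

(** The quotient map to [E / U], realized inside [E]. *)
Definition coproj (U : {vspace E}) : E -> E := \1%VF - projv U.

HB.instance Definition _ U := GRing.Linear.copy (coproj U) (\1%VF - projv U)%R.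

Lemma coprojE U x : coproj U x = x - projv U x.
Proof. by rewrite /coproj add_lfunE id_lfunE opp_lfunE. Qed.

Lemma coproj0 U (v : A) : valued U v -> clift (coproj U) v = 0.
Proof.
by move=> h; apply/ffunP => a; rewrite cliftE ffunE coprojE projv_id // subrr.
Qed.

Lemma coprojD U (v : A) : v = clift (coproj U) v + clift (projv U) v.
Proof. by apply/ffunP => a; rewrite ffunE !cliftE coprojE subrK. Qed.

(* Exactness of [Q], [Qp] with coefficients in the quotient [E / U]. *)
Lemma Q_inj_mod U b v : (b <= 4 * h)%N -> low b v -> valued U (Q v) -> valued U v.
Proof.
move=> b4 lv vQ; rewrite [v](coprojD U) (_ : clift (coproj U) v = 0) ?add0r.
  exact: valued_projv.
apply: (Q_inj pp pch p5); first by apply: low_clift; apply: low_leq lv.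
by rewrite -clift_Qop coproj0.
Qed.

Lemma ker_Qpow_mod U t v : (t <= 3 * h)%N -> hcomp t v = v -> valued U (Qp v) ->
  exists2 g, v = Q g + clift (projv U) v & forall s, (s + 2 != t)%N -> hcomp s g = 0.
Proof.
move=> t3 hv vQ.
have lv : low t.+1 (clift (coproj U) v) by apply: low_clift; rewrite -hv; apply: hcomp_low.
have [||g _ hg] := ker_Qpow pp pch p5 _ lv; first by lia.
  by rewrite -clift_iterQ coproj0.
have [t2|t2] := leqP 2 t; last first.
  exists 0 => [|s _]; last by rewrite linear0.
  rewrite linear0 {1}[v](coprojD U); congr (_ + _).
  by rewrite -hv -hcomp_clift hg hcomp_Qop0.
exists (hcomp (t - 2) g) => [|s st]; last by rewrite hcomp_neq //; lia.
by rewrite -hcomp_Qop subnK // -hg hcomp_clift hv -coprojD.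
Qed.

Lemma hcomp_DD t v : hcomp t.+1 (DD v) = clift D0 (hcomp t.+1 v) + Pen D (hcomp t v).
Proof. by rewrite /DD linearD /= hcomp_clift hcomp_PenS. Qed.

Lemma hcomp0_DD v : hcomp 0 (DD v) = clift D0 (hcomp 0 v).
Proof. by rewrite /DD linearD /= hcomp_clift hcomp_Pen0 addr0. Qed.

(** The [D i] raise the [y]-degree, so the lowest component only sees [D0]. *)
Lemma iterDD_lowest t v j : (forall s, (s < t)%N -> hcomp s v = 0) ->
  (forall s, (s < t)%N -> hcomp s (iter j DD v) = 0) /\
  hcomp t (iter j DD v) = clift (iter j D0) (hcomp t v).
Proof.
move=> hv; elim: j => [|j [IH1 IH2]].
  by split=> //=; apply/ffunP => a; rewrite cliftE.
have cE : clift (iter j.+1 D0) (hcomp t v) = clift D0 (clift (iter j D0) (hcomp t v)).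
  by apply/ffunP => a; rewrite !cliftE.
rewrite iterS; split=> [[|s] st|].
- by rewrite hcomp0_DD IH1 // linear0.
- by rewrite hcomp_DD !IH1 ?linear0 ?addr0 //; lia.
case: t {hv} IH1 IH2 cE => [|t] IH1 IH2 cE; first by rewrite hcomp0_DD IH2.
by rewrite hcomp_DD IH2 IH1 // linear0 addr0 cE.
Qed.

Lemma hcomp_Qp_shift t (v : A) : hcomp (t + 4 * h)%N (Qp v) = Qp (hcomp t v).
Proof.
by rewrite -hcomp_iterQ; congr (hcomp _ _); have := p_half pp p5; lia.
Qed.

(** The component of [DD v = 0] one degree up says that [Q ^ (p-1)] sends [Pen D kap] into the image
    of [D0]. Exactness modulo that image then exhibits [kap] as the lowest part of some
    [DD^(r-1) u]. *)
Lemma trivial_lowest j v kap : (j <= h)%N -> DD v = 0 ->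
  (forall s, (s < j + 4 * h)%N -> hcomp s v = 0) ->
  hcomp (j + 4 * h) v = Qp kap -> hcomp j kap = kap -> clift D0 kap = 0 ->
  exists u, (forall s, (s < j + 4 * h)%N -> hcomp s (Qp (iter r' DD u)) = 0) /\
    hcomp (j + 4 * h) (Qp (iter r' DD u)) = hcomp (j + 4 * h) v.
Proof.
move=> jh DDv low_v vj hk D0k; have ph := p_half pp p5.
have hPk : hcomp j.+1 (Pen D kap) = Pen D kap by rewrite hcomp_PenS hk.
have [||g gE gs] := @ker_Qpow_mod (limg (linfun D0)) j.+1 (Pen D kap) _ hPk.
- lia.
- apply/valued_img; exists (- hcomp (j + 4 * h).+1 v).
  have := hcomp_DD (j + 4 * h) v; rewrite DDv linear0 vj => /esym/eqP.
  rewrite addrC addr_eq0 => /eqP; rewrite linearN => <-.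
  by rewrite (iterQ_comm (f := Pen D)) // => w; rewrite Qop_Pen.
have [||e he eE] := @valued_img_hcomp D0 j.+1 (clift (projv (limg (linfun D0))) (Pen D kap)).
- by rewrite hcomp_clift hPk.
- exact: valued_projv.
rewrite {}eE in gE.
(* Now [Pen D kap = Q g + D0 e] and [D0 kap = 0]; applying [DD^(r-1)] next turns the left side into
   [Q (kap - e)]. *)
have DDke : DD (kap - e) = Q g - Pen D e.
  by rewrite linearB /= [DD kap]/DD [DD e]/DD D0k add0r gE opprD addrA addrK.
have Qke : Q (kap - e) = Q (iter r' DD g) - iter r' DD (Pen D e).
  by rewrite -iter_rDD DDke linearB /= iterDD_Q.
have hPe : hcomp j.+2 (Pen D e) = Pen D e by rewrite hcomp_PenS he.
have [] := @iterDD_lowest j.+2 (Pen D e) r'.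
  by move=> s sj; rewrite -hPe hcomp_neq //; lia.
rewrite hPe => lowPe loPe.
have gj0 : forall s, (s < j)%N -> hcomp s (iter r' DD g) = 0.
  case: j jh {low_v vj} hk he hPk gs hPe lowPe loPe => // j jh hk he hPk gs hPe lowPe loPe.
  have [l1 l2] := @iterDD_lowest j g r' (fun s sj => gs s ltac:(lia)).
  move=> s sj; have [sj'|sj'] := ltnP s j; first by rewrite l1.
  have -> : s = j by lia.
  apply: (Q_inj pp pch p5); first by apply: low_leq (@hcomp_low _ _ _ _ _); lia.
  have := congr1 (hcomp (j + 2)) Qke; rewrite hcomp_Qop [in RHS]linearB /= hcomp_Qop.
  rewrite lowPe ?subr0 => [<-|]; last by lia.
  by rewrite linearB /= -hk -he !hcomp_neq ?subr0 ?linear0 //; lia.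
(* In [y]-degree [j + 2] the identity [Qke] says that [Q] sends this difference into the image of
   [D0^(r-1)], modulo which [Q] is injective. *)
have [||w' hw' w'E] := @valued_img_hcomp (iter r' D0) j (kap - hcomp j (iter r' DD g)).
- by rewrite linearB /= hcomp_id hk.
- apply: (@Q_inj_mod _ j.+1); first by lia.
    by rewrite -hk -linearB; apply: hcomp_low.
  have := congr1 (hcomp (j + 2)) Qke; rewrite hcomp_Qop [in RHS]linearB /= hcomp_Qop.
  rewrite linearB /= hk -{1}he hcomp_neq ?subr0; last by lia.
  rewrite addn2 loPe linearB /= => ->; rewrite addrC addKr.
  by apply/valued_img; exists (- Pen D e); rewrite linearN.
have [s sj|l1 l2] := @iterDD_lowest j w' r'.
  by rewrite -hw' hcomp_neq //; lia.
exists (g + w').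
have uj : hcomp j (iter r' DD (g + w')) = kap.
  by rewrite linearD linearD /= l2 hw' -w'E addrC subrK.
split=> [s sj|]; last by rewrite hcomp_Qp_shift uj vj.
have [s4|s4] := ltnP s (4 * h); first by rewrite hcomp_iterQ0 //; lia.
rewrite -(subnK s4) hcomp_Qp_shift linearD linearD /= gj0 ?l1 ?addr0 ?linear0 //; lia.
Qed.

Definition tpv d : {vspace A} := limg (linfun (tp d)).

Lemma mem_tpv d v : (v \in tpv d) = (tp d v == v).
Proof.
apply/idP/eqP => [/memv_imgP[u _ ->]|<-]; first by rewrite lfunE /= tp_id.
by rewrite -[tp d v](lfunE (tp d)) memv_img ?memvf.
Qed.

(** As [DD^r = Q], this is [DD^(p r - 1)], the counterpart of [Q^(q-1)] at level [q = p r]. *)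
Definition Tr (u : A) : A := Qp (iter r' DD u).

HB.instance Definition _ := GRing.Linear.copy Tr (Qp \o iter r' DD).

Lemma DD_Tr u : DD (Tr u) = 0.
Proof.
rewrite /Tr DD_Qp -iterS DD_Frobenius -iterSr /=.
exact: (iterpQ0 pp pch p5).
Qed.

Lemma tp_Tr d u : tp (d + 2 * (p * r)%N%:Z - 2) (Tr u) = Tr (tp d u).
Proof.
rewrite /Tr -tp_iterDD -tp_iterQ; congr (tp _ _).
by have := prime_gt0 pp; nia.
Qed.

Definition Xker d := (tpv d :&: lker (linfun DD))%VS.

Lemma mem_Xker d v : reflect (tp d v = v /\ DD v = 0) (v \in Xker d).
Proof.
rewrite memv_cap memv_ker mem_tpv lfunE /=.
by apply: (iffP andP) => [[/eqP ? /eqP ?]|[-> ->]].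
Qed.

Definition Xtriv d := (linfun Tr @: tpv (d + 2 - 2 * (p * r)%N%:Z))%VS.

Lemma mem_Xtriv d v : reflect
  (exists2 u, tp (d + 2 - 2 * (p * r)%N%:Z) u = u & v = Tr u) (v \in Xtriv d).
Proof.
apply: (iffP memv_imgP) => [[u]|[u hu ->]].
  by rewrite mem_tpv lfunE => /eqP hu ->; exists u.
by exists u; rewrite ?lfunE // mem_tpv hu.
Qed.

Lemma Xtriv_sub d : (Xtriv d <= Xker d)%VS.
Proof.
apply/subvP => v /mem_Xtriv[u hu ->]; apply/mem_Xker; split; last exact: DD_Tr.
by rewrite -{2}hu -tp_Tr; congr (tp _ _); lia.
Qed.

Lemma tp_Xtriv d u : tp d (Tr u) \in Xtriv d.
Proof.
apply/mem_Xtriv; exists (tp (d + 2 - 2 * (p * r)%N%:Z) u); first exact: tp_id.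
by rewrite -tp_Tr; congr (tp _ _); lia.
Qed.

Lemma lowest_ker t v : DD v = 0 -> (forall s, (s < t)%N -> hcomp s v = 0) ->
  clift D0 (hcomp t v) = 0.
Proof.
case: t => [|t] DDv hv; first by rewrite -hcomp0_DD DDv linear0.
by have := hcomp_DD t v; rewrite DDv (hv t) // !linear0 addr0.
Qed.

Lemma lowest_Pen t v : DD v = 0 -> Pen D (hcomp t v) = clift D0 (- hcomp t.+1 v).
Proof.
move=> DDv; have := hcomp_DD t v; rewrite DDv linear0 => /esym/eqP.
by rewrite addrC addr_eq0 linearN => /eqP.
Qed.

(** Trivial elements clear one [y]-degree after another: below [5h] the lowest component is some
    [Q ^ (p-1) w], which [trivial_lowest] realizes once the coefficients of [w] are in [ker D0]. *)
Lemma Xker_reduce d t v : (t <= 5 * h)%N -> v \in Xker d ->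
  exists2 s, s \in Xtriv d & forall s', (s' < t)%N -> hcomp s' (v - s) = 0.
Proof.
move=> + vX; elim: t => [|t IH] th; first by exists 0; rewrite ?mem0v.
have [|s sT sv] := IH; first by lia.
have ph := p_half pp p5.
set v1 := v - s in sv; have /mem_Xker[v1d DDv1] : v1 \in Xker d.
  by rewrite memvB //; apply: (subvP (Xtriv_sub d)).
have D0v := lowest_ker DDv1 sv.
have [||w _ wE] := ker_Q pp pch p5 (W := E) (v := hcomp t v1).
- by apply: low_leq (@hcomp_low _ _ _ _ _); lia.
- by rewrite -hcomp_Qop ker_DD_Q ?linear0.
(* Projecting coefficients onto [ker D0] commutes with [Q] and fixes the component, whose
   coefficients are there already. *)
have vw : hcomp t v1 = Qp (clift (projv (lker (linfun D0))) w).
  by rewrite -clift_iterQ -wE clift_projv //; apply/valued_ker.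
(* Below degree [4h] an element of the image of [Q ^ (p-1)] vanishes. *)
have [t4|t4] := ltnP t (4 * h).
  exists s => // s'; rewrite ltnS leq_eqVlt => /orP[/eqP ->|]; last exact: sv.
  by rewrite -hcomp_id vw hcomp_iterQ0 //; lia.
pose j := (t - 4 * h)%N; have tj : t = (j + 4 * h)%N by rewrite /j subnK.
pose kap := hcomp j (clift (projv (lker (linfun D0))) w).
have vk : hcomp (j + 4 * h) v1 = Qp kap by rewrite -hcomp_Qp_shift -vw -tj hcomp_id.
have [|s' s't|||u [u1 u2]] := @trivial_lowest j v1 kap _ DDv1 _ vk.
- by lia.
- by apply: sv; rewrite tj.
- exact: hcomp_id.
- by apply/valued_ker/valued_hcomp/valued_projv.
exists (s + tp d (Tr u)) => [|s' s't]; first by rewrite memvD // tp_Xtriv.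
rewrite opprD addrA linearB /= -tp_hcomp; move: s't; rewrite ltnS leq_eqVlt.
case/orP=> [/eqP ->|s't].
  by rewrite tj /Tr u2 tp_hcomp v1d subrr.
by rewrite sv // /Tr u1 -?tj // linear0 subr0.
Qed.

Section Range.
Variable d : int.
Local Notation n := (d - (5 * h * r)%N%:Z).
Hypothesis d_lt : d < ((5 * h + 3) * r)%N%:Z - 2.
Hypothesis D0_inj : forall m x, m < 2 * r%:Z - 2 -> prE m x = x -> D0 x = 0 -> x = 0.
Hypothesis D0_ex : forall m x, m < r%:Z -> prE m x = x -> iter r' D0 x = 0 ->
  exists y, x = D0 y.

(* Kernel elements modulo trivial ones are represented by those with [cut v = 0], and these
   are determined by their component in the middle degree [5 h]. *)
Definition cut (v : A) : A := [ffun a => if (wt a < 5 * h)%N then v a else 0].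

Fact cut_is_linear : linear cut.
Proof.
move=> c u v; apply/ffunP => a; rewrite !ffunE.
by case: ifP; rewrite // scaler0 addr0.
Qed.
HB.instance Definition _ := GRing.isLinear.Build k A A _ cut cut_is_linear.

Lemma cut0 v : cut v = 0 <-> forall s, (s < 5 * h)%N -> hcomp s v = 0.
Proof.
split=> [c0 s sh|hv]; apply/ffunP => a.
  rewrite hcompE ffunE; case: eqP => // wa; have /ffunP/(_ a) := c0.
  by rewrite !ffunE wa sh.
rewrite !ffunE; case: ifP => // wa; have /ffunP/(_ a) := hv _ wa.
by rewrite hcompE eqxx ffunE.
Qed.

Definition Xhi := (Xker d :&: lker (linfun cut))%VS.

Lemma mem_Xhi v : reflect
  [/\ tp d v = v, DD v = 0 & forall s, (s < 5 * h)%N -> hcomp s v = 0] (v \in Xhi).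
Proof.
rewrite memv_cap memv_ker lfunE /=; apply: (iffP andP) => [[/mem_Xker[? ?] /eqP /cut0]|].
  by [].
by case=> ? ? /cut0 ?; split; [apply/mem_Xker | apply/eqP].
Qed.

Lemma Xker_sum : Xker d = (Xtriv d + Xhi)%VS.
Proof.
apply/eqP; rewrite eqEsubv subv_add Xtriv_sub capvSl !andbT; apply/subvP => v vX.
have [s sT sv] := Xker_reduce (leqnn _) vX.
rewrite -(subrK s v) addrC memv_add //.
have sX : s \in Xker d by apply: subvP sT; apply: Xtriv_sub.
have /mem_Xker[vd Dv] : v - s \in Xker d by rewrite memvB.
exact/mem_Xhi.
Qed.

(** A lowest component in [y]-degree [s > 5h] is killed by [D0] and has degree [d - r s < 2r - 2] in
    [E], where [D0] is injective. *)
Lemma Xhi_inj v : v \in Xhi -> hcomp (5 * h) v = 0 -> v = 0.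
Proof.
move=> /mem_Xhi[vd DDv hv] v5; apply: hcomp_ext => t; rewrite linear0.
suff H t' s : (s <= 5 * h + t')%N -> hcomp s v = 0.
  by apply: (H t); rewrite leq_addl.
elim: t' s => [|t' IH] s st.
  by rewrite addn0 leq_eqVlt in st; case/orP: st => [/eqP -> //|]; apply: hv.
have [|s_gt] := leqP s (5 * h + t'); first exact: IH.
have D0s : clift D0 (hcomp s v) = 0.
  by apply: lowest_ker => // s' s's; apply: IH; lia.
apply/ffunP => a; have /ffunP/(_ a) := D0s; rewrite cliftE !zeroE hcompE.
case: eqP => // wa; apply: (@D0_inj (d - r%:Z * s%:Z)).
  by nia.
by rewrite -{2}vd tpE wa -{1}vd tpE wa pr_id.
Qed.

Definition Zcond kap :=
  [/\ hcomp (5 * h) kap = kap, tp d kap = kap, clift D0 kap = 0, Q kap = 0 &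
      valued (limg (linfun D0)) (Pen D kap)].

(** Corrections [f] and [f'] in [y]-degrees [5h + 1] and [5h + 2] suffice. The second exists because
    [Q kap = 0] puts [Pen D f] in the kernel of [D0^(r-1)], in a degree below [r] where that kernel
    is the image of [D0]. *)
Lemma Zcond_lift kap : Zcond kap -> exists2 v, v \in Xhi & hcomp (5 * h) v = kap.
Proof.
case=> hk dk D0k Qk vP.
have ttp f s x : hcomp s x = x -> tp (d + 2) f = f -> f = clift D0 x ->
    exists y, [/\ hcomp s y = y, tp d y = y & f = clift D0 y].
  move=> hx df fE; exists (tp d x); split; first by rewrite -tp_hcomp hx.
    exact: tp_id.
  by rewrite -tp_cliftD0 -fE df.
have hP : hcomp (5 * h).+1 (Pen D kap) = Pen D kap by rewrite hcomp_PenS hk.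
have [f0 hf0 f0E] := valued_img_hcomp hP vP.
have [|f [hf df fE]] := ttp (Pen D kap) _ f0 hf0 _ f0E; first by rewrite tp_Pen dk.
have DDf : DD (kap - f) = - Pen D f.
  by rewrite linearB /= /DD D0k add0r fE opprD addrA subrr add0r.
have hPf : hcomp (5 * h).+2 (Pen D f) = Pen D f by rewrite hcomp_PenS hf.
have [s sh|_ lo] := @iterDD_lowest (5 * h).+2 (Pen D f) r'.
  by rewrite -hPf hcomp_neq //; lia.
have it0 : clift (iter r' D0) (Pen D f) = 0.
  have := congr1 (hcomp (5 * h).+2) (iter_rDD (kap - f)).
  rewrite DDf linearN linearN /= lo hPf hcomp_QS linearB /= hk -hf hcomp_neq; last by lia.
  by rewrite subr0 Qk => /eqP; rewrite oppr_eq0 => /eqP.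
have dPf : tp (d + 2) (Pen D f) = Pen D f by rewrite tp_Pen df.
have vf : valued (limg (linfun D0)) (Pen D f).
  move=> a; have [|||y ->] := @D0_ex (d + 2 - r%:Z * (5 * h).+2%:Z) (Pen D f a).
  - by nia.
  - rewrite -{1}hPf hcompE; case: eqP => wa; last first.
      by rewrite linear0 -hPf hcompE; case: eqP.
    by rewrite -{2}dPf tpE wa.
  - by have /ffunP/(_ a) := it0; rewrite cliftE ffunE.
  by rewrite -(lfunE D0) memv_img ?memvf.
have [f1 hf1 f1E] := valued_img_hcomp hPf vf.
have [f' [hf' df' f'E]] := ttp (Pen D f) _ f1 hf1 dPf f1E.
exists (kap - f + f'); last first.
  rewrite linearD linearB /= hk -hf -hf' !hcomp_neq ?subr0 ?addr0 //; lia.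
apply/mem_Xhi; split.
- by rewrite linearD linearB /= dk df df'.
(* In [y]-degree [5h + 3] the degree left for [E] is negative. *)
- have PDf' : Pen D f' = 0.
    have df2 : tp (d + 2) (Pen D f') = Pen D f' by rewrite tp_Pen df'.
    apply/ffunP => a; rewrite zeroE -hf' -hcomp_PenS hcompE; case: eqP => // wa.
    by rewrite -df2 tpE wa pr_neg //; nia.
  by rewrite linearD /= DDf /DD -f'E PDf' addr0 addNr.
- by move=> s sh; rewrite linearD linearB /= -hk -hf -hf' !hcomp_neq ?subr0 ?addr0 //; lia.
Qed.

Definition Zspace := (linfun (@hcomp k p E (5 * h)) @: Xhi)%VS.

Lemma mem_Zspace kap : reflect (Zcond kap) (kap \in Zspace).
Proof.
apply: (iffP memv_imgP) => [[v /mem_Xhi[dv DDv lv]]|/Zcond_lift[v vX <-]]; last first.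
  by exists v; rewrite // lfunE.
rewrite lfunE /= => ->; split.
- exact: hcomp_id.
- by rewrite tp_hcomp dv.
- exact: lowest_ker.
- by rewrite -hcomp_QS ker_DD_Q ?linear0.
- by rewrite lowest_Pen //; apply/valued_img; eexists.
Qed.

Definition Ztriv := (linfun (@hcomp k p E (5 * h)) @: (Xtriv d :&: Xhi))%VS.

(** For the converse, [trivial_lowest] gives a trivial element with middle component [kap], and
    [Xhi_inj] identifies it with the lift of [kap]. *)
Lemma mem_Ztriv kap : reflect
  (Zcond kap /\ exists w, [/\ hcomp h w = w, clift D0 w = 0 & kap = Qp w]) (kap \in Ztriv).
Proof.
have ph := p_half pp p5; have e5 : (5 * h = h + 4 * h)%N by lia.
apply: (iffP memv_imgP) => [[v]|[kZ [w [hw D0w kE]]]].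
  rewrite memv_cap lfunE /= => /andP[/mem_Xtriv[u hu vE] vX] ->.
  have kZ : Zcond (hcomp (5 * h) v).
    by apply/mem_Zspace/memv_imgP; exists v; rewrite // lfunE.
  split=> //; pose pK := projv (lker (linfun D0)).
  exists (hcomp h (clift pK (iter r' DD u))); split; first exact: hcomp_id.
    by apply/valued_ker/valued_hcomp/valued_projv.
  rewrite hcomp_clift -clift_iterQ -hcomp_Qp_shift -e5 -/(Tr u) -vE clift_projv //.
  by apply/valued_ker; case: kZ.
have [v vX vk] := Zcond_lift kZ; exists v; last by rewrite lfunE.
rewrite memv_cap vX andbT.
have /mem_Xhi[dv DDv lv] := vX.
have [||u [u1 u2]] := @trivial_lowest h v w (leqnn _) DDv _ _ hw D0w.
- by move=> s; rewrite -e5; apply: lv.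
- by rewrite -e5 vk.
suff -> : v = tp d (Tr u) by apply: tp_Xtriv.
apply/eqP; rewrite -subr_eq0; apply/eqP/Xhi_inj.
  apply/mem_Xhi; split.
  - by rewrite linearB /= dv tp_id.
  - rewrite linearB /= DDv sub0r (_ : tp d (Tr u) = Tr (tp (d + 2 - 2 * (p * r)%N%:Z) u)).
      by rewrite DD_Tr oppr0.
    by rewrite -tp_Tr; congr (tp _ _); lia.
  - by move=> s sh; rewrite linearB /= lv // -tp_hcomp /Tr u1 -?e5 // linear0 subr0.
by rewrite linearB /= -tp_hcomp {2}e5 /Tr u2 -e5 tp_hcomp dv subrr.
Qed.

Lemma Xker_dim : (\dim (Xker d) + \dim Ztriv = \dim (Xtriv d) + \dim Zspace)%N.
Proof.
have inj (U : {vspace A}) : (U <= Xhi)%VS -> \dim (linfun (@hcomp k p E (5 * h)) @: U) = \dim U.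
  move=> UX; apply: limg_dim_eq; apply/eqP; rewrite -subv0; apply/subvP => v.
  rewrite memv_cap memv_ker lfunE /= memv0 => /andP[vU /eqP v0].
  by apply/eqP/Xhi_inj => //; apply: subvP vU.
by rewrite /Ztriv /Zspace !inj ?capvSr // Xker_sum dimv_sum_cap.
Qed.

(* The coefficient of [y_i] in [DD^j]. *)
Fixpoint sop (j : nat) (i : 'I_5) (x : E) : E :=
  if j is j'.+1 then D0 (sop j' i x) + D i (iter j' D0 x) else 0.

Fact sop_is_linear j i : linear (sop j i).
Proof.
elim: j => [|j IH] c x y /=; first by rewrite scaler0 addr0.
by rewrite IH !linearP /= scalerDr addrACA.
Qed.
HB.instance Definition _ j i := GRing.isLinear.Build k E E _ (sop j i) (sop_is_linear j i).

Lemma sop_right j i x : sop j.+1 i x = sop j i (D0 x) + iter j D0 (D i x).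
Proof.
elim: j => [|j IH]; first by rewrite /= linear0.
rewrite -[sop j.+2 i x]/(D0 (sop j.+1 i x) + D i (iter j.+1 D0 x)) IH linearD /=.
by rewrite -iterSr /= addrAC.
Qed.

Lemma prE_sop m j i x : prE (m + 2 * j%:Z - r%:Z) (sop j i x) = sop j i (prE m x).
Proof.
have itD0 l : prE (m + 2 * l%:Z) (iter l D0 x) = iter l D0 (prE m x).
  elim: l => [|l IH]; first by rewrite mulr0 addr0.
  by rewrite /= -IH -prD0; congr (prE _ _); lia.
elim: j => [|j IH]; first by rewrite /= linear0.
rewrite /= linearD /= -itD0 -prD -IH -prD0.
by congr (prE _ _ + prE _ _); lia.
Qed.

Lemma hcomp_iterDD1 t v j : hcomp t v = v -> hcomp t.+1 (iter j DD v) = Pen (sop j) v.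
Proof.
move=> hv; have low s : (s < t)%N -> hcomp s v = 0.
  by move=> st; rewrite -hv hcomp_neq //; lia.
elim: j => [|j IH].
  rewrite /= -hv hcomp_neq; last by lia.
  rewrite /Pen big1 // => i _; rewrite (_ : clift _ _ = 0) ?linear0 //.
have [_ l2] := iterDD_lowest j low.
rewrite iterS hcomp_DD IH l2 hv /Pen linear_sum -big_split /=; apply: eq_bigr => i _.
rewrite clift_mulX -linearD /=; congr (mulX _ _ _); apply/ffunP => a.
by rewrite [LHS]ffunE !cliftE.
Qed.

(** The power [DD^r = Q] has no part linear in [y]. The next two lemmas are this fact with one
    factor [DD] split off on the left and on the right. *)
Lemma sop_r i x : sop r i x = 0.
Proof.
have p2 : (2 < p)%N by lia.
apply: (@Pen_eq0 k p p2 E E (sop r) i x) => v hv.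
by rewrite -[LHS](@hcomp_iterDD1 0 v r hv) DD_Frobenius hcomp_Qop0.
Qed.

Lemma D0_sop i x : D0 (sop r' i x) = - D i (iter r' D0 x).
Proof. by apply/eqP; rewrite -addr_eq0; apply/eqP; have := sop_r i x. Qed.

Lemma sop_D0 i x : sop r' i (D0 x) = - iter r' D0 (D i x).
Proof. by apply/eqP; rewrite -addr_eq0 -sop_right sop_r. Qed.

(** Together with [pi_kill]: [daddv_pi (U :\: V) V] acts on [U] as the quotient map to [U / V], read
    in the complement. *)
Lemma pi_diff (U V : {vspace E}) x : (V <= U)%VS -> x \in U ->
  x - daddv_pi (U :\: V) V x \in V.
Proof.
move=> VU xU; have d0 : ((U :\: V) :&: V = 0)%VS by rewrite capv_diff.
have xs : x \in (U :\: V + V)%VS by rewrite addv_diff (addv_idPl VU).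
by rewrite -{1}(daddv_pi_add d0 xs) addrAC subrr add0r memv_pi.
Qed.

Lemma pi_kill (U V : {vspace E}) x : x \in V -> daddv_pi (U :\: V) V x = 0.
Proof.
move=> xV; have d0 : ((U :\: V) :&: V = 0)%VS by rewrite capv_diff.
have xs : x \in (U :\: V + V)%VS by rewrite (subvP (addvSr _ _)).
have := daddv_pi_add d0 xs; rewrite (daddv_pi_id _ xV) 1?capvC //.
by rewrite -[X in _ = X]add0r => /addIr.
Qed.

Lemma pi_id (U V : {vspace E}) x : x \in (U :\: V)%VS -> daddv_pi (U :\: V) V x = x.
Proof. by move=> xU; rewrite daddv_pi_id ?capv_diff. Qed.

Local Notation m := (n + 2 - r%:Z).

(* [phi], induced by the [D i], and [psi], induced by the linear parts of [DD ^ r'], form a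
   matrix factorization of the quadric between [Kn / Fn] and [Lm / Im]; [Nn] and [Gm] are
   complements representing these quotients. *)
Definition Kn := (lker (linfun D0) :&: limg (linfun (prE n)))%VS.
Definition Fn := (Kn :&: limg (linfun (iter r' D0)))%VS.
Definition Nn := (Kn :\: Fn)%VS.
Definition Lm := (lker (linfun (iter r' D0)) :&: limg (linfun (prE m)))%VS.
Definition Im := (Lm :&: limg (linfun D0))%VS.
Definition Gm := (Lm :\: Im)%VS.

Lemma mem_prE l x : (x \in limg (linfun (prE l))) = (prE l x == x).
Proof.
apply/idP/eqP => [/memv_imgP[u _ ->]|<-]; first by rewrite lfunE /= pr_id.
by rewrite -[prE l x](lfunE (prE l)) memv_img ?memvf.
Qed.

Lemma mem_limg (f : {linear E -> E}) x : f x \in limg (linfun f).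
Proof. by rewrite -(lfunE f) memv_img ?memvf. Qed.

Lemma limgP (f : {linear E -> E}) x : x \in limg (linfun f) -> exists y, x = f y.
Proof. by case/memv_imgP => y _; rewrite lfunE => ->; exists y. Qed.

Lemma mem_Kn x : reflect (D0 x = 0 /\ prE n x = x) (x \in Kn).
Proof.
rewrite memv_cap memv_ker lfunE /= mem_prE.
by apply: (iffP andP) => [[/eqP ? /eqP ?]|[-> ->]].
Qed.

Lemma mem_Lm x : reflect (iter r' D0 x = 0 /\ prE m x = x) (x \in Lm).
Proof.
rewrite memv_cap memv_ker lfunE /= mem_prE.
by apply: (iffP andP) => [[/eqP ? /eqP ?]|[-> ->]].
Qed.

Lemma D_Kn i x : x \in Kn -> D i x \in Lm.
Proof.
move=> /mem_Kn[x0 dx]; apply/mem_Lm; split; last by rewrite prD dx.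
by apply/eqP; rewrite -oppr_eq0 -sop_D0 x0 linear0.
Qed.

Lemma D_Fn i x : x \in Fn -> D i x \in Im.
Proof.
rewrite /Fn memv_cap => /andP[xK /limgP[y xy]]; rewrite memv_cap D_Kn //=.
by rewrite xy -[D i _]opprK -D0_sop -linearN mem_limg.
Qed.

Lemma sop_Lm i x : x \in Lm -> sop r' i x \in Kn.
Proof.
move=> /mem_Lm[x0 dx]; apply/mem_Kn; split; first by rewrite D0_sop x0 linear0 oppr0.
by rewrite -{2}dx -prE_sop; congr (prE _ _); lia.
Qed.

Definition phi i : {linear subvs_of Nn -> subvs_of Gm} :=
  (vsproj Gm \o (daddv_pi Gm Im \o (D i \o vsval))).
Definition psi i : {linear subvs_of Gm -> subvs_of Nn} :=
  (vsproj Nn \o (daddv_pi Nn Fn \o (sop r' i \o vsval))).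

Local Notation vN := (@clift k p _ _ (@vsval k E Nn)).
Local Notation vG := (@clift k p _ _ (@vsval k E Gm)).

Lemma vG_phi v : vG (Pen phi v) = clift (daddv_pi Gm Im) (Pen D (vN v)).
Proof.
rewrite /Pen !linear_sum; apply: eq_bigr => i _ /=; rewrite !clift_mulX.
congr (mulX _ _ _); apply/ffunP => a; rewrite !cliftE /= vsprojK //.
exact: memv_pi.
Qed.

Lemma vN_psi v : vN (Pen psi v) = clift (daddv_pi Nn Fn) (Pen (sop r') (vG v)).
Proof.
rewrite /Pen !linear_sum; apply: eq_bigr => i _ /=; rewrite !clift_mulX.
congr (mulX _ _ _); apply/ffunP => a; rewrite !cliftE /= vsprojK //.
exact: memv_pi.
Qed.

Lemma vN_inj u v : vN u = vN v -> u = v.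
Proof.
move=> h; apply/ffunP => a; apply: subvs_inj.
by have /ffunP/(_ a) := h; rewrite !cliftE.
Qed.

Lemma vG_inj u v : vG u = vG v -> u = v.
Proof.
move=> h; apply/ffunP => a; apply: subvs_inj.
by have /ffunP/(_ a) := h; rewrite !cliftE.
Qed.

Lemma vN_valued v : valued Nn (vN v).
Proof. by move=> a; rewrite cliftE subvsP. Qed.

Lemma vG_valued v : valued Gm (vG v).
Proof. by move=> a; rewrite cliftE subvsP. Qed.

Lemma valuedS (U V : {vspace E}) v : (U <= V)%VS -> valued U v -> valued V v.
Proof. by move=> UV h a; apply: subvP (h a). Qed.

(** The part of [DD^r = Q] quadratic in [y] reads [Pen D (Pen (sop r') y) = Q y] up to the image of
    [D0]. Passing to the complement in between costs only [Im], as [D i] maps [Fn] into [Im]. *)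
Lemma phi_psi v : Pen phi (Pen psi v) = Q v.
Proof.
apply: hcomp_ext => -[|[|t]].
- by rewrite hcomp_Pen0 hcomp_Qop0.
- by rewrite hcomp_Qop0 // hcomp_PenS hcomp_Pen0 linear0.
rewrite hcomp_QS !hcomp_PenS.
move: (hcomp t v) (hcomp_id t v) => {v} v hv; apply: vG_inj.
rewrite vG_phi vN_psi clift_Qop; set y := vG v.
have hy : hcomp t y = y by rewrite /y hcomp_clift hv.
have vy : valued Lm y := valuedS (diffvSl _ _) (vG_valued v).
pose w := Pen (sop r') y.
have vw : valued Kn w by apply: valued_Pen vy => i x; apply: sop_Lm.
have vF : valued Fn (w - clift (daddv_pi Nn Fn) w).
  by move=> a; rewrite subfE cliftE pi_diff ?capvSl.
have vI : valued Im (Pen D (w - clift (daddv_pi Nn Fn) w)).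
  by apply: valued_Pen vF => i x; apply: D_Fn.
have vI' : valued Im (Q y - Pen D w).
  have DDy := congr1 (hcomp t.+2) (DD_Frobenius y).
  rewrite hcomp_QS hy iterS hcomp_DD (@hcomp_iterDD1 t) // in DDy.
  have cE : clift D0 (hcomp t.+2 (iter r' DD y)) = Q y - Pen D w.
    by apply/eqP; rewrite eq_sym subr_eq; apply/eqP; exact: esym DDy.
  have vL : valued Lm (Q y - Pen D w).
    apply: valuedB; first exact: valued_Q.
    by apply: valued_Pen vw => i x; apply: D_Kn.
  by move=> a; rewrite memv_cap vL -cE cliftE mem_limg.
have killI u : valued Im u -> clift (daddv_pi Gm Im) u = 0.
  by move=> h; apply/ffunP => a; rewrite cliftE zeroE pi_kill.
have -> : Pen D (clift (daddv_pi Nn Fn) w) =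
    Q y - (Q y - Pen D w) - Pen D (w - clift (daddv_pi Nn Fn) w).
  by rewrite [Pen D (w - _)]linearB /= !subKr.
move: (Q y - Pen D w) vI' (Pen D (w - _)) vI => I1 vI1 I2 vI2.
rewrite !linearB /= (killI I1) // (killI I2) // !subr0.
apply/ffunP => a; rewrite cliftE pi_id //.
exact: (valued_Q (vG_valued v)).
Qed.

(** Now [DD] acts first: subtracting [D0 e] moves [Pen D y] into [Gm], and applying [DD^(r-1)] gives
    [Q y] up to the image of [D0^(r-1)], that is, up to [Fn]. *)
Lemma psi_phi v : Pen psi (Pen phi v) = Q v.
Proof.
apply: hcomp_ext => -[|[|t]].
- by rewrite hcomp_Pen0 hcomp_Qop0.
- by rewrite hcomp_Qop0 // hcomp_PenS hcomp_Pen0 linear0.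
rewrite hcomp_QS !hcomp_PenS.
move: (hcomp t v) (hcomp_id t v) => {v} v hv; apply: vN_inj.
rewrite vN_psi vG_phi clift_Qop; set y := vN v.
have hy : hcomp t y = y by rewrite /y hcomp_clift hv.
have vy : valued Kn y := valuedS (diffvSl _ _) (vN_valued v).
have D0y : clift D0 y = 0 by apply/valued_ker/(valuedS (capvSl _ _) vy).
pose u := clift (daddv_pi Gm Im) (Pen D y).
have vP : valued Lm (Pen D y) by apply: valued_Pen vy => i x; apply: D_Kn.
have hPy : hcomp t.+1 (Pen D y) = Pen D y by rewrite hcomp_PenS hy.
have hu : hcomp t.+1 u = u by rewrite hcomp_clift hPy.
have vI : valued Im (Pen D y - u) by move=> a; rewrite subfE cliftE pi_diff ?capvSl.
have [||e he eE] := @valued_img_hcomp D0 t.+1 (Pen D y - u).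
- by rewrite linearB /= hPy hu.
- exact: valuedS (capvSr _ _) vI.
have vu : valued Lm u.
  by move=> a; rewrite cliftE (subvP (diffvSl _ _) _ (memv_pi _ _ _)).
have DDye : DD (y - e) = u - Pen D e.
  by rewrite linearB /= /DD D0y add0r -eE opprD opprB addrA addrCA subrr addr0.
have hPe : hcomp t.+2 (Pen D e) = Pen D e by rewrite hcomp_PenS he.
have [s st|_ lo] := @iterDD_lowest t.+2 (Pen D e) r'.
  by rewrite -hPe hcomp_neq //; lia.
have Qy : Q y = Pen (sop r') u - clift (iter r' D0) (Pen D e).
  have := congr1 (hcomp t.+2) (iter_rDD (y - e)).
  rewrite DDye hcomp_QS !linearB /= hy -{2}he hcomp_neq ?linear0 ?subr0 ?addr0; last by lia.
  by rewrite hcomp_iterDD1 // lo hPe => <-.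
have vF : valued Fn (clift (iter r' D0) (Pen D e)).
  have cE : clift (iter r' D0) (Pen D e) = Pen (sop r') u - Q y.
    by rewrite Qy opprB addrC subrK.
  have vK : valued Kn (Pen (sop r') u - Q y).
    by apply: valuedB; [apply: valued_Pen vu => i x; apply: sop_Lm | apply: valued_Q].
  by move=> a; rewrite memv_cap {1}cE vK cliftE mem_limg.
have -> : Pen (sop r') u = Q y + clift (iter r' D0) (Pen D e) by rewrite Qy subrK.
rewrite linearD /= (_ : clift (daddv_pi Nn Fn) (clift _ _) = 0) ?addr0.
  apply/ffunP => a; rewrite cliftE pi_id //.
  exact: (valued_Q (vN_valued v)).
by apply/ffunP => a; rewrite cliftE zeroE pi_kill.
Qed.

(** The single coefficients [phi ord0] and [psi ord0] are already inverse to each other. *)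
Lemma dim_Nn_Gm : \dim {:subvs_of Nn} = \dim {:subvs_of Gm}.
Proof.
have p2 : (2 < p)%N by lia.
have le (V W : vectType k) (f : {linear V -> W}) (g : {linear W -> V}) :
    (forall x, g (f x) = x) -> (\dim {:V} <= \dim {:W})%N.
  move=> gf; rewrite -(@limg_dim_eq _ _ _ (linfun f)) ?dimvS ?subvf //.
  apply/eqP; rewrite -subv0 capfv; apply/subvP => x.
  by rewrite memv_ker lfunE memv0 /= => /eqP fx; rewrite -(gf x) fx linear0.
apply/eqP; rewrite eqn_leq; apply/andP; split.
  by apply: (@le _ _ (phi ord0) (psi ord0)) => x; apply: (Pen_Pen_id p2); apply: psi_phi.
by apply: (@le _ _ (psi ord0) (phi ord0)) => x; apply: (Pen_Pen_id p2); apply: phi_psi.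
Qed.

Local Notation vF := (@clift k p _ _ (@vsval k E Fn)).

Definition jN : {linear E -> subvs_of Nn} := vsproj Nn \o daddv_pi Nn Fn.
Definition jF : {linear E -> subvs_of Fn} :=
  vsproj Fn \o (\1%VF - daddv_pi Nn Fn)%R.

Lemma vN_jN x : vN (clift jN x) = clift (daddv_pi Nn Fn) x.
Proof. by apply/ffunP => a; rewrite !cliftE /= vsprojK ?memv_pi. Qed.

Lemma split_Kn x : valued Kn x -> x = vN (clift jN x) + vF (clift jF x).
Proof.
move=> vx; rewrite vN_jN; apply/ffunP => a; rewrite [RHS]ffunE !cliftE /= vsprojK.
  by rewrite add_lfunE opp_lfunE id_lfunE addrC subrK.
by rewrite add_lfunE opp_lfunE id_lfunE pi_diff ?capvSl.
Qed.

Lemma vF_valued v : valued Fn (vF v).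
Proof. by move=> a; rewrite cliftE subvsP. Qed.

Lemma vN_vF_eq0 u v : vN u + vF v = 0 -> u = 0 /\ v = 0.
Proof.
move=> e; have h a : vN u a = 0 /\ vF v a = 0.
  have /ffunP/(_ a) := e; rewrite zeroE ffunE => /eqP; rewrite addr_eq0 => /eqP ea.
  have : vN u a \in (Nn :&: Fn)%VS by rewrite memv_cap vN_valued ea memvN vF_valued.
  by rewrite capv_diff memv0 => /eqP uv; move/eqP: ea; rewrite uv eq_sym oppr_eq0 => /eqP.
split; apply/ffunP => a; rewrite zeroE; apply: subvs_inj; have [] := h a;
  by rewrite !cliftE linear0.
Qed.

(** On [Fn] the pencil lands in [Im], so only [Q = 0] remains; on [Nn] the condition [Pen phi = 0]
    implies [Q = 0] through [psi]. *)
Lemma Zcond_split kap : Zcond kap <->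
  [/\ hcomp (5 * h) kap = kap, valued Kn kap, Pen phi (clift jN kap) = 0
    & Q (clift jF kap) = 0].
Proof.
split=> [[hk dk D0k Qk vP]|[hk vK Pk QF]].
  have vK : valued Kn kap.
    move=> a; apply/mem_Kn; split; first by rewrite -cliftE D0k zeroE.
    have [wa|wa] := eqVneq (wt a) (5 * h)%N; last first.
      by rewrite -hk hcompE (negbTE wa) linear0.
    by rewrite -{2}dk tpE wa; congr (prE _ _); lia.
  have := split_Kn vK; set kN := clift jN kap; set kF := clift jF kap => kE.
  have [QN QF] : Q kN = 0 /\ Q kF = 0.
    by apply: vN_vF_eq0; rewrite !clift_Qop -linearD /= -kE Qk.
  split=> //; apply: vG_inj; rewrite vG_phi linear0.
  have vI : valued Im (Pen D (vN kN)).
    have vL : valued Lm (Pen D (vN kN)).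
      by apply: (valued_Pen (fun i x => @D_Kn i x)); apply: valuedS (vN_valued _); apply: diffvSl.
    move=> a; rewrite memv_cap vL /=.
    have vIF : valued (limg (linfun D0)) (Pen D (vF kF)).
      apply: (valuedS (capvSr Lm _)).
      by apply: (valued_Pen (fun i x => @D_Fn i x)); apply: vF_valued.
    have -> : Pen D (vN kN) = Pen D kap - Pen D (vF kF).
      by rewrite [in RHS]kE linearD /= addrK.
    exact: valuedB.
  by apply/ffunP => a; rewrite cliftE zeroE pi_kill.
have kE := split_Kn vK.
move: (clift jN kap) (clift jF kap) kE Pk QF => kN kF kE Pk QF; split=> //.
- apply/ffunP => a; rewrite tpE.
  have [wa|wa] := eqVneq (wt a) (5 * h)%N; last first.
    by rewrite -hk hcompE (negbTE wa) linear0.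
  have /mem_Kn[_ <-] := vK a; rewrite wa.
  by rewrite (_ : d - r%:Z * (5 * h)%N%:Z = n) ?pr_id //; lia.
- by apply/ffunP => a; rewrite cliftE zeroE; have /mem_Kn[] := vK a.
- by rewrite kE linearD /= -!clift_Qop QF linear0 addr0 -psi_phi Pk !linear0.
- rewrite kE linearD /= => a; rewrite ffunE memvD //; last first.
    apply: (subvP (capvSr Lm _)).
    by apply: (valued_Pen (fun i x => @D_Fn i x)); apply: vF_valued.
  apply: (subvP (capvSr Lm _)); have := vG_phi kN; rewrite Pk linear0 => /esym/ffunP/(_ a).
  rewrite cliftE zeroE => e0; rewrite -[_ a]subr0 -[X in _ - X]e0 pi_diff ?capvSl //.
  by apply: (valued_Pen (fun i x => @D_Kn i x)); apply: valuedS (vN_valued _); apply: diffvSl.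
Qed.

Local Notation A_ W := {ffun mon p -> W}.

Lemma jN_vN u : clift jN (vN u) = u.
Proof. by apply: vN_inj; rewrite vN_jN; apply/ffunP => a; rewrite !cliftE pi_id ?subvsP. Qed.

Lemma jN_vF u : clift jN (vF u) = 0.
Proof.
apply: vN_inj; rewrite vN_jN linear0; apply/ffunP => a.
by rewrite !cliftE zeroE pi_kill ?subvsP.
Qed.

Lemma jF_vF u : clift jF (vF u) = u.
Proof.
apply/ffunP => a; apply: subvs_inj; rewrite !cliftE /=.
by rewrite add_lfunE opp_lfunE id_lfunE pi_kill ?subvsP // subr0 vsprojK ?subvsP.
Qed.

Lemma jF_vN u : clift jF (vN u) = 0.
Proof.
apply/ffunP => a; rewrite !cliftE zeroE /= add_lfunE opp_lfunE id_lfunE pi_id ?subvsP //.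
by rewrite subrr linear0.
Qed.

Lemma valued_Kn_sum u v : valued Kn (vN u + vF v).
Proof.
move=> a; rewrite ffunE memvD //.
  by apply: (subvP (diffvSl _ _)); apply: vN_valued.
by apply: (subvP (capvSl _ _)); apply: vF_valued.
Qed.

Lemma jsum u v : clift jN (vN u + vF v) = u /\ clift jF (vN u + vF v) = v.
Proof. by rewrite !linearD /= jN_vN jN_vF jF_vF jF_vN addr0 add0r. Qed.

Lemma dim_split (U : {vspace A_ (subvs_of Nn)}) (V : {vspace A_ (subvs_of Fn)}) :
  \dim (linfun vN @: U + linfun vF @: V) = (\dim U + \dim V)%N.
Proof.
rewrite dimv_disjoint_sum; last first.
  apply/eqP; rewrite -subv0; apply/subvP => x; rewrite memv_cap memv0.
  case/andP=> /memv_imgP[u _]; rewrite lfunE /= => -> /memv_imgP[v _]; rewrite lfunE /= => e.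
  have [|-> _] := @vN_vF_eq0 u (- v); first by rewrite linearN /= e subrr.
  by rewrite linear0.
congr (_ + _)%N; apply: limg_dim_eq; apply/eqP; rewrite -subv0; apply/subvP => x;
  rewrite memv_cap memv_ker memv0 lfunE /= => /andP[_ /eqP x0]; apply/eqP.
  by have [] := @vN_vF_eq0 x 0; rewrite ?linear0 ?addr0.
by have [] := @vN_vF_eq0 0 x; rewrite ?linear0 ?add0r.
Qed.

Lemma Zspace_split : Zspace =
  (linfun vN @: (homg p (subvs_of Nn) (5 * h) :&: lker (linfun (Pen phi))) +
   linfun vF @: (homg p (subvs_of Fn) (5 * h) :&: lker (linfun (@Qop k p (subvs_of Fn)))))%VS.
Proof.
apply/vspaceP => kap; apply/mem_Zspace/memv_addP => [/Zcond_split[hk vK Pk QF]|].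
  exists (vN (clift jN kap)); last exists (vF (clift jF kap)); last exact: split_Kn.
    rewrite -[vN _]lfunE memv_img // memv_cap memv_ker lfunE /= Pk eqxx andbT.
    by rewrite mem_homg hcomp_clift hk.
  rewrite -[vF _]lfunE memv_img // memv_cap memv_ker lfunE /= QF eqxx andbT.
  by rewrite mem_homg hcomp_clift hk.
case=> x /memv_imgP[u]; rewrite memv_cap memv_ker !lfunE mem_homg /= => /andP[/eqP hu /eqP Pu] ->.
case=> y /memv_imgP[v]; rewrite memv_cap memv_ker !lfunE mem_homg /= => /andP[/eqP hv /eqP Qv] ->.
move=> ->; apply/Zcond_split; have [-> ->] := jsum u v; split=> //.
  by rewrite linearD /= !hcomp_clift hu hv.
exact: valued_Kn_sum.
Qed.

Lemma Ztriv_split : Ztriv =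
  (linfun vN @: trivker (Pen phi) h +
   linfun vF @: trivker (@Qop k p (subvs_of Fn)) h)%VS.
Proof.
have ph := p_half pp p5; have e5 : (5 * h = h + 4 * h)%N by lia.
apply/vspaceP => kap; apply/mem_Ztriv/memv_addP.
  case=> /Zcond_split[hk vK Pk QF] [w [hw D0w kE]].
  exists (vN (clift jN kap)); last exists (vF (clift jF kap)); last exact: split_Kn.
    rewrite -[vN _]lfunE memv_img //; apply/trivkerP; exists (clift jN w); split=> //.
      by rewrite mem_homg hcomp_clift hw.
    by rewrite kE clift_iterQ.
  rewrite -[vF _]lfunE memv_img //; apply/trivkerP; exists (clift jF w); split=> //.
    by rewrite mem_homg hcomp_clift hw.
  by rewrite kE clift_iterQ.
case=> x /memv_imgP[u /trivkerP[uw [huw uE Pu]]]; rewrite lfunE /= => ->.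
case=> y /memv_imgP[v /trivkerP[vw [hvw vE Qv]]]; rewrite lfunE /= => -> ->.
rewrite !mem_homg in huw hvw.
have kE : vN u + vF v = Qp (vN uw + vF vw) by rewrite uE vE linearD /= !clift_iterQ.
have hw : hcomp h (vN uw + vF vw) = vN uw + vF vw.
  by rewrite linearD /= !hcomp_clift (eqP huw) (eqP hvw).
split.
  apply/Zcond_split; have [-> ->] := jsum u v; split=> //; last exact: valued_Kn_sum.
  by rewrite kE e5 hcomp_Qp_shift hw.
exists (vN uw + vF vw); split=> //.
apply/ffunP => a; rewrite cliftE zeroE.
by have /mem_Kn[] := valued_Kn_sum uw vw a.
Qed.

(** [ker_mid] applies to both summands of the middle component: to [phi] and [psi] with [a = 1], and
    on [Fn] to [Q] times the identity with [a = 2]. *)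
Theorem Xker_rec : (\dim (Xker d))%:Z =
  (\dim (Xtriv d))%:Z + (\dim Fn)%:Z * nu p 2 + ((\dim Kn)%:Z - (\dim Fn)%:Z) * nu p 1.
Proof.
have ph := p_half pp p5.
have dN : \dim {:subvs_of Nn} = \dim Nn by rewrite dimvf.
have dF : \dim {:subvs_of Fn} = \dim Fn by rewrite dimvf.
have k1 := (@ker_mid k p pp pch p5 (subvs_of Nn) (subvs_of Gm) 1 (Pen phi)
    (Pen (fun i => adjoint (psi i))) (Pen psi) (Pen (fun i => adjoint (phi i))) isT
    dim_Nn_Gm (hcomp_Pen phi) (hcomp_Pen psi) phi_psi psi_phi
    (hcomp_Pen (fun i => adjoint (phi i))) (hcomp_Pen (fun i => adjoint (psi i)))
    (adjoint_factorization psi_phi) (adjoint_factorization phi_psi) (fdot_Pen phi)).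
have h0 (V : vectType k) t (v : A_ V) : hcomp (t + (2 - 2)) (idfun v) = idfun (hcomp t v).
  by rewrite /= addn0.
have k2 := (@ker_mid k p pp pch p5 (subvs_of Fn) (subvs_of Fn) 2 (@Qop k p (subvs_of Fn))
  idfun idfun (@Qop k p (subvs_of Fn)) isT erefl (@hcomp_Qop k p _) (h0 _)
  (fun=> erefl) (fun=> erefl) (@hcomp_Qop k p _) (h0 _) (fun=> erefl) (fun=> erefl)
  (@fdot_Qop k p _)).
have := Xker_dim; rewrite Zspace_split Ztriv_split !dim_split.
rewrite dN in k1; rewrite dF in k2.
have kd : (\dim Fn + \dim Nn = \dim Kn)%N.
  by rewrite -(dimv_cap_compl Kn Fn) /Nn; congr (\dim _ + _)%N; rewrite /Fn capvA capvv.
have kd' : (\dim Kn)%:Z - (\dim Fn)%:Z = (\dim Nn)%:Z by rewrite -kd; lia.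
rewrite kd' -k1 -k2.
move: (\dim (trivker (@Qop _ _ _) _)) => x1.
move: (\dim (trivker _ _)) => x2.
move: (\dim (_ :&: lker (linfun (@Qop _ _ _)))) => x3.
move: (\dim (_ :&: _)) => x4.
lia.
Qed.

End Range.
End Pencil.

Lemma addfE (V : nmodType) n (u v : {ffun mon n -> V}) a : (u + v) a = u a + v a.
Proof. by rewrite !ffunE. Qed.

(** * From level pr to level r *)

Section Levels.
Variables (k : fieldType) (p : nat).
Hypotheses (pp : prime p) (pch : p \in [pchar k]) (p5 : (5 <= p)%N).
Local Notation h := (p./2).

Definition prz n (m : int) (v : {ffun mon n -> k^o}) : {ffun mon n -> k^o} :=
  if m is Posz t then hcomp t v else 0.

Fact prz_is_linear n m : linear (@prz n m).
Proof. by move=> c u v; case: m => t /=; rewrite ?linearP // scaler0 addr0. Qed.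
HB.instance Definition _ n m := GRing.isLinear.Build k {ffun mon n -> k^o} {ffun mon n -> k^o} _
  (@prz n m) (@prz_is_linear n m).

Section Step.
Variables (r : nat) (r_gt2 : (2 < r)%N).
Local Notation r' := r.-1.
Local Notation E := {ffun mon r -> k^o}.
Local Notation B := {ffun mon (p * r) -> k^o}.
Local Notation A := {ffun mon p -> E}.

Lemma r_gt0 : (0 < r)%N. Proof. exact: ltnW (ltnW r_gt2). Qed.

Lemma rK : r'.+1 = r. Proof. exact: prednK r_gt0. Qed.

(* Multiplication by [x_i ^ 2] carries into [y_i] exactly on the exponents [r - 2] and
   [r - 1]; [carry i] is the resulting coefficient of [y_i]. *)
Definition wrap (a : mon r) i : mon r :=
  [ffun j => if j == i then Ordinal (ltn_pmod (a j + (r - 2)) r_gt0) else a j].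

Definition carry (i : 'I_5) (v : E) : E :=
  [ffun a : mon r => if (a i < 2)%N then v (wrap a i) else 0].

Fact carry_is_linear i : linear (carry i).
Proof.
move=> c u v; apply/ffunP => a; rewrite !ffunE.
by case: ifP; rewrite // scaler0 addr0.
Qed.
HB.instance Definition _ i := GRing.isLinear.Build k E E _ (carry i) (carry_is_linear i).

Lemma cmb_proof (b : 'I_p) (a : 'I_r) : (b * r + a < p * r)%N.
Proof. have := ltn_ord b; have := ltn_ord a; nia. Qed.

Definition cmb (b : mon p) (a : mon r) : mon (p * r) :=
  [ffun i => Ordinal (cmb_proof (b i) (a i))].

Lemma cmbE b a i : cmb b a i = (b i * r + a i)%N :> nat.
Proof. by rewrite ffunE. Qed.

Lemma quo_proof (c : 'I_(p * r)) : (c %/ r < p)%N.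
Proof. by rewrite ltn_divLR ?r_gt0. Qed.

Definition quo (c : mon (p * r)) : mon p := [ffun i => Ordinal (quo_proof (c i))].
Definition rem (c : mon (p * r)) : mon r := [ffun i => Ordinal (ltn_pmod (c i) r_gt0)].

Lemma quo_cmb b a : quo (cmb b a) = b.
Proof.
apply: mon_eqP => i; rewrite ffunE /= cmbE divnMDl ?r_gt0 // divn_small ?ltn_ord //.
exact: addn0.
Qed.

Lemma rem_cmb b a : rem (cmb b a) = a.
Proof. by apply: mon_eqP => i; rewrite ffunE /= cmbE modnMDl modn_small ?ltn_ord. Qed.

Lemma cmb_quo_rem c : cmb (quo c) (rem c) = c.
Proof. by apply: mon_eqP => i; rewrite cmbE !ffunE /= -divn_eq. Qed.

Lemma wt_cmb b a : wt (cmb b a) = (r * wt b + wt a)%N.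
Proof.
rewrite /wt big_distrr -big_split /=; apply: eq_bigr => i _.
by rewrite cmbE mulnC.
Qed.

(** Each monomial is decomposed by [x_i ^ c = y_i ^ (c / r) x_i ^ (c mod r)]. *)
Definition split (v : B) : A := [ffun b => [ffun a => v (cmb b a)]].
Definition unsplit (w : A) : B := [ffun c => w (quo c) (rem c)].

Lemma splitE v b a : split v b a = v (cmb b a).
Proof. by rewrite !ffunE. Qed.

Fact split_is_linear : linear split.
Proof.
by move=> c u v; apply/ffunP => b; apply/ffunP => a; rewrite !ffunE.
Qed.
HB.instance Definition _ := GRing.isLinear.Build k B A _ split split_is_linear.

Lemma unsplitK : cancel unsplit split.
Proof.
by move=> w; apply/ffunP => b; apply/ffunP => a; rewrite splitE ffunE quo_cmb rem_cmb.
Qed.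

Lemma splitK : cancel split unsplit.
Proof. by move=> v; apply/ffunP => c; rewrite ffunE splitE cmb_quo_rem. Qed.

Local Notation DDr := (@DD k p E (@Qop k r k^o) carry).

Lemma split_Qop v : split (Qop v) = DDr (split v).
Proof.
apply/ffunP => b; apply/ffunP => a; rewrite splitE /DD addfE addfE cliftE.
rewrite /Qop /Pen !sum_ffunE -big_split /=; apply: eq_bigr => i _.
rewrite !mulXE splitE cmbE.
have an := ltn_ord (a i); have bn := ltn_ord (b i).
case: (leqP 1 (b i)) => b1; last first.
  have b0 : (b i : nat) = 0%N by lia.
  rewrite zeroE addr0 b0 mul0n add0n; case: ifP => a2 //.
  congr (v _); apply: mon_eqP => j; rewrite msubE !cmbE msubE.
  by case: (eqVneq j i) => [->|_]; rewrite ?b0 ?subn0.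
rewrite cliftE [carry _ _ _]ffunE; case: (leqP 2 (a i)) => a2.
  rewrite addr0 (leq_trans a2 (leq_addl _ _)).
  congr (v _); apply: mon_eqP => j; rewrite msubE !cmbE msubE.
  by case: (eqVneq j i) => [->|_]; rewrite ?subn0 // addnBA.
have -> : (2 <= b i * r + a i)%N.
  move: b1 a2 an bn; move: (nat_of_ord (b i)) (nat_of_ord (a i)) => x y; nia.
rewrite add0r.
rewrite splitE; congr (v _); apply: mon_eqP => j; rewrite msubE !cmbE msubE ffunE.
case: (eqVneq j i) => [->|_]; last by rewrite !subn0.
move: b1 a2 an bn => /=; move: (nat_of_ord (b i)) (nat_of_ord (a i)) => x y *.
rewrite modn_small; last by lia.
rewrite mulnBl mul1n; nia.
Qed.

Lemma split_mulX i m v : split (mulX i (r * m) v) = mulX i m (split v).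
Proof.
apply/ffunP => b; apply/ffunP => a; rewrite splitE !mulXE cmbE.
have -> : (r * m <= b i * r + a i)%N = (m <= b i)%N.
  have := ltn_ord (a i); have := r_gt0; nia.
case: ifP => mb; last by rewrite zeroE.
rewrite splitE; congr (v _); apply: mon_eqP => j.
rewrite msubE !cmbE msubE; case: (eqVneq j i) => [->|_]; last by rewrite !subn0.
by rewrite mulnBl (mulnC r) addnBAC // leq_mul2r mb orbT.
Qed.

Lemma split_iterQ j v : split (iter j (@Qop k _ _) v) = iter j DDr (split v).
Proof. by elim: j => //= j <-; rewrite split_Qop. Qed.

(** Frobenius: [Q ^ r] is the sum of the [x_i ^ (2 r) = y_i ^ 2]. *)
Lemma DD_Frob e w : r = (p ^ e)%N -> iter r'.+1 DDr w = Qop w.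
Proof.
move=> re; have F (v : B) : iter r (@Qop k (p * r) k^o) v = \sum_i mulX i (r * 2) v.
  by have := @iterQ_Frobenius k p e (p * r)%N k^o v pp pch; rewrite -re.
rewrite rK -{1}(unsplitK w) -split_iterQ F linear_sum.
by apply: eq_bigr => i _ /=; rewrite split_mulX unsplitK.
Qed.

Lemma split_hcomp d v : split (hcomp d v) = tp r' (@prz r) d%:Z (split v).
Proof.
apply/ffunP => b; rewrite tpE; apply/ffunP => a; rewrite splitE hcompE wt_cmb rK.
have [le|lt] := leqP (r * wt b) d.
  rewrite (_ : d%:Z - r%:Z * (wt b)%:Z = (d - r * wt b)%N%:Z); last by lia.
  rewrite /= hcompE splitE; congr (if _ then _ else _); apply/eqP/eqP; lia.
have : d%:Z - r%:Z * (wt b)%:Z < 0 by lia.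
case: (d%:Z - _) => // t _; rewrite /= zeroE; case: eqP => //; lia.
Qed.

Lemma prz_neg n m (x : {ffun mon n -> k^o}) : m < 0 -> prz m x = 0.
Proof. by case: m. Qed.

Lemma prz_id n m (x : {ffun mon n -> k^o}) : prz m (prz m x) = prz m x.
Proof. by case: m => t //=; rewrite hcomp_id. Qed.

Lemma prz_Qop n m (x : {ffun mon n -> k^o}) : prz (m + 2) (Qop x) = Qop (prz m x).
Proof.
case: m => [t|[|t]] /=; rewrite ?linear0.
- by rewrite hcomp_Qop.
- by rewrite hcomp_Qop0.
- case: t => [|t] //=; first by rewrite hcomp_Qop0.
Qed.

Lemma prz_carry m i (x : E) : prz (m + 2 - r'.+1%:Z) (carry i x) = carry i (prz m x).
Proof.
rewrite rK; have wt_wrap (a : mon r) : (a i < 2)%N -> wt (wrap a i) = (wt a + (r - 2))%N.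
  move=> a2; rewrite /wt (bigD1 i) //= [in RHS](bigD1 i) //= ffunE eqxx /=.
  rewrite modn_small; last by lia.
  rewrite addnAC; congr (_ + _ + _)%N.
  by apply: eq_bigr => j ji; rewrite ffunE (negbTE ji).
apply/ffunP => a; case: m => t /=; last first.
  rewrite (_ : prz _ _ = 0); last by apply: prz_neg; lia.
  by rewrite linear0.
rewrite [RHS]ffunE; case: ifP => a2; last first.
  case: (t%:Z + 2 - r%:Z) => u /=; rewrite ?zeroE // hcompE [carry _ _ _]ffunE a2.
  by rewrite if_same.
rewrite hcompE wt_wrap //.
have [le|lt] := leqP r (t + 2).
  rewrite (_ : t%:Z + 2 - r%:Z = (t + 2 - r)%N%:Z); last by lia.
  rewrite /= hcompE [carry _ _ _]ffunE a2; congr (if _ then _ else _).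
  by apply/eqP/eqP; lia.
rewrite prz_neg ?zeroE; last by lia.
by case: eqP => //; lia.
Qed.

Lemma split_Qpow e v : r = (p ^ e)%N ->
  split (iter (p * r).-1 (@Qop k _ _) v) = Tr r' (@Qop k r k^o) carry (split v).
Proof.
move=> re; have E : (p * r).-1 = (p.-1 * r'.+1 + r')%N.
  by rewrite rK; have := prime_gt0 pp; have := r_gt0; nia.
rewrite split_iterQ E iterD iterM /Tr; apply: eq_iter => w.
exact: DD_Frob re.
Qed.

Lemma split_inj : injective split. Proof. exact: can_inj splitK. Qed.

Lemma dim_split_img (U : {vspace B}) : \dim (linfun split @: U) = \dim U.
Proof.
apply: limg_dim_eq; apply/eqP; rewrite -subv0; apply/subvP => v.
rewrite memv_cap memv_ker lfunE memv0 /= => /andP[_ /eqP v0].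
by apply/eqP/split_inj; rewrite v0 linear0.
Qed.

End Step.

Definition Q_inj_upto n := forall m (x : {ffun mon n -> k^o}),
  m < 2 * n%:Z - 2 -> prz m x = x -> Qop x = 0 -> x = 0.

Definition Q_ex_upto n := forall m (x : {ffun mon n -> k^o}),
  m < n%:Z -> prz m x = x -> iter n.-1 (@Qop k _ _) x = 0 -> exists y, x = Qop y.

(** No induction on [e] is needed: [DD_inj_low] and [im_DD_low] rest on exactness over [A_p] and the
    Frobenius identity, and ask for no exactness of [D0]. *)
Lemma Q_levels e n : n = (p ^ e.+1)%N -> Q_inj_upto n /\ Q_ex_upto n.
Proof.
have ph := p_half pp p5.
case: e => [|e].
  rewrite expn1 => ->; split=> m x mn hx Qx; case: m hx mn => t //= hx mn.
  - apply: (Q_inj pp pch p5) => //; rewrite -hx; apply: low_leq (@hcomp_low _ _ _ _ _); lia.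
  - have lx : low t.+1 x by rewrite -hx; apply: hcomp_low.
    have [|y _ ->] := ker_Qpow pp pch p5 _ lx Qx; first by lia.
    by exists y.
  - by exists 0; rewrite linear0 -hx.
set r := (p ^ e.+1)%N; rewrite expnS -/r => ->.
have r2 : (2 < r)%N by rewrite /r expnS; have := expn_gt0 p e; nia.
have Fr w := @DD_Frob r r2 e.+1 w erefl.
have rE := rK r2.
split=> m x mn hx Qx; case: m hx mn => t //= hx mn.
- apply: split_inj; rewrite linear0.
  have hx' : tp r.-1 (@prz r) t%:Z (split r2 x) = split r2 x by rewrite -(split_hcomp r2) hx.
  apply: (DD_inj_low pp pch p5 (@prz_neg r) (@prz_id r) (@prz_Qop r) (prz_carry r2) Fr _ hx').
    by rewrite rE.
  by rewrite -(split_Qop r2) Qx linear0.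
- have hx' : tp r.-1 (@prz r) t%:Z (split r2 x) = split r2 x by rewrite -(split_hcomp r2) hx.
  have [||u _ uE] := im_DD_low pp pch p5 (@prz_neg r) (@prz_id r) (@prz_Qop r) (prz_carry r2)
      Fr _ hx'.
  + by rewrite rE.
  + by have := split_Qpow r2 (e := e.+1) x erefl; rewrite Qx linear0.
  exists (unsplit r2 u); apply: split_inj.
  by rewrite (split_Qop r2) unsplitK.
- by exists 0; rewrite linear0 -hx.
Qed.

Lemma dim_regular : \dim {:k^o} = 1%N.
Proof. by rewrite dimvf. Qed.

Definition kd n d := \dim (homg n k^o d :&: lker (linfun (@Qop k n k^o))).

(** For [j < n], the dimension of [Q ^ (n-1)] applied to degree [j]; see [dim_Qpow]. *)
Definition Ydim n (j : int) : int :=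
  if j is Posz t then (cA n t)%:Z - cAz n (t%:Z - 2) else 0.

(** Below degree [n] the kernel of [Q ^ (n-1)] is the image of [Q], and [Q] is injective there. *)
Lemma dim_Qpow e n t : n = (p ^ e.+1)%N -> (t < n)%N ->
  (\dim (linfun (iter n.-1 (@Qop k n k^o)) @: homg n k^o t))%:Z = Ydim n t%:Z.
Proof.
move=> ne tn; have [h1 h2] := Q_levels ne.
have := limg_ker_dim (linfun (iter n.-1 (@Qop k n k^o))) (homg n k^o t).
have Qn0 (v : {ffun mon n -> k^o}) : iter n.-1 (@Qop k n k^o) (Qop v) = 0.
  have n0 : (0 < n)%N by rewrite ne expn_gt0 prime_gt0.
  rewrite -iterSr prednK //.
  have := @iterQ_Frobenius k p e.+1 n k^o v pp pch; rewrite -ne => ->.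
  by apply: big1 => i _; rewrite mulX_ge //; lia.
suff kE : (\dim (homg n k^o t :&: lker (linfun (iter n.-1 (@Qop k n k^o)))))%:Z
    = cAz n (t%:Z - 2).
  rewrite dim_homg dim_regular muln1 /Ydim -kE.
  move: (\dim _) (\dim _) => x y; lia.
have [t2|t2] := leqP 2 t; last first.
  rewrite (_ : cAz n (t%:Z - 2) = 0); last by case: (t) t2 => [|[|]].
  congr Posz; apply/eqP; rewrite dimv_eq0 -subv0; apply/subvP => v.
  rewrite memv_cap memv_ker lfunE mem_homg memv0 /= => /andP[/eqP hv /eqP Qv].
  have [//||y yE] := h2 t%:Z v _ _ Qv; first by [].
  by rewrite -hv yE hcomp_Qop0.
have -> : (homg n k^o t :&: lker (linfun (iter n.-1 (@Qop k n k^o))) =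
    linfun (@Qop k n k^o) @: homg n k^o (t - 2))%VS.
  apply/vspaceP => v; rewrite memv_cap memv_ker lfunE mem_homg /=.
  apply/andP/memv_imgP => [[/eqP hv /eqP Qv]|[u]].
    have [//||y yE] := h2 t%:Z v _ _ Qv; first by [].
    exists (hcomp (t - 2) y); first exact: hcomp_homg.
    by rewrite lfunE /= -hcomp_Qop subnK // -yE hv.
  by rewrite mem_homg lfunE /= => /eqP hu ->; rewrite Qn0 -{1}(subnK t2) hcomp_Qop hu.
rewrite limg_dim_eq; last first.
  apply/eqP; rewrite -subv0; apply/subvP => v.
  rewrite memv_cap memv_ker lfunE mem_homg memv0 /= => /andP[/eqP hv /eqP Qv].
  by apply/eqP/(h1 (t - 2)%N%:Z) => //; lia.
by rewrite dim_homg dim_regular muln1 (_ : t%:Z - 2 = (t - 2)%N%:Z) //; lia.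
Qed.

(** [Xker_rec] for [D0 = Q] on [A_r]: there [Kn] is the kernel of [Q] in degree [n], and [Fn] the
    image under [Q ^ (r-1)] of degree [n - 2 (r - 1)]. *)
Theorem level_rec e r (d : nat) : r = (p ^ e.+1)%N ->
  d%:Z < ((5 * h + 3) * r)%N%:Z - 2 ->
  let n := d%:Z - (5 * h * r)%N%:Z in
  (kd (p * r) d)%:Z =
    Ydim (p * r) (d%:Z + 2 - 2 * (p * r)%N%:Z) + Ydim r (n + 2 - 2 * r%:Z) * nu p 2 +
    ((if n is Posz t then (kd r t)%:Z else 0) - Ydim r (n + 2 - 2 * r%:Z)) * nu p 1.
Proof.
move=> re dr n; have ph := p_half pp p5.
have r2 : (2 < r)%N by rewrite re expnS; have := expn_gt0 p e; nia.
have qe : (p * r)%N = (p ^ e.+2)%N by rewrite expnS re.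
have rE := rK r2; have [h1 h2] := Q_levels re; have [g1 g2] := Q_levels qe.
have Fr w := @DD_Frob r r2 e.+1 w re.
have h1' m x : m < 2 * r.-1.+1%:Z - 2 -> prz m x = x -> Qop x = 0 -> x = 0 :> {ffun mon r -> k^o}.
  by rewrite rE; apply: h1.
have h2' m x : m < r.-1.+1%:Z -> prz m x = x -> iter r.-1 (@Qop k r k^o) x = 0 ->
    exists y : {ffun mon r -> k^o}, x = Qop y.
  by rewrite rE; apply: h2.
have dr' : d%:Z < ((5 * h + 3) * r.-1.+1)%N%:Z - 2 by rewrite rE.
have rec := Xker_rec pp pch p5 (@prz_neg r) (@prz_id r) (@prz_Qop r) (prz_carry r2) Fr
  dr' h1' h2'.
have XK : Xker p r.-1 (@Qop k r k^o) (carry r2) (@prz r) d%:Z =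
    (linfun (split r2) @: (homg (p * r) k^o d :&: lker (linfun (@Qop k (p * r) k^o))))%VS.
  apply/vspaceP => v; apply/(mem_Xker _ _ _ (@prz_id r))/memv_imgP.
    case=> dv DDv; exists (unsplit r2 v); last by rewrite lfunE /= unsplitK.
    rewrite memv_cap memv_ker lfunE mem_homg /=.
    apply/andP; split; apply/eqP; apply: (split_inj (r_gt2 := r2)).
      by rewrite split_hcomp unsplitK.
    by rewrite split_Qop unsplitK linear0.
  case=> u; rewrite memv_cap memv_ker !lfunE mem_homg /= => /andP[/eqP hu /eqP Qu] ->.
  by rewrite -split_hcomp hu -split_Qop Qu linear0.
have kdE : \dim (Xker p r.-1 (@Qop k r k^o) (carry r2) (@prz r) d%:Z) = kd (p * r) d.
  by rewrite XK dim_split_img.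
have XT : (\dim (Xtriv p r.-1 (@Qop k r k^o) (carry r2) (@prz r) d%:Z))%:Z =
    Ydim (p * r) (d%:Z + 2 - 2 * (p * r)%N%:Z).
  case jE : (d%:Z + 2 - 2 * (p * r)%N%:Z) => [t|t].
    have tq : (t < p * r)%N.
      have : (5 * h + 3 <= 3 * p)%N by lia.
      by move: dr; rewrite ph; nia.
    rewrite -(dim_Qpow qe tq) -(dim_split_img r2); congr (Posz (\dim _)).
    apply/vspaceP => v; apply/(mem_Xtriv _ _ _ (@prz_id r))/memv_imgP; rewrite rE jE.
      case=> u hu vE; exists (iter (p * r).-1 (@Qop k _ _) (unsplit r2 u)).
        rewrite -[iter _ _ _](lfunE (iter (p * r).-1 (@Qop k (p * r) k^o))) memv_img //.
        rewrite mem_homg; apply/eqP/(split_inj (r_gt2 := r2)).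
        by rewrite split_hcomp unsplitK hu.
      by rewrite lfunE /= (split_Qpow r2 _ re) unsplitK.
    case=> u /memv_imgP[w]; rewrite mem_homg => /eqP hw; rewrite lfunE /= => -> ->.
    exists (split r2 w); first by rewrite -split_hcomp hw.
    by rewrite lfunE /= (split_Qpow r2 _ re).
  rewrite (_ : Xtriv _ _ _ _ _ _ = 0%VS) ?dimv0 //; apply/eqP; rewrite -subv0.
  apply/subvP => v /(mem_Xtriv _ _ _ (@prz_id r))[u]; rewrite rE jE => <- ->.
  rewrite (_ : tp _ _ _ u = 0) ?linear0 ?mem0v //.
  apply/ffunP => b; rewrite tpE zeroE; apply: prz_neg; rewrite NegzE; lia.
have KE : (\dim (Kn p r.-1 (@Qop k r k^o) (@prz r) d%:Z))%:Z =
    if n is Posz t then (kd r t)%:Z else 0.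
  have nE : d%:Z - (5 * h * r.-1.+1)%N%:Z = n by rewrite rE.
  case: n nE => t nE.
    congr (Posz (\dim _)); apply/vspaceP => v; apply/(mem_Kn _ _ _ (@prz_id r))/idP; rewrite nE.
      by case=> Qv /= hv; rewrite memv_cap memv_ker lfunE mem_homg /= Qv hv !eqxx.
    by rewrite memv_cap memv_ker lfunE mem_homg /= => /andP[/eqP -> /eqP ->].
  rewrite (_ : Kn _ _ _ _ _ = 0%VS) ?dimv0 //; apply/eqP; rewrite -subv0.
  apply/subvP => v /(mem_Kn _ _ _ (@prz_id r)); rewrite nE => -[_ <-].
  exact: mem0v.
have FE : (\dim (Fn p r.-1 (@Qop k r k^o) (@prz r) d%:Z))%:Z = Ydim r (n + 2 - 2 * r%:Z).
  have nE : d%:Z - (5 * h * r.-1.+1)%N%:Z = n by rewrite rE.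
  have przp m j (x : {ffun mon r -> k^o}) :
      prz (m + 2 * j%:Z) (iter j (@Qop k _ _) x) = iter j (@Qop k _ _) (prz m x).
    elim: j => [|j IH]; first by rewrite mulr0 addr0.
    by rewrite /= -IH -prz_Qop; congr (prz _ _); lia.
  have Qr0 (x : {ffun mon r -> k^o}) : Qop (iter r.-1 (@Qop k _ _) x) = 0.
    rewrite -iterS rE; have := @iterQ_Frobenius k p e.+1 r k^o x pp pch; rewrite -re => ->.
    by apply: big1 => i _; rewrite mulX_ge //; lia.
  have r1 : r.-1%:Z = r%:Z - 1 by lia.
  case jE : (n + 2 - 2 * r%:Z) => [t|t].
    have tr : (t < r)%N.
      have : n + 2 < 3 * r%:Z by rewrite /n; lia.
      lia.
    have nT : n = t%:Z + 2 * r.-1%:Z by rewrite -jE r1; ring.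
    rewrite -(dim_Qpow re tr); congr (Posz (\dim _)).
    apply/vspaceP => v; rewrite /Fn memv_cap; apply/andP/memv_imgP.
      case=> /(mem_Kn _ _ _ (@prz_id r)); rewrite nE => -[Qv hv] /memv_imgP[u _].
      rewrite lfunE /= => vE; exists (hcomp t u); first exact: hcomp_homg.
      by rewrite lfunE /= -[v]hv vE nT; apply: (przp t%:Z).
    case=> u; rewrite mem_homg => /eqP hu; rewrite lfunE /= => ->; split.
      apply/(mem_Kn _ _ _ (@prz_id r)); rewrite nE; split; first exact: Qr0.
      by rewrite nT; apply: etrans (przp t%:Z _ _) _; rewrite /= hu.
    by rewrite -[iter _ _ _](lfunE (iter r.-1 (@Qop k r k^o))) memv_img ?memvf.
  rewrite (_ : Fn _ _ _ _ _ = 0%VS) ?dimv0 //; apply/eqP; rewrite -subv0.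
  apply/subvP => v; rewrite /Fn memv_cap => /andP[/(mem_Kn _ _ _ (@prz_id r))].
  rewrite nE => -[Qv hv] /memv_imgP[u _]; rewrite lfunE /= => vE.
  have nT : n = (n + 2 - 2 * r%:Z) + 2 * r.-1%:Z by rewrite r1; ring.
  rewrite memv0 -hv vE nT; apply/eqP; apply: etrans (przp _ _ _) _.
  by rewrite jE /= linear0.
by rewrite -kdE rec XT KE FE.
Qed.

End Levels.

(** * Counting monomials *)

Section Counting.

(** The coefficient of [X ^ x] in [1 / (1 - X) ^ (d+1)]. *)
Definition bz (d : nat) (x : int) : int := if x is Posz t then ('C(t + d, d))%:Z else 0.

Lemma bz_pascal d x : bz d.+1 x - bz d.+1 (x - 1) = bz d x.
Proof.
case: x => [[|t]|t] //.
- by rewrite /= !add0n !binn.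
- rewrite (_ : Posz t.+1 - 1 = Posz t); last by lia.
  by rewrite /= [(t.+1 + d)%N]addSnnS [(t.+1 + _)%N]addSn binS; lia.
Qed.

Let X1 : {poly int} := 1 - 'X.

(** An inverse of [(1 - X) ^ (d+1)] modulo [X ^ N], so that generating functions stay
    polynomials. *)
Lemma series_inv d N : exists R : {poly int},
  X1 ^+ d.+1 * \poly_(j < N) bz d j%:Z = 1 + 'X^N * R.
Proof.
elim: d => [|d [R hR]].
  exists (- 1); rewrite expr1 mulrN1.
  have -> : \poly_(j < N) bz 0 j%:Z = \sum_(j < N) 'X^j.
    apply/polyP => i; rewrite coef_poly coef_sum.
    case: ltnP => iN.
      rewrite (bigD1 (Ordinal iN)) //= coefXn eqxx big1 ?addr0 ?bin0 // => j ji.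
      by rewrite coefXn; case: eqP => // e; case/eqP: ji; apply: val_inj.
    rewrite big1 // => j _; rewrite coefXn; case: eqP => // e.
    by have := ltn_ord j; lia.
  by rewrite -[X1]opprB mulNr -subrX1 opprB.
(* Multiplying the truncated series by [1 - X] leaves its last coefficient, negated, at [X ^ N]; the
   new remainder absorbs it. *)
exists (R - X1 ^+ d.+1 * (bz d.+1 (N%:Z - 1))%:P).
rewrite exprSr -mulrA (_ : X1 * _ = \poly_(j < N) bz d j%:Z - 'X^N * (bz d.+1 (N%:Z - 1))%:P).
  by rewrite mulrBr hR mulrBr addrA; congr (_ - _); rewrite mulrCA.
apply/polyP => i; rewrite mulrBl mul1r !coefB coefXM coefXnM coefC !coef_poly.
case: i => [|i].
  case: N {hR} => [|N] /=; first by rewrite !subr0.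
  by rewrite !add0n !binn !subr0.
rewrite -[i.+1.-1]/i -[(i.+1 == 0)%N]/false /=.
have e1 : bz d.+1 i.+1%:Z - bz d.+1 i%:Z = bz d i.+1%:Z.
  by rewrite -[RHS]bz_pascal (_ : i.+1%:Z - 1 = i%:Z) //; lia.
case: (ltnP i.+1 N) => iN; first by rewrite (ltnW iN) subr0.
case: (ltnP i N) => iN'.
  have -> : N = i.+1 by lia.
  by rewrite subnn eqxx !sub0r (_ : i.+1%:Z - 1 = i%:Z) //; lia.
by rewrite (_ : (i.+1 - N == 0)%N = false) ?subrr //; lia.
Qed.

Lemma cA_gen n t : (cA n t)%:Z = ((\sum_(j < n) 'X^j) ^+ 5 : {poly int})`_t.
Proof.
rewrite -[5%N]card_ord -prodr_const bigA_distr_bigA coef_sum /cA -sum1_card.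
rewrite (big_morph Posz PoszD (erefl _)) big_mkcond /=; apply: eq_bigr => a _.
have -> : \prod_i 'X^(a i) = 'X^(wt a) :> {poly int}.
  by symmetry; apply: (big_morph _ (exprD 'X) (expr0 'X)).
by rewrite coefXn inE eq_sym; case: eqP.
Qed.

(** Expand [((1 - X ^ n) / (1 - X)) ^ 5]. *)
Lemma cA_formula n t : (0 < n)%N -> (cA n t)%:Z =
  \sum_(i < 6) (-1) ^+ i * ('C(5, i))%:Z * bz 4 (t%:Z - i%:Z * n%:Z).
Proof.
move=> n0; rewrite cA_gen; set G := \sum_(j < n) _.
have [R hR] := series_inv 4 t.+1; set T := \poly_(_ < _) _ in hR.
have GX : X1 * G = 1 - 'X^n.
  by rewrite -[X1]opprB mulNr -subrX1 opprB.
have E : G ^+ 5 = (1 - 'X^n) ^+ 5 * T - 'X^(t.+1) * (R * G ^+ 5).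
  by rewrite -GX exprMn mulrAC hR mulrDl mul1r -mulrA addrK.
rewrite E coefB coefXnM ltnSn subr0 exprBn mulr_suml coef_sum.
apply: eq_bigr => i _; rewrite expr1n mulr1 -exprM.
have -> : (-1) ^+ i * 'X^(n * i) *+ 'C(5, i) * T =
    ((-1) ^+ i * ('C(5, i))%:Z) *: ('X^(n * i) * T) :> {poly int}.
  rewrite -mul_polyC -natz rmorphM rmorphXn rmorphN1 rmorph_nat -mulr_natr.
  by rewrite -!mulrA; congr (_ * _); rewrite mulrCA.
rewrite coefZ coefXnM coef_poly; congr (_ * _).
case: ltnP => ti.
  by case e : (t%:Z - i%:Z * n%:Z) => [u|u] //=; lia.
rewrite ltnS leq_subr; congr (bz _ _); lia.
Qed.
End Counting.

(** * Hilbert functions and the multiplicities *)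

Section Dimensions.

(** The Hilbert function [Yf] of the quadric, extended by zero to negative degrees. *)
Definition Yz (x : int) : int := bz 4 x - bz 4 (x - 2).

Lemma bz_neg d x : x < 0 -> bz d x = 0.
Proof. by case: x => [t|t]. Qed.

Lemma Yz_neg x : x < 0 -> Yz x = 0.
Proof. by move=> x0; rewrite /Yz !bz_neg //; lia. Qed.

Lemma Yz_nat t : Yz t%:Z = (Yf t)%:Z.
Proof.
have le_bin : ('C(t + 2, 4) <= 'C(t + 4, 4))%N by apply: leq_bin2l; lia.
rewrite /Yz /Yf -subzn //; move: le_bin => _.
case: t => [|[|t]] //.
by rewrite (_ : t.+2%:Z - 2 = t%:Z); [rewrite /= !addSn addn2 addn4 | lia].
Qed.

Lemma bz4E x : -5 < x -> 24 * bz 4 x = (x + 1) * (x + 2) * (x + 3) * (x + 4).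
Proof.
case: x => [t|[|[|[|[|t]]]]] // _.
rewrite /= -[24]/(4`!%:Z) mulrC -PoszM bin_ffact.
by rewrite addn4 !ffactSS ffactn0 !PoszM !intS; ring.
Qed.

(** The bound allows [-1] and [-2], where both sides vanish. *)
Lemma Yz_poly x : -3 < x -> 6 * Yz x = (x + 1) * (x + 2) * (2 * x + 3).
Proof.
move=> x2; have h1 := @bz4E x; have h2 := @bz4E (x - 2).
have {}h1 := h1 ltac:(lia); have {}h2 := h2 ltac:(lia).
rewrite /Yz; apply: (mulfI (_ : 4 != 0)) => //.
have -> : 4 * (6 * (bz 4 x - bz 4 (x - 2))) = 24 * bz 4 x - 24 * bz 4 (x - 2) by ring.
rewrite h1 h2; ring.
Qed.

Lemma cAz_formula n x : (0 < n)%N -> cAz n x =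
  \sum_(i < 6) (-1) ^+ i * ('C(5, i))%:Z * bz 4 (x - i%:Z * n%:Z).
Proof.
move=> n0; case: x => [t|t]; first exact: cA_formula.
by rewrite big1 // => i _; rewrite bz_neg ?mulr0 //; lia.
Qed.

Lemma cAz_unfold n x : (0 < n)%N -> cAz n x = bz 4 x - 5 * bz 4 (x - n%:Z)
  + 10 * bz 4 (x - 2 * n%:Z) - 10 * bz 4 (x - 3 * n%:Z) + 5 * bz 4 (x - 4 * n%:Z)
  - bz 4 (x - 5 * n%:Z).
Proof.
move=> n0; rewrite cAz_formula // !big_ord_recr big_ord0 /=.
rewrite -[Posz 'C(5, 1)]/(5 : int) -[Posz 'C(5, 2)]/(10 : int).
rewrite -[Posz 'C(5, 5)]/(1 : int) ?[Posz 1]/(1 : int) -[Posz 2]/(2 : int) -[Posz 3]/(3 : int) -[Posz 4]/(4 : int).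
by rewrite ?[Posz 5]/(5 : int) mul0r subr0 !mul1r; ring.
Qed.

Lemma cA_diff n x : (0 < n)%N -> cAz n x - cAz n (x - 2) =
  Yz x - 5 * Yz (x - n%:Z) + 10 * Yz (x - 2 * n%:Z) - 10 * Yz (x - 3 * n%:Z)
  + 5 * Yz (x - 4 * n%:Z) - Yz (x - 5 * n%:Z).
Proof.
by move=> n0; rewrite !cAz_unfold // /Yz ![x - 2 - _]addrAC; ring.
Qed.

Lemma cAz_small n x : x < n%:Z -> cAz n x = bz 4 x.
Proof.
case: x => [t|t] // tn; rewrite cAz_unfold; last by lia.
by rewrite [bz 4 (_ - n%:Z)]bz_neg ?[bz 4 (_ - _ * _)]bz_neg; [ring | lia..].
Qed.

Lemma Ydim_small n x : x < n%:Z -> Ydim n x = Yz x.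
Proof.
move=> xn; case: x xn => [t|t] tn; last by rewrite Yz_neg.
by rewrite /Yz /Ydim -(@cAz_small n t%:Z) // -(@cAz_small n (t%:Z - 2)) //; lia.
Qed.

Section Midpoint.
Variables p h : nat.
Hypotheses (ph : p = h.*2.+1) (h2 : (1 < h)%N).

Lemma cA_mid t : (t <= 5 * h)%N -> cA p t = bz 4 t%:Z - 5 * bz 4 (t%:Z - p%:Z)
  + 10 * bz 4 (t%:Z - 2 * p%:Z) :> int.
Proof.
move=> th; rewrite -[LHS]/(cAz p t%:Z) cAz_unfold; last by lia.
rewrite [bz 4 (_ - 3 * _)]bz_neg; last by lia.
rewrite [bz 4 (_ - 4 * _)]bz_neg; last by lia.
by rewrite [bz 4 (_ - 5 * _)]bz_neg; [ring | lia].
Qed.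

Lemma cA_bz t : (t < p)%N -> cA p t = bz 4 t%:Z :> int.
Proof. by move=> tp; apply: (@cAz_small p t%:Z). Qed.

(** Up to degree [5h] only three terms of [cA] survive, with coefficients [1, -5, 10]; the eleventh
    [Yz (h - 2)] and the last term come from the trivial parts in [nu]. *)
Lemma nu2 : nu p 2 = Yz (2 * p + h - 2)%N - 5 * Yz (p + h - 2)%N
  + 11 * Yz (h - 2)%N - Yz h.
Proof.
have p2 : (p./2 = h)%N by lia.
rewrite /nu p2 (_ : (h - (2 - 2))%N = h); last by lia.
rewrite (cA_mid (t := (5 * h)%N)) ?(cA_mid (t := (5 * h - 2)%N)); try lia.
rewrite !(cA_bz (t := (h - 2)%N)) ?(cA_bz (t := h)) ?cAz_small /Yz; try lia.
pose z := h%:Z.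
rewrite (_ : Posz (5 * h)%N = 5 * z) 1?(_ : Posz (5 * h - 2)%N = 5 * z - 2); try (rewrite /z; lia).
rewrite (_ : Posz (2 * p + h - 2)%N = 5 * z) 1?(_ : Posz (p + h - 2)%N = 3 * z - 1);
  try (rewrite /z; lia).
rewrite (_ : Posz (h - 2)%N = z - 2) 1?(_ : Posz p = 2 * z + 1); try (rewrite /z; lia).
rewrite (_ : 5 * z - (2 * z + 1) = 3 * z - 1); last ring.
rewrite (_ : 5 * z - 2 * (2 * z + 1) = z - 2); last ring.
rewrite (_ : 5 * z - 2 - (2 * z + 1) = 3 * z - 1 - 2); last ring.
rewrite (_ : 5 * z - 2 - 2 * (2 * z + 1) = z - 2 - 2); last ring.
rewrite -/z; ring.
Qed.

(** As for [nu2], but with first differences, which Pascal's rule turns into [bz 3]. *)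
Lemma nu1 : nu p 1 = bz 3 (2 * p + h - 2)%N - 5 * bz 3 (p + h - 2)%N
  + 11 * bz 3 (h - 2)%N - bz 3 (h - 1)%N.
Proof.
have p2 : (p./2 = h)%N by lia.
rewrite /nu p2 (_ : (h - (2 - 1))%N = (h - 1)%N); last by lia.
rewrite (cA_mid (t := (5 * h)%N)) ?(cA_mid (t := (5 * h - 1)%N)); try lia.
rewrite !(cA_bz (t := (h - 2)%N)) ?(cA_bz (t := (h - 1)%N)) ?cAz_small; try lia.
rewrite -!(bz_pascal 3).
pose z := h%:Z.
rewrite (_ : Posz (5 * h)%N = 5 * z) 1?(_ : Posz (5 * h - 1)%N = 5 * z - 1); try (rewrite /z; lia).
rewrite (_ : Posz (2 * p + h - 2)%N = 5 * z) 1?(_ : Posz (p + h - 2)%N = 3 * z - 1);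
  try (rewrite /z; lia).
rewrite (_ : Posz (h - 2)%N = z - 2) 1?(_ : Posz p = 2 * z + 1); try (rewrite /z; lia).
rewrite (_ : Posz (h - 1)%N = z - 1); try (rewrite /z; lia).
rewrite (_ : 5 * z - (2 * z + 1) = 3 * z - 1); last ring.
rewrite (_ : 5 * z - 2 * (2 * z + 1) = z - 2); last ring.
rewrite (_ : 5 * z - 1 - (2 * z + 1) = 3 * z - 1 - 1); last ring.
rewrite (_ : 5 * z - 1 - 2 * (2 * z + 1) = z - 2 - 1); last ring.
rewrite -/z (_ : z - 1 - 1 = z - 2) 1?(_ : z - 1 - 2 = z - 2 - 1); try ring.
Qed.

End Midpoint.

Lemma nu2_mu (R : numFieldType) p : prime p -> (5 <= p)%N -> (nu p 2)%:~R = 4 * mu R p.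
Proof.
move=> pp p5; have := p_half pp p5; rewrite mul2n; move: (p./2) => h ph.
rewrite (nu2 ph); last by lia.
rewrite /mu /P0 [RHS]mulrC mulfVK ?pnatr_eq0 // !Yz_nat.
rewrite (_ : (p - 1) %/ 2 = h)%N; last by lia.
rewrite (_ : (h - 2 + 2 * p = 2 * p + h - 2)%N); last by lia.
rewrite (_ : (h - 2 + p = p + h - 2)%N); last by lia.
rewrite (_ : (p - (h - 2) - 3 = h)%N); last by lia.
by rewrite !(rmorphB, rmorphD, rmorphM) /= !pmulrn.
Qed.

Lemma h0S_bz m : (0 < m)%N -> (h0S m)%:Z = 4 * bz 3 (m - 1)%N.
Proof.
by case: m => [|m] // _; rewrite /h0S subn1 /= [(m.+1 + 3)%N]addnS binS addSnnS addKn PoszM.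
Qed.

(** Here [h0S] carries a factor 4, which the division by 4 in [mubar] removes; [Yf] in [mu] has
    none, hence [4 * mu] in [nu2_mu]. *)
Lemma nu1_mubar (R : numFieldType) p : prime p -> (5 <= p)%N -> (nu p 1)%:~R = mubar R p.
Proof.
move=> pp p5; have := p_half pp p5; rewrite mul2n; move: (p./2) => h ph.
apply: (mulfI (_ : 4 != 0)); first by rewrite pnatr_eq0.
rewrite (nu1 ph); last by lia.
rewrite /mubar /P0 [RHS]mulrC mulfVK ?pnatr_eq0 //.
rewrite (_ : (p - 1) %/ 2 = h)%N; last by lia.
rewrite !(pmulrn _ (h0S _)) !h0S_bz; try lia.
rewrite (_ : (h - 1 + 2 * p - 1 = 2 * p + h - 2)%N); last by lia.
rewrite (_ : (h - 1 + p - 1 = p + h - 2)%N); last by lia.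
rewrite (_ : (h - 1 - 1 = h - 2)%N); last by lia.
rewrite (_ : (p - (h - 1) - 2 - 1 = h - 1)%N); last by lia.
by rewrite !(rmorphB, rmorphD, rmorphM) /=; ring.
Qed.

End Dimensions.

(** * Polynomials modulo the ideal *)

Section Reduction.
Variables (k : fieldType) (q : nat).
Local Notation A := {ffun mon q -> k^o}.
Local Notation MP := {mpoly k[5]}.

Lemma coef_mulX_mnm (f : MP) (b m : 'X_{1..5}) :
  (f * 'X_[b])@_m = if (b <= m)%MM then f@_(m - b) else 0.
Proof.
case: ifP => bm; first by rewrite -{1}(submK bm) [(_ + b)%MM]addmC mcoeffMX.
rewrite [f]mpolyE mulr_suml raddf_sum big1 // => c _ /=.
rewrite -scalerAl -mpolyXD mcoeffZ mcoeffX.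
case: eqP => [e|_]; last by rewrite mulr0.
by move: bm; rewrite -e lem_addl.
Qed.

Definition mnm_of (a : mon q) : 'X_{1..5} := [multinom nat_of_ord (a i) | i < 5].

Lemma mdeg_mnm_of a : mdeg (mnm_of a) = wt a.
Proof. by rewrite mdegE /wt; apply: eq_bigr => i _; rewrite mnmE. Qed.

Definition mred (f : MP) : A := [ffun a => f@_(mnm_of a)].

Fact mred_is_linear : linear mred.
Proof. by move=> c f g; apply/ffunP => a; rewrite !ffunE mcoeffD mcoeffZ. Qed.
HB.instance Definition _ := GRing.isLinear.Build k MP A _ mred mred_is_linear.

Lemma mred_mulXn f i r : mred (f * 'X_i ^+ r) = mulX i r (mred f).
Proof.
apply/ffunP => a; rewrite mulXE !ffunE mpolyXn coef_mulX_mnm.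
have -> : (U_(i) *+ r <= mnm_of a)%MM = (r <= a i)%N.
  apply/mnm_lepP/idP => [/(_ i)|h j]; rewrite mulmnE mnm1E mnmE ?eqxx ?mul1n //.
  by case: eqP => [<-|_]; rewrite ?mul1n.
case: ifP => // h; congr (_@_ _); apply/mnmP => j.
by rewrite mnmBE mulmnE mnm1E !mnmE msubE eq_sym; case: eqP => _; rewrite ?mul1n.
Qed.

Lemma mred_quadric f : mred (f * quadric k) = Qop (mred f).
Proof. by rewrite /quadric mulr_sumr linear_sum; apply: eq_bigr => i _; rewrite /= mred_mulXn. Qed.

Definition msec (v : A) : MP := \sum_a v a *: 'X_[mnm_of a].

Lemma msecK v : mred (msec v) = v.
Proof.
apply/ffunP => a; rewrite ffunE raddf_sum (bigD1 a) //= mcoeffZ mcoeffX eqxx mulr1.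
rewrite big1 ?addr0 // => b ba; rewrite mcoeffZ mcoeffX.
case: eqP => [e|]; last by rewrite mulr0.
case/eqP: ba; apply: mon_eqP => i.
by have := congr1 (fun m : 'X_{1..5} => m i) e; rewrite !mnmE.
Qed.

Lemma in_ideal_sum (I : Type) (s : seq I) (F : I -> MP) :
  (forall i, in_ideal q (F i)) -> in_ideal q (\sum_(i <- s) F i).
Proof.
move=> h; elim/big_ind: _ => //.
  by exists (fun _ => 0); rewrite big1 // => j _; rewrite mul0r.
move=> _ _ [c ->] [d ->]; exists (fun j => c j + d j).
by rewrite -big_split; apply: eq_bigr => j _; rewrite mulrDl.
Qed.

Lemma in_ideal_gens f j : in_ideal q (f * gens k q j).
Proof.
exists (fun i => if i == j then f else 0); rewrite (bigD1 j) //= eqxx.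
by rewrite big1 ?addr0 // => i /negbTE ->; rewrite mul0r.
Qed.

Lemma gens0 : gens k q ord0 = quadric k.
Proof. by rewrite /gens unlift_none. Qed.

Lemma gens_lift i : gens k q (lift ord0 i) = 'X_i ^+ q.
Proof. by rewrite /gens liftK. Qed.

Lemma in_ideal_mred0 f : mred f = 0 -> in_ideal q f.
Proof.
move=> f0; rewrite [f]mpolyE; apply: in_ideal_sum => m.
have [/existsP[i qi]|/existsPn h] := boolP [exists i, (q <= m i)%N].
  have le_m : (U_(i) *+ q <= m)%MM.
    apply/mnm_lepP => j; rewrite mulmnE mnm1E.
    by case: eqP => [<-|_]; rewrite ?mul1n.
  rewrite -(submK le_m) mpolyXD -mpolyXn scalerAl -gens_lift.
  exact: in_ideal_gens.
have hm i : (m i < q)%N by rewrite ltnNge h.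
have /ffunP/(_ [ffun i => Ordinal (hm i)]) := f0; rewrite zeroE ffunE.
have -> : mnm_of [ffun i => Ordinal (hm i)] = m.
  by apply/mnmP => i; rewrite mnmE ffunE.
by move=> ->; rewrite scale0r -(mul0r (gens k q ord0)); apply: in_ideal_gens.
Qed.

(** The kernel of [mred] is spanned by the monomials divisible by some [x_i ^ q], so modulo it only
    the quadric remains. *)
Lemma in_idealP f : in_ideal q f <-> exists u, mred f = Qop u.
Proof.
split=> [[c ->]|[u fu]].
  exists (mred (c ord0)); rewrite linear_sum big_ord_recl /= gens0 mred_quadric.
  rewrite big1 ?addr0 // => i _.
  by rewrite gens_lift mred_mulXn mulX_ge.
have [c fc] : in_ideal q (f - msec u * quadric k).
  by apply: in_ideal_mred0; rewrite linearB /= mred_quadric msecK fu subrr.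
have [d hd] := in_ideal_gens (msec u) ord0; rewrite gens0 in hd.
exists (fun j => c j + d j); rewrite -[f](subrK (msec u * quadric k)) fc hd.
by rewrite -big_split; apply: eq_bigr => j _; rewrite mulrDl.
Qed.

Lemma mred_homog f d : f \is d.-homog -> mred f \in homg q k^o d.
Proof.
move=> hf; rewrite mem_homg; apply/eqP/ffunP => a; rewrite hcompE ffunE.
case: eqP => // /eqP; rewrite -mdeg_mnm_of => ne.
by rewrite (dhomog_nemf_coeff hf).
Qed.

Lemma msec_homog v d : v \in homg q k^o d -> msec v \is d.-homog.
Proof.
rewrite mem_homg => /eqP <-; apply: rpred_sum => a _; rewrite hcompE.
case: eqP => [<-|_]; last by rewrite scale0r rpred0.
by apply: rpredZ; rewrite dhomogX; apply/eqP/mdeg_mnm_of.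
Qed.

(** The match keeps a truncated [d - 2] from standing for degree [0] when [d < 2]. *)
Definition Qimg d : {vspace A} :=
  if d is d'.+2 then (linfun (@Qop k q k^o) @: homg q k^o d')%VS else 0%VS.

Lemma Qimg_homg d : (Qimg d <= homg q k^o d)%VS.
Proof.
case: d => [|[|d]]; rewrite ?sub0v //=.
apply/subvP => _ /memv_imgP[u hu ->]; rewrite lfunE /= mem_homg hcomp_QS.
by move: hu; rewrite mem_homg => /eqP ->.
Qed.

Lemma mem_Qimg d u : Qop u \in homg q k^o d -> Qop u \in Qimg d.
Proof.
case: d => [|[|d]]; rewrite mem_homg => /eqP <-; [| |].
- by rewrite hcomp_Qop0 ?mem0v.
- by rewrite hcomp_Qop0 ?mem0v.
by rewrite hcomp_QS /= -(lfunE (@Qop k q k^o)) memv_img ?hcomp_homg.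
Qed.

Lemma QimgP d v : v \in Qimg d -> exists u, v = Qop u.
Proof.
case: d => [|[|d]] /=.
- by rewrite memv0 => /eqP ->; exists 0; rewrite linear0.
- by rewrite memv0 => /eqP ->; exists 0; rewrite linear0.
by case/memv_imgP => u _ ->; exists u; rewrite lfunE.
Qed.

Lemma indep_modP d n : indep_mod k q d n -> (n + \dim (Qimg d) <= \dim (homg q k^o d))%N.
Proof.
case=> f [hf ind]; pose v := [tuple mred (f i) | i < n].
have vE i : v`_(nat_of_ord i) = mred (f i).
  by rewrite -tnth_nth tnth_mktuple.
have vcomb (c : 'I_n -> k) : \sum_(i < n) c i *: v`_i = mred (\sum_(i < n) c i *: f i).
  by rewrite linear_sum; apply: eq_bigr => i _; rewrite vE linearZ.
have frv : free v.
  apply/freeP => c c0; apply: ind; apply/in_idealP.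
  by exists 0; rewrite -vcomb c0 linear0.
have sv : (<<v>> <= homg q k^o d)%VS.
  apply/span_subvP => _ /tnthP[i ->]; rewrite tnth_mktuple.
  exact: mred_homog.
have cap0 : (<<v>> :&: Qimg d = 0)%VS.
  apply/eqP; rewrite -subv0; apply/subvP => w; rewrite memv_cap => /andP[wv /QimgP[u wu]].
  rewrite (coord_span wv) memv0 big1 // => i _.
  rewrite (ind (fun i => coord v i w)) ?scale0r //; apply/in_idealP; exists u.
  by rewrite -vcomb -coord_span.
have := dimvS (_ : (<<v>> + Qimg d <= homg q k^o d)%VS).
rewrite subv_add sv Qimg_homg => /(_ isT); rewrite dimv_disjoint_sum //.
by move: frv; rewrite /free => /eqP ->; rewrite size_tuple.
Qed.

Lemma indep_mod_max d : indep_mod k q d (\dim (homg q k^o d :\: Qimg d)).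
Proof.
set D := (homg q k^o d :\: Qimg d)%VS.
pose b := vbasis D; exists (fun i => msec b`_i); split=> [i|c].
  apply: msec_homog; apply: (subvP (diffvSl _ (Qimg d))).
  by apply: vbasis_mem; rewrite mem_nth // size_tuple.
case/in_idealP => u; rewrite linear_sum => e.
have {}e : \sum_(i < \dim D) c i *: b`_i = Qop u.
  by rewrite -e; apply: eq_bigr => i _; rewrite linearZ /= msecK.
have hD : \sum_(i < \dim D) c i *: b`_i \in D.
  apply: rpred_sum => i _; rewrite rpredZ //.
  by apply: vbasis_mem; rewrite mem_nth // size_tuple.
have h0 : \sum_(i < \dim D) c i *: b`_i = 0.
  apply/eqP; rewrite -memv0 -(capv_diff (homg q k^o d) (Qimg d)) memv_cap hD /=.
  rewrite e; apply: mem_Qimg; rewrite -e.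
  exact: (subvP (diffvSl _ (Qimg d))).
by have /freeP/(_ c h0) := basis_free (vbasisP D).
Qed.

(** A complement of the image of [Q] attains the maximum, so the specification given to [epsilon]
    can be met. *)
Lemma graded_dimE d : (graded_dim k q d + \dim (Qimg d) = cA q d)%N.
Proof.
have dH : \dim (homg q k^o d) = cA q d by rewrite dim_homg dim_regular muln1.
have dD := dimv_cap_compl (homg q k^o d) (Qimg d).
have cQ : (homg q k^o d :&: Qimg d)%VS = Qimg d by apply/capv_idPr; apply: Qimg_homg.
have mx : is_graded_dim k q d (\dim (homg q k^o d :\: Qimg d)).
  split=> [|m /indep_modP]; first exact: indep_mod_max.
  move: dD; rewrite cQ => <-; rewrite addnC.
  by rewrite leq_add2l.
have [i1 m1] : is_graded_dim k q d (graded_dim k q d).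
  by apply: epsilon_spec; exists (\dim (homg q k^o d :\: Qimg d)).
have := m1 _ mx.1; have := mx.2 _ i1.
move: dD; rewrite cQ -dH => <- l1 l2.
by rewrite addnC; congr (_ + _)%N; apply/eqP; rewrite eqn_leq l1.
Qed.

End Reduction.

(** * Two descriptions of the graded dimension *)

Section Duality.
Variables (k : fieldType) (q : nat).
Local Notation A := {ffun mon q -> k^o}.

Definition kdz (x : int) : int := if x is Posz t then (kd k q t)%:Z else 0.

Lemma wt_le (a : mon q) : (wt a <= 5 * q.-1)%N.
Proof. by rewrite -(wt_mrev a) leq_addl. Qed.

Lemma hcomp_gt t (v : A) : (5 * q.-1 < t)%N -> hcomp t v = 0.
Proof.
move=> ht; apply/ffunP => a; rewrite hcompE zeroE.
by case: eqP => // e; have := wt_le a; lia.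
Qed.

Lemma cA_gt t : (5 * q.-1 < t)%N -> cA q t = 0%N.
Proof.
move=> ht; apply: eq_card0 => a; rewrite inE.
by apply: contraTF ht => /eqP <-; rewrite -leqNgt wt_le.
Qed.

Lemma cA_sym s t : (s + t = 5 * q.-1)%N -> cA q s = cA q t.
Proof.
move=> st; rewrite /cA -(card_imset _ (inv_inj (@mrevK q))); apply: eq_card => a.
rewrite -[a in LHS]mrevK mem_imset; last exact: inv_inj (@mrevK q).
by rewrite !inE; have e := wt_mrev a; apply/eqP/eqP; lia.
Qed.

Lemma kd_rank t : (kd k q t + \dim (linfun (@Qop k q k^o) @: homg q k^o t))%N = cA q t.
Proof. by rewrite /kd limg_ker_dim dim_homg dim_regular muln1. Qed.

(** The cokernel of [Q] into degree [d]; used below the middle, where the kernel is known. *)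
Lemma graded_kdz d : (graded_dim k q d)%:Z = cAz q d%:Z - cAz q (d%:Z - 2) + kdz (d%:Z - 2).
Proof.
have := graded_dimE k q d; case: d => [|[|d]].
- by rewrite /= dimv0 addn0 => ->; rewrite !subr0.
- by rewrite /= dimv0 addn0 => ->; rewrite !subr0.
rewrite (_ : d.+2%:Z - 2 = d%:Z) /=; last by lia.
by have := kd_rank d; move: (\dim _) => x; lia.
Qed.

Lemma graded_top d : (5 * q.-1 < d)%N -> graded_dim k q d = 0%N.
Proof. by move=> /cA_gt h; have := graded_dimE k q d; rewrite h; lia. Qed.

(** The rank of [Q] into degree [d] equals its rank out of the dual degree [s]; used above the first
    range, where the kernel obeys the recursion. *)
Lemma graded_dual s d : (s + d = 5 * q.-1)%N -> graded_dim k q d = kd k q s.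
Proof.
move=> sd; have e := graded_dimE k q d; have e' := kd_rank s; have c := cA_sym sd.
have rk : \dim (Qimg k q d) = \dim (linfun (@Qop k q k^o) @: homg q k^o s).
  have [d2|d2] := ltnP d 2.
    have -> : Qimg k q d = 0%VS by case: d d2 {sd e c} => [|[|d]].
    apply/esym/eqP; rewrite dimv0 dimv_eq0 -subv0; apply/subvP => _ /memv_imgP[u hu ->].
    move: hu; rewrite mem_homg lfunE /= memv0 => /eqP <-.
    by rewrite -hcomp_QS hcomp_gt //; lia.
  case: d d2 sd {e c} => [|[|d]] // _ sd.
  apply: (rank_dual (a := 2)) => [u v|t v|t v|]; rewrite ?fdot_Qop ?hcomp_Qop //.
  by rewrite -addnA addn2.
by move: e e'; rewrite rk c; move: (\dim _) => x; lia.
Qed.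

(* The part of the kernel in degree [x] that is not forced by [Q ^ (q - 1)]. *)
Definition Nz (x : int) : int := kdz x - Yz (x + 2 - 2 * q%:Z).

Lemma Nz_neg x : (0 < q)%N -> x < 0 -> Nz x = 0.
Proof.
move=> q0 x0; rewrite /Nz Yz_neg; last by lia.
by rewrite subr0; case: x x0.
Qed.

End Duality.

Section Recursion.
Variables (k : fieldType) (p : nat).
Hypotheses (pp : prime p) (pch : p \in [pchar k]) (p5 : (5 <= p)%N).
Local Notation h := (p./2).
Local Notation Nz := (Nz k).

(** In this range [Ydim] agrees with [Yz], and removing the trivial part on both sides leaves a
    linear recursion. *)
Lemma Nz_rec e r x : r = (p ^ e.+1)%N -> x < ((5 * h + 3) * r)%N%:Z - 2 ->
  let n := x - (5 * h * r)%N%:Z in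
  Nz (p * r) x = nu p 2 * Yz (n + 2 - 2 * r%:Z) + nu p 1 * Nz r n.
Proof.
move=> re; have p0 := prime_gt0 pp; have r0 : (0 < r)%N by rewrite re expn_gt0 p0.
(* [level_rec] speaks of natural degrees; for negative [x] all terms vanish. *)
have [x0|] := ltrP x 0.
  move=> _ n; by rewrite !Nz_neg ?Yz_neg ?mulr0 ?addr0 ?muln_gt0 ?p0 // /n; lia.
case: x => [d|t] // _ hx n.
have ph := p_half pp p5.
rewrite /Nz /= (level_rec pp pch p5 re hx) -/n !Ydim_small; first by ring.
  rewrite /n; nia.
rewrite PoszM; nia.
Qed.

Lemma Nz_low e r x : r = (p ^ e.+1)%N -> x < 2 * r%:Z - 2 -> Nz r x = 0.
Proof.
move=> re hx; have [inj _] := Q_levels pp pch p5 re.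
rewrite /Nz Yz_neg ?subr0; last by lia.
case: x hx => // t hx; rewrite /kdz /kd; apply/eqP; rewrite eqz_nat dimv_eq0 -subv0.
apply/subvP => v; rewrite memv_cap memv_ker lfunE /= mem_homg memv0 => /andP[/eqP hv /eqP Qv].
by apply/eqP; apply: (inj t%:Z).
Qed.

(** The bound puts [n] below [2 r - 2], where both terms of the recursion vanish. *)
Lemma Nz0 e r x : r = (p ^ e.+1)%N -> x < ((5 * h + 2) * r)%N%:Z - 2 -> Nz (p * r) x = 0.
Proof.
move=> re hx; rewrite (Nz_rec re); last by nia.
rewrite Yz_neg; last by nia.
by rewrite (Nz_low re) ?mulr0 ?addr0 //; nia.
Qed.

End Recursion.

Lemma expn_pred p s i : (i < s)%N -> (p ^ (s - i) = p * p ^ (s - i.+1))%N.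
Proof. by move=> si; rewrite -expnS; congr (_ ^ _)%N; lia. Qed.

(** * Iterating the recursion *)

Section Shift.
Variables (p : nat).
Hypotheses (pp : prime p) (p5 : (5 <= p)%N).
Local Notation h := (p./2).

(** The degree after [i] steps, each of which passes from level [p r] to [r] by subtracting
    [5h r]. *)
Definition shift s (x : int) i : int := x - (\sum_(t < i) 5 * h * p ^ (s - t.+1))%N%:Z.

(** [2h = p - 1] makes the sum telescope; doubling avoids a division. *)
Lemma shiftE s x i : (i <= s)%N ->
  2 * shift s x i = 2 * x - 5 * ((p ^ s)%N%:Z - (p ^ (s - i))%N%:Z).
Proof.
have ph := p_half pp p5; elim: i => [|i IH] si.
  by rewrite /shift big_ord0 !subn0 subr0 subrr mulr0 subr0.
move: IH; rewrite /shift big_ord_recr /= => /(_ (ltnW si)) IH.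
have e := expn_pred p si; move: IH e;
  move: (\sum_(_ < i) _)%N (p ^ _)%N (p ^ _)%N (p ^ _)%N => S a b c.
nia.
Qed.

Section Degree.
Variables (s : nat) (D : nat).
Local Notation q := (p ^ s)%N.
Local Notation qi i := (p ^ (s - i))%N.

(** Both start from the kernel degree dual to [D]. After [i] steps, [tdeg] is the argument of [Yz]
    in the trivial part, and [bdeg] the degree of the quotient at level [p ^ (s - i)] dual to the
    kernel degree reached. *)
Definition tdeg i : int := shift s (5 * q%:Z - 5 - D%:Z) i + 2 - 2 * (qi i)%:Z.
Definition bdeg i : int := 5 * (qi i)%:Z - 5 - shift s (5 * q%:Z - 5 - D%:Z) i.

Lemma tdegE i : (i <= s)%N -> 2 * tdeg i = 5 * q%:Z + (qi i)%:Z - 6 - 2 * D%:Z.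
Proof. by move=> si; have := shiftE (5 * q%:Z - 5 - D%:Z) si; rewrite /tdeg; lia. Qed.

Lemma bdegE i : (i <= s)%N -> 2 * bdeg i = 2 * D%:Z - 5 * q%:Z + 5 * (qi i)%:Z.
Proof. by move=> si; have := shiftE (5 * q%:Z - 5 - D%:Z) si; rewrite /bdeg; lia. Qed.

Lemma expn_sub_gt0 i : (0 < qi i)%N.
Proof. by rewrite expn_gt0 prime_gt0. Qed.

Lemma expn_sub_le i : (qi i <= q)%N.
Proof. by rewrite leq_pexp2l ?prime_gt0 ?leq_subr. Qed.

End Degree.
End Shift.

Section ClosedForms.
Variables (k : fieldType) (p : nat).
Hypotheses (pp : prime p) (pch : p \in [pchar k]) (p5 : (5 <= p)%N).
Local Notation h := (p./2).
Local Notation Nz := (Nz k).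
Local Notation shift := (shift p).
Local Notation shiftE := (shiftE pp p5).

(** A bound at the last step is enough: going back one step adds [5h] times the level, and
    [5h + 3 <= 3p]. *)
Lemma Nz_iter s x i : (i < s)%N -> (0 < i)%N ==> (shift s x i < 3 * (p ^ (s - i))%N%:Z - 2) ->
  Nz (p ^ s) x =
    \sum_(t < i) nu p 2 * nu p 1 ^+ t * Yz (shift s x t.+1 + 2 - 2 * (p ^ (s - t.+1))%N%:Z)
    + nu p 1 ^+ i * Nz (p ^ (s - i)) (shift s x i).
Proof.
have ph := p_half pp p5; elim: i => [|i IH] si hi.
  by rewrite big_ord0 add0r mul1r subn0 /shift big_ord0 subr0.
have e := expn_pred p (ltnW si).
have e1 : (p ^ (s - i.+1) = p ^ (s - i.+2).+1)%N by congr (_ ^ _)%N; lia.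
have sh : shift s x i.+1 = shift s x i - (5 * h * p ^ (s - i.+1))%N%:Z.
  by rewrite /shift big_ord_recr /= PoszD opprD addrA.
rewrite IH ?(ltnW si) //; last first.
  apply/implyP => _; move: hi; rewrite sh e /=.
  move: (shift s x i) (p ^ _)%N => y b; rewrite !PoszM; nia.
rewrite big_ord_recr /= -addrA; congr (_ + _).
rewrite e (Nz_rec pp pch p5 e1) /= -?sh; first by rewrite exprS; ring.
move: hi; rewrite sh /=; move: (shift s x i) (p ^ _)%N => y b; rewrite !PoszM !PoszD; lia.
Qed.

(** The coefficient [11] is [10] from [cA_diff] plus [1] from the kernel, which in this range is its
    trivial part [Yz (D - 2 q)]. *)
Definition base (q : nat) (D : int) : int := Yz D - 5 * Yz (D - q%:Z) + 11 * Yz (D - 2 * q%:Z).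

Lemma kdz_Yz s x : (1 < s)%N -> 2 * x + 4 < 5 * (p ^ s)%N%:Z - (p ^ (s - 1))%N%:Z ->
  kdz k (p ^ s) x = Yz (x + 2 - 2 * (p ^ s)%N%:Z).
Proof.
move=> s2 hx; have ph := p_half pp p5.
have e : (p ^ s = p * p ^ (s - 1))%N by rewrite -{1}[s]subn0 (expn_pred p (ltnW s2)).
have e1 : (p ^ (s - 1) = p ^ (s - 2).+1)%N by congr (_ ^ _)%N; lia.
apply/eqP; rewrite -subr_eq0; apply/eqP; rewrite -/(Nz (p ^ s) x) e.
by apply: (Nz0 pp pch p5 e1); move: hx; rewrite e; move: (p ^ _)%N => b; nia.
Qed.

Lemma graded_base s D : (1 < s)%N -> 2 * D%:Z + (p ^ (s - 1))%N%:Z < 5 * (p ^ s)%N%:Z ->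
  (graded_dim k (p ^ s) D)%:Z = base (p ^ s) D%:Z.
Proof.
move=> s2 hD; have q0 : (0 < p ^ s)%N by rewrite expn_gt0 prime_gt0.
rewrite graded_kdz cA_diff // kdz_Yz //; last by lia.
rewrite subrK /base.
rewrite [Yz (_ - 3 * _)]Yz_neg; last by lia.
rewrite [Yz (_ - 4 * _)]Yz_neg; last by lia.
rewrite [Yz (_ - 5 * _)]Yz_neg; last by lia.
by ring.
Qed.

Lemma kdz_graded s D : (0 <= D)%R -> D <= 5 * (p ^ s)%N%:Z - 5 ->
  kdz k (p ^ s) (5 * (p ^ s)%N%:Z - 5 - D) = (graded_dim k (p ^ s) `|D|%N)%:Z.
Proof.
have q0 : (0 < p ^ s)%N by rewrite expn_gt0 prime_gt0.
case: D => // D _ hD; rewrite (@graded_dual k (p ^ s) (5 * (p ^ s) - 5 - D)%N); last by lia.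
by rewrite (_ : _ - D%:Z = (5 * (p ^ s) - 5 - D)%N%:Z) //; lia.
Qed.

Section Degree.
Variables (s : nat) (D : nat).
Local Notation q := (p ^ s)%N.
Local Notation qi i := (p ^ (s - i))%N.
Local Notation tdeg := (tdeg p s D).
Local Notation bdeg := (bdeg p s D).

(** After [i] steps the remaining [Nz] falls in the range of [Nz0]. *)
Lemma graded_high i : (i.+1 < s)%N -> 5 * q%:Z + (qi i.+1)%:Z < 2 * D%:Z + 6 ->
  (graded_dim k q D)%:Z = Yz (3 * q%:Z - 3 - D%:Z) +
    \sum_(t < i) nu p 2 * nu p 1 ^+ t * Yz (tdeg t.+1).
Proof.
move=> si hD; have q0 : (0 < q)%N by rewrite expn_gt0 prime_gt0.
(* Beyond the socle degree [5 (q - 1)] both sides are [0]. *)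
have [D5|D5] := leqP D (5 * q.-1); last first.
  rewrite graded_top // Yz_neg; last by lia.
  rewrite big1 ?addr0 // => t _; rewrite Yz_neg ?mulr0 //.
  have := tdegE pp p5 D (s := s) (i := t.+1); have := expn_sub_le pp s t.+1; have := ltn_ord t; lia.
have -> : (graded_dim k q D)%:Z = kdz k q (5 * q%:Z - 5 - D%:Z).
  by rewrite kdz_graded //; lia.
have ph := p_half pp p5; have e := expn_pred p (ltnW si).
have sE := shiftE (5 * q%:Z - 5 - D%:Z) (ltnW (ltnW si)).
have -> : 3 * q%:Z - 3 - D%:Z = 5 * q%:Z - 5 - D%:Z + 2 - 2 * q%:Z by lia.
rewrite [RHS]addrC; apply/eqP; rewrite -subr_eq -/(Nz q (5 * q%:Z - 5 - D%:Z)) (Nz_iter (i := i)) ?(ltnW si) //.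
  have e1 : (qi i.+1 = p ^ (s - i.+2).+1)%N by congr (_ ^ _)%N; lia.
  rewrite e (Nz0 pp pch p5 e1) ?mulr0 ?addr0 //.
  move: sE hD; rewrite e; move: (shift _ _ _) (p ^ (s - i.+1))%N => y b; nia.
apply/implyP => _; move: sE hD; have := expn_sub_gt0 pp s i.+1; rewrite e.
by move: (shift _ _ _) (p ^ (s - i.+1))%N => y b; nia.
Qed.

(** After [i] steps the remaining [Nz] need not vanish, but the dual degree [bdeg i] at that level
    is in the range of [graded_base], which computes it. *)
Lemma graded_mid i : (i.+1 < s)%N -> 2 * D%:Z + (qi i.+1)%:Z < 5 * q%:Z ->
  5 * q%:Z - (qi i)%:Z < 2 * D%:Z + 6 ->
  (graded_dim k q D)%:Z = Yz (3 * q%:Z - 3 - D%:Z) +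
    \sum_(t < i) nu p 2 * nu p 1 ^+ t * Yz (tdeg t.+1)
    + nu p 1 ^+ i * (base (qi i) (bdeg i) - Yz (tdeg i)).
Proof.
move=> si hD hD'; have q0 : (0 < q)%N by rewrite expn_gt0 prime_gt0.
have ph := p_half pp p5; have e := expn_pred p (ltnW si).
have e' : qi i.+1 = (p ^ ((s - i) - 1))%N by congr (_ ^ _)%N; lia.
have le_q := expn_sub_le pp s i; have q1 := expn_sub_gt0 pp s i.+1.
have q2 : (5 <= qi i)%N by rewrite e; nia.
have -> : (graded_dim k q D)%:Z = kdz k q (5 * q%:Z - 5 - D%:Z).
  by rewrite kdz_graded //; lia.
have sE := shiftE (5 * q%:Z - 5 - D%:Z) (ltnW (ltnW si)).
have bE := bdegE pp p5 D (ltnW (ltnW si)).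
have -> : 3 * q%:Z - 3 - D%:Z = 5 * q%:Z - 5 - D%:Z + 2 - 2 * q%:Z by lia.
rewrite -[RHS]addrA [RHS]addrC; apply/eqP;
  rewrite -subr_eq -/(Nz q (5 * q%:Z - 5 - D%:Z)) (Nz_iter (i := i)) ?(ltnW si) //.
  apply/eqP; congr (_ + _ * (_ - _)).
  have -> : shift s (5 * q%:Z - 5 - D%:Z) i = 5 * (qi i)%:Z - 5 - bdeg i by rewrite /bdeg; lia.
  have b0 : 0 <= bdeg i by lia.
  rewrite kdz_graded //; last by lia.
  have -> : bdeg i = `|bdeg i|%N%:Z by lia.
  by rewrite absz_nat graded_base //; lia.
by apply/implyP => _; lia.
Qed.

End Degree.
End ClosedForms.

(** * Limits *)

Section Limits.
Variables (R : archiRealFieldType) (p : nat).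
Hypothesis p_gt1 : (1 < p)%N.
Local Notation q s := ((p ^ s)%N%:R : R).
Implicit Types (u v : nat -> R) (x y l : R).

(* Convergence at rate [O(1 / q)]: stable under linear combinations without epsilons. *)
Definition rate_cvg u l :=
  exists E N, forall s, (N <= s)%N -> `|u s - l| * q s <= E.

Lemma q_ge1 s : 1 <= q s.
Proof. by rewrite ler1n expn_gt0 (ltnW p_gt1). Qed.

Lemma rate_cvgP u l : rate_cvg u l -> seq_cvg u l.
Proof.
case=> E [N h] eps e0; pose n := (Num.truncn (`|E| / eps)).+1.
exists (maxn N n) => s; rewrite geq_max => /andP[Ns ns].
have q0 : 0 < q s := lt_le_trans ltr01 (q_ge1 s).
rewrite -(ltr_pM2r q0); apply: le_lt_trans (h s Ns) _.
apply: le_lt_trans (ler_norm E) _; rewrite mulrC -ltr_pdivrMr //.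
have [_] : (Num.truncn (`|E| / eps))%:R <= `|E| / eps /\ `|E| / eps < n%:R.
  by split; [rewrite truncn_le ?divr_ge0 // ltW | rewrite truncnS_gt].
move=> /lt_le_trans; apply; rewrite ler_nat; apply: leq_trans ns _.
exact: ltnW (ltn_expl s p_gt1).
Qed.

Lemma rate_cvg_ext N u v l : (forall s, (N <= s)%N -> u s = v s) ->
  rate_cvg v l -> rate_cvg u l.
Proof.
move=> uv [E [M h]]; exists E, (maxn N M) => s; rewrite geq_max => /andP[Ns Ms].
by rewrite uv ?h.
Qed.

Lemma rate_cvgD u v l l' : rate_cvg u l -> rate_cvg v l' -> rate_cvg (fun s => u s + v s) (l + l').
Proof.
move=> [E [M h]] [E' [M' h']]; exists (E + E'), (maxn M M') => s.
rewrite geq_max => /andP[Ms Ms']; apply: le_trans (lerD (h s Ms) (h' s Ms')).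
rewrite -mulrDl ler_wpM2r //; apply: le_trans (ler_normD _ _).
by rewrite opprD addrACA.
Qed.

Lemma rate_cvgZ c u l : rate_cvg u l -> rate_cvg (fun s => c * u s) (c * l).
Proof.
move=> [E [M h]]; exists (`|c| * E), M => s Ms.
by rewrite -mulrBr normrM -mulrA ler_wpM2l ?h.
Qed.

Lemma rate_cvg0 : rate_cvg (fun=> 0) 0.
Proof. by exists 0, 0%N => s _; rewrite subrr normr0 mul0r. Qed.

Lemma rate_cvg_sum n (F : nat -> nat -> R) (l : nat -> R) : (forall i, rate_cvg (F i) (l i)) ->
  rate_cvg (fun s => \sum_(i < n) F i s) (\sum_(i < n) l i).
Proof.
move=> h; elim: n => [|n IH].
  by rewrite big_ord0; apply: (@rate_cvg_ext 0%N) rate_cvg0 => s _; rewrite big_ord0.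
rewrite big_ord_recr; apply: (@rate_cvg_ext 0%N) (rate_cvgD IH (h n)) => s _.
by rewrite big_ord_recr.
Qed.

(** [Yz] vanishes in negative degrees, so it grows like the cube of a positive part; one limit then
    serves on both sides of a breakpoint. *)
Definition pos (y : R) : R := Num.max y 0.

Lemma pos_id y : 0 <= y -> pos y = y.
Proof. by move=> y0; apply/max_idPl. Qed.

Lemma pos_0 y : y <= 0 -> pos y = 0.
Proof. by move=> y0; apply/max_idPr. Qed.

Lemma pos_ge0 y : 0 <= pos y.
Proof. by rewrite le_max lexx orbT. Qed.

Lemma pos_lip x y : `|pos x - pos y| <= `|x - y|.
Proof.
rewrite /pos; case: (lerP x 0) => hx; case: (lerP y 0) => hy; rewrite ?subrr ?normr0 //.
- by rewrite !ler0_norm; lra.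
- by rewrite !ger0_norm; lra.
Qed.

(** For [m >= 0] the difference is [9 m^2 + 13 m + 6]. *)
Lemma Yz_pos (m : int) : let M := pos m%:~R in
  `|6 * (Yz m)%:~R - 2 * M ^+ 3| <= 9 * (M + 1) ^+ 2.
Proof.
rewrite /=; have [m0|m0] := ltrP m 0.
  rewrite Yz_neg // pos_0 ?lerz0 ?ltW //.
  by rewrite mulr0z mulr0 expr0n /= mulr0 subr0 normr0; lra.
rewrite pos_id ?ler0z //; have := congr1 (fun z : int => z%:~R : R) (Yz_poly (_ : -3 < m)).
rewrite !(rmorphM, rmorphD) /= => ->; last by lia.
have : (0 : R) <= m%:~R by rewrite ler0z.
move: (m%:~R : R) => M M0; rewrite ger0_norm; nra.
Qed.

(** Replacing [D s] by [y] times the level in the cube costs the square of the level, by factoring a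
    difference of cubes. *)
Lemma rate_cvg_Yz (D : nat -> int) y C N :
  (forall s, (N <= s)%N -> `|(D s)%:~R - y * q s| <= C) ->
  rate_cvg (fun s => (Yz (D s))%:~R / (((p ^ s) ^ 3)%N)%:R) (pos y ^+ 3 / 3).
Proof.
move=> hD; pose B := pos y + C.
exists ((9 * (B + 1) ^+ 2 + 2 * (C * (3 * B ^+ 2))) / 6), N => s Ns.
have q1 := q_ge1 s; have q0 : 0 < q s := lt_le_trans ltr01 q1.
have h1 := Yz_pos (D s); rewrite natrX.
have posq : pos (y * q s) = pos y * q s.
  by rewrite /pos maxr_pMl ?mul0r // ltW.
have := le_trans (pos_lip (D s)%:~R (y * q s)) (hD s Ns); rewrite posq.
move: h1 (pos_ge0 (D s)%:~R) (pos_ge0 y); rewrite /B.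
move: (pos (D s)%:~R) (pos y) ((Yz _)%:~R : R) (q s) q0 q1 => M Y Z r r0 r1 h1 M0 Y0 hM.
have C0 : 0 <= C := le_trans (normr_ge0 _) hM.
have -> : Z / r ^+ 3 - Y ^+ 3 / 3 = (6 * Z - 2 * (Y * r) ^+ 3) / (6 * r ^+ 3).
  by field; rewrite gt_eqF.
rewrite normrM normfV (ger0_norm (_ : 0 <= 6 * r ^+ 3)); last by rewrite mulr_ge0 ?exprn_ge0 ?ltW.
have -> : `|6 * Z - 2 * (Y * r) ^+ 3| / (6 * r ^+ 3) * r =
    `|6 * Z - 2 * (Y * r) ^+ 3| / r ^+ 2 / 6 by field; rewrite gt_eqF.
rewrite ler_wpM2r ?invr_ge0 // ler_pdivrMr ?exprn_gt0 //.
have MB : M <= (Y + C) * r.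
  have : M - Y * r <= C by apply: le_trans (ler_norm _) hM.
  by nra.
have h2 : `|M ^+ 3 - (Y * r) ^+ 3| <= C * (3 * ((Y + C) * r) ^+ 2).
  rewrite subrXX normrM !big_ord_recr big_ord0 /= add0r.
  apply: ler_pM => //; rewrite ?subn0 ?subnn ?expr0 ?mulr1 ?mul1r ?expr1.
  have Yr0 : 0 <= Y * r by apply: mulr_ge0 => //; apply: ltW.
  have YB : Y * r <= (Y + C) * r by apply: ler_wpM2r; [apply: ltW | rewrite lerDl].
  rewrite ger0_norm; last by nra.
  by move: Yr0 YB MB; move: (Y * r) ((Y + C) * r) => a b; nra.
apply: le_trans (_ : 9 * (M + 1) ^+ 2 + 2 * `|M ^+ 3 - (Y * r) ^+ 3| <= _).
  have -> : 6 * Z - 2 * (Y * r) ^+ 3 = (6 * Z - 2 * M ^+ 3) + 2 * (M ^+ 3 - (Y * r) ^+ 3) by ring.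
  apply: le_trans (ler_normD _ _) _; rewrite normrM (ger0_norm (_ : 0 <= 2)) //.
  exact: lerD.
have h3 : (M + 1) ^+ 2 <= ((Y + C + 1) * r) ^+ 2.
  by rewrite ler_sqr ?nnegrE; nra.
nra.
Qed.

End Limits.

(** * The density on each interval *)

Section Density.
Variables (k : fieldType) (p : nat) (R : archiRealFieldType).
Hypotheses (pp : prime p) (pch : p \in [pchar k]) (p5 : (5 <= p)%N).
Local Notation q s := ((p ^ s)%N%:R : R).
Local Notation w i := ((p%:R ^+ i)^-1 : R).
Local Notation rcvg := (@rate_cvg R p).

Lemma p_neq0 : p%:R != 0 :> R.
Proof. by rewrite pnatr_eq0 -lt0n prime_gt0. Qed.

Lemma w_gt0 i : 0 < w i.
Proof. by rewrite invr_gt0 exprn_gt0 // ltr0n prime_gt0. Qed.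

Lemma w_anti i j : (i <= j)%N -> w j <= w i.
Proof.
move=> ij; rewrite lef_pV2 ?posrE ?exprn_gt0 ?ltr0n ?prime_gt0 //.
by rewrite ler_weXn2l // ler1n prime_gt0.
Qed.

Lemma w0 : w 0 = 1.
Proof. by rewrite expr0 invr1. Qed.

Lemma w_le1 i : w i <= 1.
Proof. by have := @w_anti 0 i isT; rewrite w0. Qed.

Lemma q_sub s i : (i <= s)%N -> (p ^ (s - i))%N%:R = q s * w i.
Proof. by move=> si; rewrite -{2}(subnK si) expnD natrM !natrX mulfK // expf_neq0 ?p_neq0. Qed.

(** A geometric sum; it brings the breakpoints into their form symmetric about [5/2]. *)
Lemma Pi_closed i : Pi R p i = (1 - w i) / 2.
Proof.
rewrite /Pi; elim: i => [|i IH]; first by rewrite big_ord0 mulr0 w0 subrr mul0r.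
rewrite big_ord_recr /= mulrDr IH exprS.
by field; rewrite expf_neq0 ?p_neq0.
Qed.

Lemma tailsumE j x : tailsum p j x = (3 - x) ^+ 3 / 3 +
  \sum_(t < j) 4 * mu R p * mubar R p ^+ t * ((5 / 2 + w t.+1 / 2 - x) ^+ 3 / 3).
Proof.
rewrite /tailsum big_add1 /= big_mkord mulr_sumr; congr (_ + _).
by apply: eq_bigr => t _; rewrite Pi_closed; field; rewrite ?expf_neq0 ?p_neq0.
Qed.

Section Point.
Variable x : R.
Hypothesis x_ge0 : 0 <= x.
Local Notation D s := (Num.truncn (x * q s)).
Local Notation u :=
  (fun s : nat => (graded_dim k (p ^ s) (D s))%:R / ((p ^ s) ^ 3)%:R : R).

Lemma D_itv s : (D s)%:R <= x * q s < (D s)%:R + 1.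
Proof. by rewrite natr1 truncn_itv ?mulr_ge0. Qed.

Lemma cvg_top : rcvg (fun s => (Yz (3 * (p ^ s)%N%:Z - 3 - (D s)%:Z))%:~R / ((p ^ s) ^ 3)%:R)
  (pos (3 - x) ^+ 3 / 3).
Proof.
(* [4] covers the constant [3] and the rounding in [D s]. *)
apply: (rate_cvg_Yz (prime_gt1 pp) (C := 4) (N := 0)) => s _.
have := D_itv s; rewrite !(rmorphB, rmorphM) /= -!pmulrn => /andP[h1 h2].
by rewrite ler_norml; lra.
Qed.

Lemma cvg_tdeg i : rcvg (fun s => (Yz (tdeg p s (D s) i))%:~R / ((p ^ s) ^ 3)%:R)
  (pos (5 / 2 + w i / 2 - x) ^+ 3 / 3).
Proof.
apply: (rate_cvg_Yz (prime_gt1 pp) (C := 4) (N := i)) => s si.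
have := congr1 (fun z : int => z%:~R : R) (tdegE pp p5 (D s) si).
rewrite !(rmorphB, rmorphD, rmorphM) /= -!pmulrn q_sub //.
by have := D_itv s => /andP[h1 h2] e; rewrite ler_norml; lra.
Qed.

Lemma bdeg_approx s i : (i <= s)%N ->
  `|(bdeg p s (D s) i)%:~R - (x - 5 / 2 + 5 / 2 * w i) * q s| <= 1.
Proof.
move=> si; have := congr1 (fun z : int => z%:~R : R) (bdegE pp p5 (D s) si).
rewrite !(rmorphB, rmorphD, rmorphM) /= -!pmulrn q_sub //.
by have := D_itv s => /andP[h1 h2] e; rewrite ler_norml; lra.
Qed.

Lemma cvg_base (B : nat -> int) i y :
  (forall s, (i <= s)%N -> `|(B s)%:~R - y * q s| <= 1) ->
  rcvg (fun s => (base (p ^ (s - i)) (B s))%:~R / ((p ^ s) ^ 3)%:R)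
    (pos y ^+ 3 / 3 - 5 * (pos (y - w i) ^+ 3 / 3) + 11 * (pos (y - 2 * w i) ^+ 3 / 3)).
Proof.
move=> hB; have p1 := prime_gt1 pp.
have c0 := rate_cvg_Yz p1 hB.
have c1 : rcvg (fun s => (Yz (B s - (p ^ (s - i))%N%:Z))%:~R / ((p ^ s) ^ 3)%:R)
    (pos (y - w i) ^+ 3 / 3).
  apply: (rate_cvg_Yz p1 (C := 1) (N := i)) => s si; apply: le_trans (hB s si).
  rewrite rmorphB /= -pmulrn q_sub // le_eqVlt; apply/orP; left; apply/eqP.
  by congr `|_|; ring.
have c2 : rcvg (fun s => (Yz (B s - 2 * (p ^ (s - i))%N%:Z))%:~R / ((p ^ s) ^ 3)%:R)
    (pos (y - 2 * w i) ^+ 3 / 3).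
  apply: (rate_cvg_Yz p1 (C := 1) (N := i)) => s si; apply: le_trans (hB s si).
  rewrite rmorphB rmorphM /= -!pmulrn q_sub // le_eqVlt; apply/orP; left; apply/eqP.
  by congr `|_|; ring.
rewrite -mulNr; apply: (rate_cvg_ext (N := 0)) (rate_cvgD (rate_cvgD c0 (rate_cvgZ (-5) c1)) (rate_cvgZ 11 c2)).
move=> s _ /=; rewrite /base !(rmorphB, rmorphD, rmorphM) /= -!pmulrn; ring.
Qed.

Lemma cvg_terms i : rcvg (fun s => (Yz (3 * (p ^ s)%N%:Z - 3 - (D s)%:Z) +
    \sum_(t < i) nu p 2 * nu p 1 ^+ t * Yz (tdeg p s (D s) t.+1))%:~R / ((p ^ s) ^ 3)%:R)
  (pos (3 - x) ^+ 3 / 3 +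
  \sum_(t < i) 4 * mu R p * mubar R p ^+ t * (pos (5 / 2 + w t.+1 / 2 - x) ^+ 3 / 3)).
Proof.
have c t := rate_cvgZ (4 * mu R p * mubar R p ^+ t) (cvg_tdeg t.+1).
apply: (rate_cvg_ext (N := 0)) (rate_cvgD cvg_top (rate_cvg_sum i c)) => s _.
rewrite rmorphD rmorph_sum mulrDl mulr_suml; congr (_ + _); apply: eq_bigr => t _ /=.
by rewrite !intrM rmorphXn /= nu2_mu // nu1_mubar // -!mulrA.
Qed.

Lemma cvg_high i : 5 / 2 + w i.+1 / 2 <= x -> rcvg u (pos (3 - x) ^+ 3 / 3 +
  \sum_(t < i) 4 * mu R p * mubar R p ^+ t * (pos (5 / 2 + w t.+1 / 2 - x) ^+ 3 / 3)).
Proof.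
move=> hx; apply: (rate_cvg_ext (N := i.+2)) (cvg_terms i) => s si.
rewrite pmulrn -(graded_high pp pch p5 si) //.
(* The slack [6] in [graded_high] absorbs the rounding, so that the left endpoint is included. *)
rewrite -(ltr_int R) !(rmorphB, rmorphD, rmorphM) /= -!pmulrn (q_sub (ltnW si)) //.
have /andP[h1 h2] := D_itv s.
have := ler_wpM2r (ler0n R (p ^ s)) hx; lra.
Qed.

Lemma cvg_mid i : 5 / 2 - w i / 2 <= x < 5 / 2 - w i.+1 / 2 ->
  let y := x - 5 / 2 + 5 / 2 * w i in
  rcvg u (pos (3 - x) ^+ 3 / 3 +
  \sum_(t < i) 4 * mu R p * mubar R p ^+ t * (pos (5 / 2 + w t.+1 / 2 - x) ^+ 3 / 3)
  + mubar R p ^+ i * (pos y ^+ 3 / 3 - 5 * (pos (y - w i) ^+ 3 / 3)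
     + 11 * (pos (y - 2 * w i) ^+ 3 / 3) - pos (5 / 2 + w i / 2 - x) ^+ 3 / 3)).
Proof.
move=> /andP[x1 x2] y; have cb := cvg_base (fun s si => bdeg_approx si).
have := rate_cvgD (cvg_terms i) (rate_cvgZ (mubar R p ^+ i) (rate_cvgD (cb i) (rate_cvgZ (-1) (cvg_tdeg i)))).
rewrite mulN1r; apply: (rate_cvg_ext (N := i.+2)) => s si.
have /andP[h1 h2] := D_itv s; have q0 : 0 < q s by rewrite ltr0n expn_gt0 prime_gt0.
rewrite [LHS]/= pmulrn (graded_mid pp pch p5 si).
- move: (Yz _ + _) (base _ _) (Yz (tdeg _ _ _ i)) (((p ^ s) ^ 3)%N%:R : R) => a b c d.
  by rewrite intrD intrM rmorphXn rmorphB /= nu1_mubar //; ring.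
- rewrite -(ltr_int R) !(rmorphB, rmorphD, rmorphM) /= -!pmulrn (q_sub (ltnW si)) //.
  by have : x * q s < (5 / 2 - w i.+1 / 2) * q s; [rewrite ltr_pM2r | lra].
- rewrite -(ltr_int R) !(rmorphB, rmorphD, rmorphM) /= -!pmulrn (q_sub (ltnW (ltnW si))) //.
  have := ler_wpM2r (ltW q0) x1; lra.
Qed.

Lemma cvg_low : x < 5 / 2 - w 1 / 2 ->
  rcvg u (x ^+ 3 / 3 - 5 / 3 * pos (x - 1) ^+ 3 + 11 / 3 * pos (x - 2) ^+ 3).
Proof.
move=> hx; have cb : forall s, (0 <= s)%N -> `|((D s)%:Z)%:~R - x * q s| <= 1.
  by move=> s _; have /andP[h1 h2] := D_itv s; rewrite -pmulrn ler_norml; lra.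
have := cvg_base cb; rewrite w0 mulr1 (pos_id x_ge0).
rewrite -[5 / 3 * _]mulrA -[11 / 3 * _]mulrA ![3^-1 * _]mulrC.
apply: (rate_cvg_ext (N := 2)) => s s2; rewrite subn0 pmulrn (graded_base pp pch p5) //.
rewrite -(ltr_int R) !(rmorphB, rmorphD, rmorphM) /= -!pmulrn (q_sub (ltnW s2)) //.
have /andP[h1 h2] := D_itv s; have q0 : 0 < q s by rewrite ltr0n expn_gt0 prime_gt0.
by have : x * q s < (5 / 2 - w 1 / 2) * q s; [rewrite ltr_pM2r | lra].
Qed.

Lemma density_of l l' : rcvg u l -> l = l' -> HK_density_at k p x l'.
Proof. by move=> ul <-; apply: rate_cvgP ul; apply: prime_gt1. Qed.

End Point.
End Density.

Theorem theorem5p2 (k : fieldType) (p : nat) (R : archiRealFieldType) :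
  prime p -> (5 <= p)%N -> perfect_char k p ->
  let f := HK_density_at k p (R:=R) in
  let pr : R := p%:R in
  (forall x : R, 0 <= x < 1 -> f x (x ^+ 3 / 3)) /\
  (forall x : R, 1 <= x < 2 -> f x (x ^+ 3 / 3 - 5 / 3 * (x - 1) ^+ 3)) /\
  (forall x : R, 2 <= x < 2 + Pi R p 1 ->
     f x (x ^+ 3 / 3 - 5 / 3 * (x - 1) ^+ 3 + 11 / 3 * (x - 2) ^+ 3)) /\
  (forall (j : nat) (x : R), (1 <= j)%N ->
     2 + Pi R p j <= x < 2 + Pi R p j.+1 ->
     f x (tailsum p j x +
          (8 / 3 * (x - 2 - Pi R p j) ^+ 3
           - 4 / pr ^+ j * (x - 2 - Pi R p j) ^+ 2
           + 2 / (3 * pr ^+ (3 * j))) * mubar R p ^+ j)) /\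
  (forall (j : nat) (x : R), (1 <= j)%N ->
     2 + Pi R p j.+1 + (pr ^+ j.+1)^-1 <= x < 2 + Pi R p j + (pr ^+ j)^-1 ->
     f x (tailsum p j x)) /\
  (forall x : R, 2 + Pi R p 1 + pr^-1 <= x < 3 -> f x ((3 - x) ^+ 3 / 3)) /\
  (forall x : R, 3 <= x -> f x 0).
Proof.
move=> pp p5 [pch _] f pr.
have w_pos i : 0 < (pr ^+ i)^-1 := w_gt0 R pp i.
have w_le i : (pr ^+ i)^-1 <= 1 := w_le1 R pp i.
have low := @cvg_low k p R pp pch p5; have mid := @cvg_mid k p R pp pch p5.
have high := @cvg_high k p R pp pch p5; have dens := @density_of k p R pp.
have PiE := Pi_closed R pp; have p0 := p_neq0 R pp.
split; [|split; [|split; [|split; [|split; [|split]]]]].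
- move=> x /andP[x0 x1]; apply: dens (low x x0 _) _; first by have := w_le 1%N; rewrite /pr; lra.
  by rewrite !pos_0; [ring | lra..].
- move=> x /andP[x1 x2]; apply: dens (low x _ _) _; [lra | by have := w_le 1%N; rewrite /pr; lra |].
  by rewrite (pos_id (y := x - 1)) ?pos_0; [ring | lra..].
- move=> x; rewrite PiE => /andP[x2 xP]; apply: dens (low x _ _) _; [lra | lra |].
  by rewrite !pos_id; lra.
- move=> j x j1; rewrite !PiE => /andP[xj xj1].
  have x0 : 0 <= x by have := w_le j; rewrite /pr; lra.
  have wj := w_pos j; have wj1 := w_pos j.+1; rewrite /pr in wj wj1.
  apply: dens (mid x x0 j _) _; first by apply/andP; split; lra.
  rewrite tailsumE // [X in X = _]addrC [X in _ = X]addrC; congr (_ + _).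
    (* With [X = x - 2 - P_j] and [w = 1/p^j] the cubes are those of [X + 2w], [X + w], [X] and
       [w - X]; in their combination the term [X w^2] cancels. *)
    rewrite !pos_id; [|lra..]; rewrite mulrC; congr (_ * _).
    rewrite /pr mulnC exprM; have := expf_neq0 j p0; move: (p%:R ^+ j) => a a0; field.
    by rewrite a0.
  rewrite pos_id; last lra; congr (_ + _); apply: eq_bigr => t _.
  by rewrite pos_id //; have := w_pos t.+1; rewrite /pr; lra.
- move=> j x j1; rewrite !PiE => /andP[xj xj1].
  have x0 : 0 <= x by have := w_pos j.+1; rewrite /pr; lra.
  have wj := w_le j; rewrite /pr in wj.
  apply: dens (high x x0 j _) _; first by move: xj; rewrite /pr; lra.
  rewrite tailsumE // pos_id; last by move: xj1; rewrite /pr; lra.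
  congr (_ + _); apply: eq_bigr => t _; rewrite pos_id //.
  have : (pr ^+ j)^-1 <= (pr ^+ t.+1)^-1 by apply: w_anti => //; apply: ltn_ord.
  by move: xj1; rewrite /pr; lra.
- move=> x; rewrite PiE => /andP[xl x3].
  have x0 : 0 <= x by have := w_pos 1%N; move: xl; rewrite /pr expr1; lra.
  apply: dens (high x x0 0%N _) _; first by move: xl; rewrite /pr expr1; lra.
  by rewrite big_ord0 addr0 pos_id //; lra.
- move=> x x3; have x0 : 0 <= x by lra.
  apply: dens (high x x0 0%N _) _; first by have := w_le 1%N; rewrite /pr; lra.
  by rewrite big_ord0 addr0 pos_0; [rewrite expr0n mul0r | lra].
Qed.
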